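(* Let $U\subset\mathbb{C}^N$ be a domain and $V=\{x''=0\}\subset U$ a linear complex submanifold of codimension $n$, bounded and simply connected with smooth boundary. Let $T$ be a positive closed $(p,p)$-current on $U$ admitting a tangent current $T_\infty$ along $V$. Let $m\in\{\max\{n-p,0\},\dots,\min\{N-p,n\}\}$. Suppose that the family $\big(T\wedge\mathcal K_\theta^m\wedge\pi_V^*\omega_V^{N-p-m}\big)_{0<|\theta|\ll1}$ of currents of order $0$ of maximal bidegree has locally uniformly bounded mass in $U$. Then, for every smooth test $(N-p-m,N-p-m)$-form $\varphi$ on $V$, there exists a sequence $(\theta_k)_{k\in\mathbb{N}}\subset\mathbb{C}^*$ converging to $0$ such that the sequence $\big(T\wedge\mathcal K_{\theta_k}^m\wedge\pi_V^*\varphi\big)_{k\in\mathbb{N}}$ converges to a current $L_\varphi$ of order $0$ of maximal bidegree satisfying $$\langle\mathbf 1_VL_\varphi,1\rangle=\big\langle(\pi_V)_*(T_\infty\wedge\pi_F^*\Omega_m),\varphi\big\rangle .$$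
   Context: Conventions: $dd^c=\frac i\pi\partial\bar\partial$; test forms have compact support. Coordinates on $U\subset\mathbb{C}^N$ are $x=(x',x'')$ with $x'\in\mathbb{C}^{N-n}$, $x''\in\mathbb{C}^n$ ($1\le n\le N$). $E=V\times\mathbb{C}^n$ is the normal bundle of $V$, $\overline E=V\times\mathbb{P}^n$ with $\mathbb{C}^n\subset\mathbb{P}^n$ via $x''\mapsto[x'':1]$, and $\pi_V:\overline E\to V$, $\pi_F:\overline E\to\mathbb{P}^n$ are the projections; $U$ is regarded as an open subset of $E$. $\omega_V=dd^c|x'|^2$ (when $n=N$, $V$ is a point, necessarily $N-p-m=0$, and $\varphi$ is a function). Fix a smooth convex increasing $\chi:\mathbb{R}\to\mathbb{R}_{\ge0}$ with $\chi(t)=0$ for $t\le-1$, $\chi(t)=t$ for $t\ge1$. Let $u(x)=\log|x''|$, and for $\theta\in\mathbb{C}^*$, $u_\theta^{\mathcal K}=\chi(u-\log|\theta|)+\log|\theta|$, $\mathcal K_\theta^m=dd^cu_\theta^{\mathcal K}\wedge(dd^cu)^{m-1}$ for $1\le m\le n$, $\mathcal K^0_\theta=1$. Fix a sufficiently large $M>0$. Let $\alpha$ be the smooth positive closed $(1,1)$-form on $\mathbb{P}^n$ equal to $dd^c\chi(\log|x''|+M)$ on $\mathbb{C}^n$ and to $dd^c\log|x''|$ near $\mathbb{P}^n\setminus\mathbb{C}^n$ (homogeneous coordinates $[x'':t]$), and $\Omega_m:=\alpha\wedge(dd^c\log|x''|)^{m-1}$ for $1\le m\le n$, $\Omega_0:=1$;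 these are smooth positive closed $(m,m)$-forms on $\mathbb{P}^n$. Tangent currents: for $\lambda\in\mathbb{C}^*$, $A_\lambda:E\to E$ is $(x',x'')\mapsto(x',\lambda x'')$. A tangent current of $T$ along $V$ is a positive closed current $T_\infty$ on $E$ with $T_\infty=\lim_j(A_{\lambda_j})_*(\mathbf 1_UT)$ on $E$ for some sequence $\lambda_j\to\infty$ in $\mathbb{C}^*$; it is extended by zero to $\overline E$. *)

(* Defs.v *)
From HB Require Import structures.
From mathcomp Require Import all_boot all_order all_algebra.
From mathcomp Require Import all_classical all_reals all_analysis.
From mathcomp Require Import complex.

Set Implicit Arguments.
Unset Strict Implicit.
Unset Printing Implicit Defensive.

Import Order.TTheory GRing.Theory Num.Theory.
Import numFieldNormedType.Exports.

Local Open Scope classical_set_scope.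
Local Open Scope ring_scope.


(* Declaring the structure keeps the topology that MathComp-Analysis puts on
   every numClosedFieldType available on the complex numbers R[i]. *)
Definition Cplx (R : realType) : numClosedFieldType := R[i].

Definition Cn (R : realType) (N : nat) := 'rV[Cplx R]_N.

Definition toC (R : realType) (a : R) : Cplx R := (a%:C)%C.
Definition reC (R : realType) (z : Cplx R) : R := complex.Re z.
Definition imC (R : realType) (z : Cplx R) : R := complex.Im z.
Definition modC (R : realType) (z : Cplx R) : R := reC `|z|.

(** * Smooth functions on C^N, identified with R^2N *)

(* (j, false) is the direction of Re z_j and (j, true) that of Im z_j. *)
Definition rdir (R : realType) N (s : 'I_N * bool) : Cn R N :=
  (if s.2 then 'i%R else 1 : Cplx R) *: delta_mx 0 s.1.

Definition along (R : realType) N (s : 'I_N * bool) (x : Cn R N) (t : R) :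
  Cn R N := x + toC t *: rdir R s.

Definition rderiv (R : realType) N (s : 'I_N * bool) (f : Cn R N -> Cplx R)
    (x : Cn R N) : Cplx R :=
  toC (derive1 (fun t : R => reC (f (along s x t))) 0)
  + 'i * toC (derive1 (fun t : R => imC (f (along s x t))) 0).

Definition rderivable (R : realType) N (s : 'I_N * bool)
    (f : Cn R N -> Cplx R) (x : Cn R N) : Prop :=
  derivable (fun t : R => reC (f (along s x t))) 0 1 /\
  derivable (fun t : R => imC (f (along s x t))) 0 1.

Definition rderivs (R : realType) N (l : seq ('I_N * bool))
    (f : Cn R N -> Cplx R) : Cn R N -> Cplx R :=
  foldr (@rderiv R N) f l.

(* C^oo on an open set: all iterated partial derivatives exist and are
   continuous. *)
Definition smooth_on (R : realType) N (W : set (Cn R N))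
    (f : Cn R N -> Cplx R) : Prop :=
  forall (l : seq ('I_N * bool)) (x : Cn R N), W x ->
    {for x, continuous (rderivs l f)} /\
    forall s, rderivable s (rderivs l f) x.

Definition wirt (R : realType) N (j : 'I_N) (f : Cn R N -> Cplx R)
    (x : Cn R N) : Cplx R :=
  (rderiv (j, false) f x - 'i * rderiv (j, true) f x) / 2.

Definition wirtbar (R : realType) N (j : 'I_N) (f : Cn R N -> Cplx R)
    (x : Cn R N) : Cplx R :=
  (rderiv (j, false) f x + 'i * rderiv (j, true) f x) / 2.

(** * Differential forms *)

(* Complex exterior algebra on dz_0, .., dz_(N-1), dzbar_0, .., dzbar_(N-1):
   the index lshift N j stands for dz_j and rshift N j for dzbar_j, and S
   indexes the wedge product of the corresponding covectors in increasing
   order. *)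
Definition covec (R : realType) N := {ffun {set 'I_(N + N)} -> Cplx R}.

Definition ecov (R : realType) N (S : {set 'I_(N + N)}) : covec R N :=
  [ffun A => (A == S)%:R].

(* (-1) to the number of inversions between A and B *)
Definition wsign (R : realType) N (A B : {set 'I_(N + N)}) : Cplx R :=
  (-1) ^+ #|[set ab in finset.setX A B | (ab.2 < ab.1)%N]%SET|.

Definition wedge (R : realType) N (a b : covec R N) : covec R N :=
  [ffun S : {set 'I_(N + N)} =>
    \sum_(A : {set 'I_(N + N)} | A \subset S)
      wsign R A (S :\: A)%SET * a A * b (S :\: A)%SET].

Definition cform (R : realType) N := Cn R N -> covec R N.

Definition wform (R : realType) N (a b : cform R N) : cform R N :=
  fun x => wedge (a x) (b x).

Definition zform (R : realType) N (f : Cn R N -> Cplx R) : cform R N :=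
  fun x => f x *: ecov R finset.set0.

Definition wpow (R : realType) N (a : cform R N) (k : nat) : cform R N :=
  iter k (wform a) (zform (fun=> 1)).

Definition bidegree_covec (R : realType) N (k l : nat) (c : covec R N) : Prop :=
  forall S, c S != 0 ->
    #|[set j : 'I_N | lshift N j \in S]%SET| = k /\
    #|[set j : 'I_N | rshift N j \in S]%SET| = l.

Definition bidegree (R : realType) N (k l : nat) (w : cform R N) : Prop :=
  forall x, bidegree_covec k l (w x).

Definition smooth_form (R : realType) N (W : set (Cn R N)) (w : cform R N) :
  Prop := forall S, smooth_on W (fun x => w x S).

Definition del (R : realType) N (w : cform R N) : cform R N := fun x =>
  \sum_(j < N) wedge (ecov R [set lshift N j]%SET)
    [ffun S => wirt j (fun y => w y S) x].

Definition delbar (R : realType) N (w : cform R N) : cform R N := fun x =>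
  \sum_(j < N) wedge (ecov R [set rshift N j]%SET)
    [ffun S => wirtbar j (fun y => w y S) x].

Definition dform (R : realType) N (w : cform R N) : cform R N := fun x =>
  del w x + delbar w x.

Definition ddc (R : realType) N (w : cform R N) : cform R N := fun x =>
  ('i / toC pi) *: del (delbar w) x.

(* The coordinate z_j or its conjugate, so that dform of it is the covector of
   index a. *)
Definition coordf (R : realType) N (a : 'I_(N + N)) (y : Cn R N) : Cplx R :=
  match fintype.split a with
  | inl j => y 0 j
  | inr j => Num.conj (y 0 j)
  end.

(* Big operators over an ordinal type enumerate it increasingly, which is the
   order used in the meaning of covec. *)
Definition form_pullback (R : realType) N N' (F : Cn R N -> Cn R N')
    (w : cform R N') : cform R N := fun x =>
  \sum_(S : {set 'I_(N' + N')}) w (F x) S *: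
    \big[@wedge R N/ecov R finset.set0]_(a in S)
      dform (zform (fun y => coordf a (F y))) x.

(** * Currents *)

(* Test forms on W are extended by zero to C^N. *)
Definition test_form (R : realType) N (W : set (Cn R N)) (k l : nat)
    (w : cform R N) : Prop :=
  [/\ smooth_form setT w, bidegree k l w &
   exists K : set (Cn R N),
     [/\ compact K, K `<=` W & forall x, ~ K x -> w x = 0]].

Definition test_fun (R : realType) N (W : set (Cn R N))
    (f : Cn R N -> Cplx R) : Prop := test_form W 0 0 (zform f).

(* A functional on forms; only its values on the test forms of the relevant
   bidegree and domain are meaningful. *)
Definition functional (R : realType) N := cform R N -> Cplx R.

Definition current (R : realType) N (W : set (Cn R N)) (k l : nat)
    (T : functional R N) : Prop :=
  let test := test_form W (N - k) (N - l) in
  (forall (c : Cplx R) (v w : cform R N), test v -> test w ->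
     T (fun x => c *: v x + w x) = c * T v + T w) /\
  (forall K : set (Cn R N), compact K -> K `<=` W ->
     exists (r : nat) (C : R), forall (w : cform R N) (B : R), test w ->
       (forall x, ~ K x -> w x = 0) ->
       (forall (s : seq ('I_N * bool)) S x, (size s <= r)%N ->
          modC (rderivs s (fun y => w y S) x) <= B) ->
       modC (T w) <= C * B).

(* A (k,k)-current kills the components of its test forms that are not of
   bidegree (N-k,N-k), hence only these two cases matter in <T, d w> = 0. *)
Definition closed_current (R : realType) N (W : set (Cn R N)) (k : nat)
    (T : functional R N) : Prop :=
  forall r, r.+1 = (N - k)%N ->
    (forall w, test_form W r r.+1 w -> T (del w) = 0) /\
    (forall w, test_form W r.+1 r w -> T (delbar w) = 0).

Definition holcov (R : realType) N (a : Cn R N) : covec R N :=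
  \sum_(j < N) a 0 j *: ecov R [set lshift N j]%SET.

Definition antiholcov (R : realType) N (a : Cn R N) : covec R N :=
  \sum_(j < N) Num.conj (a 0 j) *: ecov R [set rshift N j]%SET.

(* i a_1 /\ abar_1 /\ .. /\ i a_k /\ abar_k *)
Definition elemcov (R : realType) N (l : seq (Cn R N)) : covec R N :=
  foldr (fun a c => wedge ('i *: wedge (holcov a) (antiholcov a)) c)
    (ecov R finset.set0) l.

Definition strongly_positive_covec (R : realType) N (k : nat) (c : covec R N) :
  Prop :=
  exists (r : nat) (g : 'I_r -> R) (a : 'I_r -> k.-tuple (Cn R N)),
    (forall i, 0 <= g i) /\ c = \sum_(i < r) toC (g i) *: elemcov (a i).

(* The order on R[i] is the one for which 0 <= z means that z is real and
   nonnegative. *)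
Definition positive_current (R : realType) N (W : set (Cn R N)) (k : nat)
    (T : functional R N) : Prop :=
  forall w, test_form W (N - k) (N - k) w ->
    (forall x, strongly_positive_covec (N - k) (w x)) -> 0 <= T w.

Definition cwedge (R : realType) N (T : functional R N) (a : cform R N) :
  functional R N := fun w => T (wform a w).

Definition current_pushforward (R : realType) N N' (F : Cn R N -> Cn R N')
    (T : functional R N) : functional R N' := fun w => T (form_pullback F w).

(** * Currents of order 0 and maximal bidegree *)

Definition order0 (R : realType) N (W : set (Cn R N)) (S : functional R N) :
  Prop :=
  forall K : set (Cn R N), compact K -> K `<=` W ->
    exists C : R, forall (f : Cn R N -> Cplx R) (B : R), test_fun W f ->
      (forall x, ~ K x -> f x = 0) -> (forall x, modC (f x) <= B) ->
      modC (S (zform f)) <= C * B.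

Definition mass_le (R : realType) N (W : set (Cn R N)) (S : functional R N)
    (C : R) : Prop :=
  forall f : Cn R N -> Cplx R, test_fun W f -> (forall x, modC (f x) <= 1) ->
    modC (S (zform f)) <= C.

Definition locally_uniformly_bounded_mass (R : realType) N (U : set (Cn R N))
    (I : Type) (D : set I) (S : I -> functional R N) : Prop :=
  forall x, U x -> exists (W : set (Cn R N)) (C : R),
    [/\ open W, W x, W `<=` U & forall i, D i -> mass_le W (S i) C].

Definition borelCn (R : realType) N :=
  g_sigma_algebraType (@open (Cn R N)).

(* Decomposition of the order 0 current S as the complex measure
   mu_0 + i mu_1 - mu_2 - i mu_3, with mu_k positive and locally finite on W. *)
Definition represents (R : realType) N (W : set (Cn R N))
    (mu : 'I_4 -> {measure set (borelCn R N) -> \bar R})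
    (S : functional R N) : Prop :=
  (forall k (K : set (Cn R N)), compact K -> K `<=` W ->
     (mu k K < +oo)%E) /\
  (forall f : Cn R N -> Cplx R, test_fun W f ->
     S (zform f) = \sum_(k < 4) 'i ^+ k *
       (toC (Rintegral (mu k) W (fun x => reC (f x)))
        + 'i * toC (Rintegral (mu k) W (fun x => imC (f x))))).

(* c = <1_A S, 1>: the complex measure S on W has finite mass on A and gives
   A the value c. *)
Definition total_mass_on (R : realType) N (W : set (Cn R N))
    (S : functional R N) (A : set (Cn R N)) (c : Cplx R) : Prop :=
  exists mu : 'I_4 -> {measure set (borelCn R N) -> \bar R},
    [/\ represents W mu S, forall k, (mu k A < +oo)%E &
     c = \sum_(k < 4) 'i ^+ k * toC (fine (mu k A))].

(** * Subsets of C^d *)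

Definition bounded_in (R : realType) N (V : set (Cn R N)) : Prop :=
  exists B : R, forall x, V x -> forall j, modC (x 0 j) <= B.

Definition simply_connected (R : realType) N (V : set (Cn R N)) : Prop :=
  let I : set R := [set` `[0, 1]] in
  [/\ V !=set0,
   forall x y, V x -> V y -> exists g : R -> Cn R N,
     [/\ {within I, continuous g}, g @` I `<=` V, g 0 = x & g 1 = y] &
   forall g : R -> Cn R N, {within I, continuous g} -> g @` I `<=` V ->
     g 0 = g 1 -> exists H : R * R -> Cn R N,
     [/\ {within I `*` I, continuous H}, H @` (I `*` I) `<=` V,
      (forall t, I t -> H (t, 0) = g t /\ H (t, 1) = g 0) &
      forall s, I s -> H (0, s) = g 0 /\ H (1, s) = g 0]].

Definition smooth_boundary (R : realType) N (V : set (Cn R N)) : Prop :=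
  forall b, (closure V `\` interior V) b ->
    exists (W : set (Cn R N)) (rho : Cn R N -> R),
      [/\ open W, W b, smooth_on W (fun x => toC (rho x)),
       (forall x, W x -> (V x <-> rho x < 0)) &
       exists s, rderiv s (fun x => toC (rho x)) b != 0].

(** * The setting: C^(d+n) with coordinates x = (x', x'') *)

Definition bpart (R : realType) d n (x : Cn R (d + n)) : Cn R d := lsubmx x.
Definition fpart (R : realType) d n (x : Cn R (d + n)) : Cn R n := rsubmx x.

(* V = U cap {x'' = 0}, as a subset of C^(d+n) and as a subset of C^d *)
Definition zero_section (R : realType) d n (U : set (Cn R (d + n))) :
  set (Cn R (d + n)) := U `&` [set x | fpart x = 0].
Definition base (R : realType) d n (U : set (Cn R (d + n))) : set (Cn R d) :=
  [set x | U (row_mx x 0)].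

(* E = V x C^n *)
Definition normal_bundle (R : realType) d n (U : set (Cn R (d + n))) :
  set (Cn R (d + n)) := [set x | base U (bpart x)].

Definition dilation (R : realType) d n (lam : Cplx R) (x : Cn R (d + n)) :
  Cn R (d + n) := row_mx (bpart x) (lam *: fpart x).

Definition sqnorm (R : realType) N (x : Cn R N) : R :=
  \sum_(j < N) modC (x 0 j) ^+ 2.

Definition lognorm (R : realType) N (x : Cn R N) : R := ln (Num.sqrt (sqnorm x)).

Record cutoff (R : realType) (chi : R -> R) : Prop := {
  cutoff_smooth : forall k t, derivable (derive1n k chi) t 1;
  cutoff_convex : convex_function (E := R^o) setT chi;
  cutoff_incr : {homo chi : s t / s <= t};
  cutoff_ge0 : forall t, 0 <= chi t;
  cutoff_left : forall t, t <= -1 -> chi t = 0;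
  cutoff_right : forall t, 1 <= t -> chi t = t }.

(* chi (log |y| + s), where log 0 = -oo and chi (-oo) = 0; the case split is
   needed because the library sets ln 0 = 0. *)
Definition chilog (R : realType) N (chi : R -> R) (s : R) (y : Cn R N) : R :=
  if y == 0 then 0 else chi (lognorm y + s).

Definition real_ddc (R : realType) N (f : Cn R N -> R) : cform R N :=
  ddc (zform (fun x => toC (f x))).

Definition uK (R : realType) d n (chi : R -> R) (theta : Cplx R)
    (x : Cn R (d + n)) : R :=
  chilog chi (- ln (modC theta)) (fpart x) + ln (modC theta).

(* dd^c log |x''| has no meaning at x'' = 0, but there dd^c uK vanishes, and so
   does the product below, which is the smooth form K_theta^m. *)
Definition Kform (R : realType) d n (chi : R -> R) (theta : Cplx R) (m : nat) :
  cform R (d + n) :=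
  if m is m'.+1 then
    wform (real_ddc (uK chi theta))
      (wpow (real_ddc (fun x : Cn R (d + n) => lognorm (fpart x))) m')
  else zform (fun=> 1).

(* The restriction of Omega_m to C^n; the same remark applies at 0. *)
Definition Omega (R : realType) n (chi : R -> R) (M : R) (m : nat) : cform R n :=
  if m is m'.+1 then
    wform (real_ddc (@chilog R n chi M)) (wpow (real_ddc (@lognorm R n)) m')
  else zform (fun=> 1).

Definition omegaV (R : realType) d : cform R d := real_ddc (@sqnorm R d).

(* 1_U T has a meaning on E only near V, but for a test form w on E the support
   of the pullback of w by the dilation of ratio lam_j lies in U for j large,
   so that the limit only involves values of T at test forms on U. *)
Definition tangent_current (R : realType) d n (U : set (Cn R (d + n))) (p : nat)
    (T Tinf : functional R (d + n)) : Prop :=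
  let E := normal_bundle U in
  [/\ current E p p Tinf, positive_current E p Tinf, closed_current E p Tinf &
   exists lam : nat -> Cplx R,
     [/\ forall j, lam j != 0,
      (fun j => modC (lam j)) @ \oo --> +oo%R &
      forall w, test_form E (d + n - p) (d + n - p) w ->
        (fun j => current_pushforward (@dilation R d n (lam j)) T w) @ \oo
          --> Tinf w]].

(* c = <(pi_V)_* (S /\ pi_F^* Om), phi>, S being extended by zero from E to
   V x P^n.  The extension does not charge the complement of E, so the pairing
   is the integral over E of the order 0 current S /\ pi_F^* Om /\ pi_V^* phi,
   required to be absolutely convergent; in particular only the restriction of
   Om to C^n is involved. *)
Definition compactified_pushforward_pairing (R : realType) d n
    (U : set (Cn R (d + n))) (S : functional R (d + n)) (Om : cform R n)
    (phi : cform R d) (c : Cplx R) : Prop :=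
  let E := normal_bundle U in
  total_mass_on E
    (cwedge S (wform (form_pullback (@fpart R d n) Om)
                     (form_pullback (@bpart R d n) phi)))
    E c.

(* Main.v *)
(* For |x''| > e |theta| the cutoff in u_theta^K is inactive, so K_theta^m does
   not depend on theta there, while K_theta^m is the pullback of pi_F^* Omega_m by
   the dilation of ratio e^(-M) / theta.  Hence theta_k := e^(-M) / lambda_(j_k).
   Writing phi as a combination of strongly positive forms turns
   T /\ K_theta^m /\ pi_V^* phi into positive functionals on test functions,
   bounded uniformly in theta by the mass hypothesis; a diagonal argument makes
   them converge along a subsequence, and Riesz' theorem represents their limit
   by a measure mu and the functional of T_infty /\ pi_F^* Omega_m by a measure
   nu.  Let eta_s (x) = b (x') kappa (s |x''|^2), where b = 1 on the support of
   phi.  Then mu (V) is the infimum over s of the limits of the masses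
   a_theta (s) of eta_s, and nu (E) is the supremum over t of the limits of
   a_theta (t / |theta|^2).  The mass of the shell eta_s - eta_s' does not depend
   on theta when s' |theta|^2 is small, and it is bounded and monotone in s', so
   the shells beyond s carry a mass tending to 0 and the two numbers agree. *)
From HB Require Import structures.
Require Import Defs.
From mathcomp Require Import all_boot all_order all_algebra.
From mathcomp Require Import all_classical all_reals all_analysis.
From mathcomp Require Import complex ring lra zify measurable_realfun.
Set Implicit Arguments.
Unset Strict Implicit.
Unset Printing Implicit Defensive.
Import Order.TTheory GRing.Theory Num.Theory.
Import numFieldNormedType.Exports.
Local Open Scope classical_set_scope.
Local Open Scope ring_scope.

(** * Complex numbers and the topology of C^N *)

(** Convergence is only available on compactly supported test functions, and neither the indicator
    of V nor the constant 1 on E is one: mass could a priori escape between the scale |x''| of order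
    |theta| and a fixed scale. The factor dd^c log |x''| is singular on V, and formal derivatives
    take default values there. The kernels are therefore rewritten as explicit radial covectors with
    one real parameter c: c = - log |theta| gives K_theta^m, c = M gives Omega_m, and the dilation
    of ratio lambda shifts c by log |lambda|. They are positive because chi is convex and
    increasing, by Lagrange's identity. The mass hypothesis only speaks of a power of omega_V, so
    the positive pieces of phi must also be dominated by a multiple of that power. No further cutoff
    function is needed: chi' is a smooth step from 0 to 1, and bumps, partitions of unity and kappa
    are all made from it. *)

Section ComplexNumbers.
Variable R : realType.
Implicit Types (z w : Cplx R) (a b : R).

Lemma reCD z w : reC (z + w) = reC z + reC w.
Proof. by case: z; case: w. Qed.
Lemma imCD z w : imC (z + w) = imC z + imC w.
Proof. by case: z; case: w. Qed.
Lemma reCN z : reC (- z) = - reC z. Proof. by case: z. Qed.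
Lemma imCN z : imC (- z) = - imC z. Proof. by case: z. Qed.
Lemma reCB z w : reC (z - w) = reC z - reC w.
Proof. by rewrite reCD reCN. Qed.
Lemma imCB z w : imC (z - w) = imC z - imC w.
Proof. by rewrite imCD imCN. Qed.
Lemma reCM z w : reC (z * w) = reC z * reC w - imC z * imC w.
Proof. by case: z; case: w. Qed.
Lemma imCM z w : imC (z * w) = reC z * imC w + imC z * reC w.
Proof. by case: z => a b; case: w => c d; rewrite /imC /= . Qed.
Lemma reC_toC a : reC (toC a) = a. Proof. by []. Qed.
Lemma imC_toC a : imC (toC a) = 0. Proof. by []. Qed.
Lemma iCE : 'i = Complex 0 1 :> Cplx R.
Proof. by rewrite -(complexiE R). Qed.
Lemma reCi : reC ('i : Cplx R) = 0. Proof. by rewrite iCE. Qed.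
Lemma imCi : imC ('i : Cplx R) = 1. Proof. by rewrite iCE. Qed.
Lemma CplxE z : z = toC (reC z) + 'i * toC (imC z).
Proof. by rewrite iCE; exact: complexE. Qed.
Lemma Cplx_eq z w : reC z = reC w -> imC z = imC w -> z = w.
Proof. by case: z => a b; case: w => c e; rewrite /reC /imC /=; move=> -> ->. Qed.
Lemma toCD a b : toC (a + b) = toC a + toC b.
Proof. by apply: Cplx_eq; rewrite /= ?addr0. Qed.
Lemma toCB a b : toC (a - b) = toC a - toC b.
Proof. by rewrite /toC rmorphB. Qed.
Lemma toCN a : toC (- a) = - toC a.
Proof. by rewrite /toC rmorphN. Qed.
Lemma toCM a b : toC (a * b) = toC a * toC b.
Proof. by rewrite /toC rmorphM. Qed.
Lemma toC0 : toC 0 = 0 :> Cplx R. Proof. by []. Qed.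
Lemma toC1 : toC 1 = 1 :> Cplx R. Proof. by []. Qed.
Lemma toCV a : toC a^-1 = (toC a)^-1.
Proof. by rewrite /toC fmorphV. Qed.
Lemma toC_sum I (r : seq I) P (F : I -> R) :
  toC (\sum_(i <- r | P i) F i) = \sum_(i <- r | P i) toC (F i).
Proof. by rewrite /toC rmorph_sum. Qed.
Lemma toC_inj : injective (@toC R).
Proof. by move=> a b /(congr1 (@reC R)). Qed.
Lemma reC_conj z : reC (Num.conj z) = reC z.
Proof. by case: z. Qed.
Lemma imC_conj z : imC (Num.conj z) = - imC z.
Proof. by case: z. Qed.
Lemma modCE z : modC z = Num.sqrt (reC z ^+ 2 + imC z ^+ 2).
Proof. by rewrite /modC normc_def. Qed.
Lemma toC_modC z : toC (modC z) = `|z|.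
Proof. by rewrite /modC normc_def. Qed.
Lemma modC_ge0 z : 0 <= modC z.
Proof. by rewrite modCE sqrtr_ge0. Qed.
Lemma modC_sq z : modC z ^+ 2 = reC z ^+ 2 + imC z ^+ 2.
Proof. by rewrite modCE sqr_sqrtr // addr_ge0 // sqr_ge0. Qed.
Lemma modCM z w : modC (z * w) = modC z * modC w.
Proof. by apply: toC_inj; rewrite toCM !toC_modC normrM. Qed.
Lemma modC_toC a : modC (toC a) = `|a|.
Proof. by rewrite modCE reC_toC imC_toC expr0n addr0 sqrtr_sqr. Qed.
Lemma ltC_toC a b : (toC a < toC b) = (a < b). Proof. exact: ltcR. Qed.
Lemma leC_toC a b : (toC a <= toC b) = (a <= b). Proof. exact: lecR. Qed.
Lemma modC0 : modC (0 : Cplx R) = 0.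
Proof. by rewrite -toC0 modC_toC normr0. Qed.
Lemma modC_eq0 z : (modC z == 0) = (z == 0).
Proof. by rewrite -(inj_eq toC_inj) toC_modC normr_eq0. Qed.
Lemma modC_gt0 z : (0 < modC z) = (z != 0).
Proof. by rewrite lt_def modC_eq0 modC_ge0 andbT. Qed.
Lemma modCV z : modC z^-1 = (modC z)^-1.
Proof. by apply: toC_inj; rewrite toCV !toC_modC normfV. Qed.
Lemma modCD z w : modC (z + w) <= modC z + modC w.
Proof. by rewrite -leC_toC toCD !toC_modC ler_normD. Qed.
Lemma modCN z : modC (- z) = modC z.
Proof. by apply: toC_inj; rewrite !toC_modC normrN. Qed.
Lemma modC_conj z : modC (Num.conj z) = modC z.
Proof. by rewrite !modCE reC_conj imC_conj sqrrN. Qed.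
Lemma le_reC_modC z : `|reC z| <= modC z.
Proof.
by rewrite -(sqrtr_sqr (reC z)) modCE ler_wsqrtr // lerDl sqr_ge0.
Qed.
Lemma le_imC_modC z : `|imC z| <= modC z.
Proof.
by rewrite -(sqrtr_sqr (imC z)) modCE ler_wsqrtr // lerDr sqr_ge0.
Qed.
Lemma modC_le_reC_imC z : modC z <= `|reC z| + `|imC z|.
Proof.
rewrite {1}(CplxE z) (le_trans (modCD _ _))// modCM !modC_toC.
by rewrite modCE reCi imCi expr0n expr1n add0r sqrtr1 mul1r.
Qed.
(** The radius of a ball in [Cplx R] is itself a complex number; the order forces a positive one to
    be real, which reduces the topology to real radii. *)
Lemma Cplx_gt0 (e : Cplx R) : 0 < e -> exists2 a : R, 0 < a & e = toC a.
Proof.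
move=> e0; exists (reC e); last first.
  by apply: Cplx_eq => //=; move: e0; rewrite ltcE => /andP[/eqP].
by move: e0; rewrite ltcE => /andP[].
Qed.
Lemma CconjD z w : Num.conj (z + w) = Num.conj z + Num.conj w.
Proof. exact: rmorphD. Qed.
Lemma CconjB z w : Num.conj (z - w) = Num.conj z - Num.conj w.
Proof. exact: rmorphB. Qed.
Lemma CconjN z : Num.conj (- z) = - Num.conj z.
Proof. exact: rmorphN. Qed.
Lemma CconjM z w : Num.conj (z * w) = Num.conj z * Num.conj w.
Proof. exact: rmorphM. Qed.
Lemma CconjK z : Num.conj (Num.conj z) = z.
Proof. exact: conjCK. Qed.
Lemma Cconj_nat (n : nat) : Num.conj (n%:R : Cplx R) = n%:R.
Proof. exact: conjC_nat. Qed.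
Lemma Cconj0 : Num.conj (0 : Cplx R) = 0.
Proof. exact: rmorph0. Qed.
Lemma Cconj1 : Num.conj (1 : Cplx R) = 1.
Proof. exact: rmorph1. Qed.
Lemma Cconj_sum I (r : seq I) P (F : I -> Cplx R) :
  Num.conj (\sum_(i <- r | P i) F i) = \sum_(i <- r | P i) Num.conj (F i).
Proof. exact: rmorph_sum. Qed.
Lemma conj_mul_sq z : Num.conj z * z = toC (modC z ^+ 2).
Proof.
apply: Cplx_eq; rewrite ?reCM ?imCM reC_conj imC_conj.
  by rewrite /= modC_sq; ring.
by rewrite imC_toC; ring.
Qed.
End ComplexNumbers.

Section ComplexTopology.
Variable R : realType.

Lemma ball_CplxE (z : Cplx R) (e : R) w : ball z (toC e) w = (modC (z - w) < e).
Proof. by rewrite -[LHS]/(is_true (`|z - w| < toC e)) -toC_modC ltC_toC. Qed.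

Lemma nbhs_CplxP (z : Cplx R) (A : set (Cplx R)) :
  nbhs z A <-> exists2 e : R, 0 < e & forall w, modC (z - w) < e -> A w.
Proof.
split=> [/nbhs_ballP[e /Cplx_gt0[a a0 ->] h]|[e e0 h]].
  by exists a => // w zw; apply: h; rewrite ball_CplxE.
apply/nbhs_ballP; exists (toC e); first by rewrite /= -toC0 ltC_toC.
by move=> w; rewrite ball_CplxE; exact: h.
Qed.

Lemma cvg_CplxP T (F : set_system T) {FF : Filter F} (f : T -> Cplx R) z :
  f @ F --> z <-> forall e : R, 0 < e -> \forall x \near F, modC (z - f x) < e.
Proof.
split=> [h e e0|h].
  by apply: (h [set w | modC (z - w) < e]); apply/nbhs_CplxP; exists e.
move=> A /nbhs_CplxP[e e0 hA]; have := h _ e0.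
by apply: filterS => x /hA.
Qed.

Lemma cvg_CplxE T (F : set_system T) {FF : Filter F} (f : T -> Cplx R) z :
  f @ F --> z <->
  ((fun x => reC (f x)) @ F --> reC z) /\ ((fun x => imC (f x)) @ F --> imC z).
Proof.
split=> [/cvg_CplxP h|[/cvgrPdist_lt h1 /cvgrPdist_lt h2]].
  split; apply/cvgrPdist_lt => e e0; have := h _ e0; apply: filterS => x.
    by apply: le_lt_trans; rewrite -reCB le_reC_modC.
  by apply: le_lt_trans; rewrite -imCB le_imC_modC.
apply/cvg_CplxP => e e0; have e20 : 0 < e / 2 by rewrite divr_gt0.
near=> x; rewrite (le_lt_trans (modC_le_reC_imC _))// reCB imCB (splitr e).
by rewrite ltrD //; near: x; [exact: h1|exact: h2].
Unshelve. all: by end_near. Qed.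

Lemma reC_continuous : continuous (@reC R).
Proof. by move=> z; have /cvg_CplxE[] := @cvg_id _ (nbhs z). Qed.
Lemma imC_continuous : continuous (@imC R).
Proof. by move=> z; have /cvg_CplxE[] := @cvg_id _ (nbhs z). Qed.
Lemma toC_continuous : continuous (@toC R).
Proof.
move=> a; apply/cvg_CplxE; split; first exact: cvg_id.
exact: cvg_cst.
Qed.

Lemma continuous_CplxE (T : topologicalType) (f : T -> Cplx R) x :
  {for x, continuous f} <->
  {for x, continuous (fun y => reC (f y))} /\
  {for x, continuous (fun y => imC (f y))}.
Proof. exact: cvg_CplxE. Qed.

Lemma nbhs_CnP N (x : Cn R N) (A : set (Cn R N)) :
  nbhs x A <-> exists2 e : R, 0 < e &
    forall y : Cn R N, (forall j, modC (x 0 j - y 0 j) < e) -> A y.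
Proof.
split=> [/nbhs_ballP[e /Cplx_gt0[a a0 ->] h]|[e e0 h]].
  exists a => // w zw; apply: h; split; first by rewrite -toC0 ltC_toC.
  by move=> i j; rewrite ball_CplxE ord1.
apply/nbhs_ballP; exists (toC e); first by rewrite /= -toC0 ltC_toC.
by move=> w [_ xw]; apply: h => j; have := xw 0 j; rewrite ball_CplxE.
Qed.

Lemma cvg_CnP N T (F : set_system T) {FF : Filter F} (f : T -> Cn R N) (x : Cn R N) :
  (forall j, (fun t => f t 0 j) @ F --> x 0 j) -> f @ F --> x.
Proof.
move=> h A /nbhs_CnP[e e0 hA].
have : \forall t \near F, forall j, modC (x 0 j - f t 0 j) < e.
  by apply: filter_forall => j; have /cvg_CplxP := h j; exact.
by apply: filterS => t /hA.
Qed.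

Lemma continuous_CnP N (T : topologicalType) (f : T -> Cn R N) (t : T) :
  (forall j, {for t, continuous (fun u => f u 0 j)}) -> {for t, continuous f}.
Proof. by move=> h; apply: cvg_CnP => j; exact: h. Qed.

Lemma coordC_continuous N (j : 'I_N) : continuous (fun x : Cn R N => x 0 j).
Proof. exact: coord_continuous. Qed.

Definition box N (a b : 'I_N * bool -> R) : set (Cn R N) :=
  [set x | forall j, a (j, false) <= reC (x 0 j) <= b (j, false) /\
                     a (j, true) <= imC (x 0 j) <= b (j, true)].

Lemma box_compact N (a b : 'I_N * bool -> R) : compact (box a b).
Proof.
pose B j := [set z : Cplx R | a (j, false) <= reC z <= b (j, false) /\
                     a (j, true) <= imC z <= b (j, true)].
have -> : box a b = [set v : 'rV_N | forall j, B j (v ord0 j)] by [].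
apply: rV_compact => j.
pose F (p : R * R) : Cplx R := toC p.1 + 'i * toC p.2.
have -> : B j = F @` (`[a (j, false), b (j, false)] `*` `[a (j, true), b (j, true)]).
  rewrite eqEsubset; split=> [z [/= zr zi]|_ [[p q] [/= pr qi] <-]].
    by exists (reC z, imC z); [split; rewrite /= in_itv|rewrite /F /= -CplxE].
  have E1 : reC (F (p, q)) = p.
    by rewrite reCD reCM reCi imCi !reC_toC imC_toC /=; ring.
  have E2 : imC (F (p, q)) = q.
    by rewrite imCD imCM reCi imCi !reC_toC !imC_toC /=; ring.
  by move: pr qi; rewrite !in_itv /B /mkset E1 E2.
apply: continuous_compact; last first.
  by apply: compact_setX; exact: segment_compact.
apply: continuous_subspaceT => p; apply: cvgD.
  apply: continuous_comp; [exact: cvg_fst|exact: toC_continuous].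
apply: cvgM; first exact: cvg_cst.
apply: continuous_comp; [exact: cvg_snd|exact: toC_continuous].
Qed.

Lemma compact_CnE N (K : set (Cn R N)) : compact K ->
  closed K /\ exists B : R, forall x, K x -> forall j, modC (x 0 j) <= B.
Proof.
move=> cK; split.
  by apply: compact_closed => //; exact: norm_hausdorff.
(* Compactness in its near-covering form, with the filter at +oo, produces a bound valid on all of
   [K] at once. *)
have /compact_near_coveringP/(_ R (pinfty_nbhs R)
  (fun B x => forall j, modC (x 0 j) <= B)) : compact K := cK.
case.
  move=> x Kx; pose m := \sum_j modC (x 0 j) + 1.
  exists ([set y : Cn R N | forall j, modC (x 0 j - y 0 j) < 1],
          [set B | m < B]).
    split; first by apply/nbhs_CnP; exists 1.
    by exists m; rewrite num_real.
  move=> [y B] /= [xy mB] j; apply: ltW; apply: le_lt_trans mB.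
  have -> : y 0 j = - (x 0 j - y 0 j) + x 0 j by rewrite opprB addrNK.
  rewrite (le_trans (modCD _ _))// modCN addrC lerD //; last exact: ltW.
  by rewrite (bigD1 j) //= lerDl sumr_ge0 // => *; exact: modC_ge0.
move=> M [Mr h]; exists (M + 1) => x Kx; apply: h => //.
by rewrite ltrDl.
Qed.

Lemma closed_box_sub_compact N (K : set (Cn R N)) (B : R) : closed K ->
  (forall x, K x -> forall j, modC (x 0 j) <= B) -> compact K.
Proof.
move=> cK h; apply: (subclosed_compact cK (@box_compact N (fun=> - B) (fun=> B))).
by move=> x Kx j; rewrite -!ler_norml; split; apply: le_trans (h x Kx j);
  rewrite ?le_reC_modC ?le_imC_modC.
Qed.

End ComplexTopology.

(** * Smooth functions *)

Section RealDerivatives.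
Variables (R : realType) (N : nat).
Implicit Types (f g : Cn R N -> Cplx R) (x : Cn R N) (D : Cplx R)
  (s : 'I_N * bool) (W : set (Cn R N)).

(** Relational form of [rderiv] that also carries differentiability: [rderiv] alone may be a default
    value, to which the product and chain rules do not apply. *)
Definition is_rderiv s f x D :=
  is_derive (0 : R) 1 (fun t : R => reC (f (along s x t))) (reC D) /\
  is_derive (0 : R) 1 (fun t : R => imC (f (along s x t))) (imC D).

Lemma along0 s x : along s x 0 = x.
Proof. by rewrite /along toC0 scale0r addr0. Qed.

Lemma along_continuous s x : continuous (fun t : R => along s x t).
Proof.
move=> t; apply: cvg_CnP => j.
have -> : (fun t => along s x t 0 j) = (fun t => x 0 j + toC t * rdir R s 0 j).
  by apply/funext => u; rewrite !mxE.
rewrite [along _ _ _ _ _]mxE [in X in _ + X]mxE.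
apply: cvgD; first exact: cvg_cst.
by apply: cvgM; [exact: toC_continuous|exact: cvg_cst].
Qed.

Lemma is_rderivP s f x : rderivable s f x -> is_rderiv s f x (rderiv s f x).
Proof.
case=> h1 h2; rewrite /is_rderiv /rderiv reCD imCD reCM imCM reCi imCi.
rewrite !reC_toC !imC_toC !(mul0r, mul1r, subr0, addr0, add0r).
by split; rewrite derive1E; [exact: (derivableP h1)|exact: (derivableP h2)].
Qed.

Lemma is_rderiv_rderivable s f x D : is_rderiv s f x D -> rderivable s f x.
Proof. by case=> h1 h2; split; exact: ex_derive. Qed.

Lemma is_rderivE s f x D : is_rderiv s f x D -> rderiv s f x = D.
Proof.
case=> h1 h2; rewrite /rderiv !derive1E [RHS]CplxE.
by have -> := @derive_val _ _ _ _ _ _ _ h1; have -> := @derive_val _ _ _ _ _ _ _ h2.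
Qed.

Lemma near_along s x (P : Cn R N -> Prop) : (\forall y \near x, P y) ->
  \forall t \near (0 : R), P (along s x t).
Proof.
by move=> h; apply: (@along_continuous s x 0); rewrite along0.
Qed.

Lemma near_is_rderiv s f g x D : (\forall y \near x, f y = g y) ->
  is_rderiv s f x D -> is_rderiv s g x D.
Proof.
move=> /(near_along s) fg [h1 h2]; split.
  apply: near_eq_is_derive h1.
  by apply: filterS fg => t ->.
apply: near_eq_is_derive h2.
by apply: filterS fg => t ->.
Qed.

Lemma is_rderiv_cst s x (c : Cplx R) : is_rderiv s (fun=> c) x 0.
Proof. by split; exact: is_derive_cst. Qed.

Lemma is_rderivD s f g x D E : is_rderiv s f x D -> is_rderiv s g x E ->
  is_rderiv s (fun y => f y + g y) x (D + E).
Proof.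
case=> [a b] [c e]; rewrite /is_rderiv reCD imCD; split.
  under eq_fun do rewrite reCD; exact: is_deriveD.
under eq_fun do rewrite imCD; exact: is_deriveD.
Qed.

Lemma is_rderivM s f g x D E : is_rderiv s f x D -> is_rderiv s g x E ->
  is_rderiv s (fun y => f y * g y) x (D * g x + f x * E).
Proof.
case=> [a b] [c e].
split.
  under eq_fun do rewrite reCM.
  apply: is_derive_eq; rewrite along0 reCD !reCM /GRing.scale /=; ring.
under eq_fun do rewrite imCM.
apply: is_derive_eq; rewrite along0 imCD !imCM /GRing.scale /=; ring.
Qed.

Lemma is_rderiv_conj s f x D : is_rderiv s f x D ->
  is_rderiv s (fun y => Num.conj (f y)) x (Num.conj D).
Proof.
case=> a b; rewrite /is_rderiv reC_conj imC_conj; split.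
  by under eq_fun do rewrite reC_conj.
by under eq_fun do rewrite imC_conj; exact: is_deriveN.
Qed.

Lemma is_rderiv_coord s x (j : 'I_N) :
  is_rderiv s (fun y => y 0 j) x (rdir R s 0 j).
Proof.
rewrite /is_rderiv /along; split.
  under eq_fun do rewrite !mxE reCD reCM reC_toC imC_toC mul0r subr0.
  by apply: is_derive_eq; rewrite /GRing.scale /= !mxE; ring.
under eq_fun do rewrite !mxE imCD imCM reC_toC imC_toC mul0r addr0.
by apply: is_derive_eq; rewrite /GRing.scale /= !mxE; ring.
Qed.

Lemma is_rderiv_comp s (h : R -> R) (u : Cn R N -> R) x (dh du : R) :
  is_derive (u x) 1 h dh -> is_rderiv s (fun y => toC (u y)) x (toC du) ->
  is_rderiv s (fun y => toC (h (u y))) x (toC (dh * du)).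
Proof.
move=> hd [ud _]; split; last first.
  by under eq_fun do rewrite imC_toC; exact: is_derive_cst.
rewrite reC_toC in ud *.
have hd' : is_derive (u (along s x 0)) 1 h dh by rewrite along0.
by have := @is_derive1_comp _ h (fun t => u (along s x t)) 0 _ _ hd' ud.
Qed.

End RealDerivatives.

Lemma near_continuous (T U : topologicalType) (f g : T -> U) (x : T) :
  (\forall y \near x, f y = g y) -> {for x, continuous f} ->
  {for x, continuous g}.
Proof.
move=> fg cf; suff : g @ x --> f x by rewrite (nbhs_singleton fg).
by apply: cvg_trans cf; apply: near_eq_cvg.
Qed.

Lemma continuous_addC (R : realType) (T : topologicalType) (f g : T -> Cplx R)
    (x : T) : {for x, continuous f} -> {for x, continuous g} ->
  {for x, continuous (fun y => f y + g y)}.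
Proof. by move=> cf cg; apply: cvgD; [exact: cf|exact: cg]. Qed.

Lemma continuous_mulC (R : realType) (T : topologicalType) (f g : T -> Cplx R)
    (x : T) : {for x, continuous f} -> {for x, continuous g} ->
  {for x, continuous (fun y => f y * g y)}.
Proof. by move=> cf cg; apply: cvgM; [exact: cf|exact: cg]. Qed.

Lemma continuous_cstC (R : realType) (T : topologicalType) (c : Cplx R)
    (x : T) : {for x, continuous (fun _ : T => c)}.
Proof. exact: cvg_cst. Qed.

Lemma continuous_cstR (R : realType) (T : topologicalType) (c : R) (x : T) :
  {for x, continuous (fun _ : T => c)}.
Proof. exact: cvg_cst. Qed.

Section SmoothFunctions.
Variables (R : realType) (N : nat).
Implicit Types (f g : Cn R N -> Cplx R) (x : Cn R N)
  (s : 'I_N * bool) (W : set (Cn R N)).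

(** The innermost derivative is peeled off first, whereas the head of the list in [smooth_on] is the
    outermost one. In this order sums, products and compositions go by induction on [k]. *)
Fixpoint cont_diff (k : nat) W f : Prop :=
  (forall x, W x -> {for x, continuous f}) /\
  if k is k'.+1 then forall s, (forall x, W x -> rderivable s f x) /\
    cont_diff k' W (rderiv s f)
  else True.

Lemma cont_diff_continuous k W f : cont_diff k W f ->
  forall x, W x -> {for x, continuous f}.
Proof. by case: k => [|k] []. Qed.

Lemma smooth_onP W f : smooth_on W f <-> forall k, cont_diff k W f.
Proof.
split=> [+ k|].
  elim: k f => [|k ih] f h.
    by split; [move=> x Wx; have [] := h [::] x Wx|].
  split=> [x Wx|s]; first by have [] := h [::] x Wx.
  split=> [x Wx|]; first by have [_] := h [::] x Wx; exact.
  apply: ih => l x Wx.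
  have -> : rderivs l (rderiv s f) = rderivs (rcons l s) f.
    by rewrite /rderivs foldr_rcons.
  exact: h.
move=> + l; elim/last_ind: l f => [|l s ih] f h x Wx.
  split; first exact: (cont_diff_continuous (h 0) Wx).
  by move=> s; have [_ /(_ s)[]] := h 1; move=> + _; exact.
have -> : rderivs (rcons l s) f = rderivs l (rderiv s f).
  by rewrite /rderivs foldr_rcons.
by apply: ih => // k; have [_ /(_ s)[]] := h k.+1.
Qed.

Lemma cont_diff_le k W f : cont_diff k.+1 W f -> cont_diff k W f.
Proof.
elim: k f => [|k ih] f; first by case.
by case=> h1 h2; split=> // s; have [? ?] := h2 s; split=> //; exact: ih.
Qed.

Lemma cont_diff_eq k W f g : open W -> (forall x, W x -> f x = g x) ->
  cont_diff k W f -> cont_diff k W g.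
Proof.
move=> oW.
have nbW x : W x -> nbhs x W by move=> Wx; exact: open_nbhs_nbhs.
have fgn (f' g' : Cn R N -> Cplx R) : (forall x, W x -> f' x = g' x) ->
    forall x, W x -> \forall y \near x, f' y = g' y.
  by move=> fg x Wx; apply: (@filterS _ _ _ W) (nbW _ Wx) => y; exact: fg.
have cfg (f' g' : Cn R N -> Cplx R) : (forall x, W x -> f' x = g' x) ->
    forall x, W x -> {for x, continuous f'} -> {for x, continuous g'}.
  by move=> fg x Wx; apply: near_continuous; exact: (fgn _ _ fg x Wx).
elim: k f g => [|k ih] f g fg.
  by case=> h _; split; [move=> x Wx; exact: (cfg f g fg x Wx (h x Wx))|].
case=> h h'; split=> [x Wx|s]; first exact: (cfg f g fg x Wx (h x Wx)).
have [d c] := h' s.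
have e x : W x -> is_rderiv s g x (rderiv s f x).
  by move=> Wx; apply: near_is_rderiv (fgn _ _ fg _ Wx) _; exact/is_rderivP/d.
split=> [x Wx|]; first exact: is_rderiv_rderivable (e x Wx).
by apply: ih c => x Wx; rewrite (is_rderivE (e x Wx)).
Qed.

(* A derivative computed on W may be used in place of the one that [rderiv]
   denotes, which is a junk value where [f] is not differentiable. *)
Lemma cont_diffS k W f (f' : 'I_N * bool -> Cn R N -> Cplx R) : open W ->
  (forall x, W x -> {for x, continuous f}) ->
  (forall s x, W x -> is_rderiv s f x (f' s x)) ->
  (forall s, cont_diff k W (f' s)) -> cont_diff k.+1 W f.
Proof.
move=> oW cf hf ck; split=> // s; split=> [x Wx|].
  exact: is_rderiv_rderivable (hf s x Wx).
by apply: cont_diff_eq (ck s) => // x Wx; rewrite (is_rderivE (hf s x Wx)).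
Qed.

Lemma cont_diff_cst k W (c : Cplx R) : cont_diff k W (fun=> c).
Proof.
elim: k c => [|k ih] c.
  by split; [move=> x Wx; exact: continuous_cstC|].
split=> [x Wx|s]; first exact: continuous_cstC.
split=> [x Wx|]; first exact: is_rderiv_rderivable (is_rderiv_cst s x c).
rewrite (_ : rderiv s _ = fun=> 0) //; apply/funext => x.
exact: is_rderivE (is_rderiv_cst s x c).
Qed.

Lemma cont_diffD k W f g : open W -> cont_diff k W f -> cont_diff k W g ->
  cont_diff k W (fun x => f x + g x).
Proof.
move=> oW; elim: k f g => [|k ih] f g [cf hf] [cg hg].
  by split; [move=> x Wx; exact: (continuous_addC (cf x Wx) (cg x Wx))|].
apply: (cont_diffS (f' := fun s x => rderiv s f x + rderiv s g x)); first exact: oW.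
- by move=> x Wx; exact: (continuous_addC (cf x Wx) (cg x Wx)).
- move=> s x Wx; apply: is_rderivD; apply: is_rderivP.
    by have [+ _] := hf s; exact.
  by have [+ _] := hg s; exact.
- by move=> s; apply: ih; [have [] := hf s|have [] := hg s].
Qed.

Lemma cont_diffM k W f g : open W -> cont_diff k W f -> cont_diff k W g ->
  cont_diff k W (fun x => f x * g x).
Proof.
move=> oW; elim: k f g => [|k ih] f g kf kg.
  have [[cf _] [cg _]] := (kf, kg).
  by split; [move=> x Wx; exact: (continuous_mulC (cf x Wx) (cg x Wx))|].
have [[cf hf] [cg hg]] := (kf, kg).
apply: (cont_diffS (f' := fun s x => rderiv s f x * g x + f x * rderiv s g x)); first exact: oW.
- by move=> x Wx; exact: (continuous_mulC (cf x Wx) (cg x Wx)).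
- move=> s x Wx; apply: is_rderivM; apply: is_rderivP.
    by have [+ _] := hf s; exact.
  by have [+ _] := hg s; exact.
- move=> s; apply: cont_diffD => //; apply: ih => //.
  + by have [] := hf s.
  + exact: cont_diff_le.
  + exact: cont_diff_le.
  + by have [] := hg s.
Qed.

Lemma continuous_conj : continuous (fun z : Cplx R => Num.conj z).
Proof.
move=> z; apply/(@continuous_CplxE R (Cplx R) (fun z => Num.conj z) z).
have -> : (fun x : Cplx R => reC (Num.conj x)) = @reC R.
  by apply/funext => w; rewrite reC_conj.
have -> : (fun x : Cplx R => imC (Num.conj x)) = (fun w : Cplx R => - imC w).
  by apply/funext => w; rewrite imC_conj.
split; first exact: reC_continuous.
exact: (@continuousN _ _ _ _ z (@imC_continuous R z)).
Qed.

Lemma cont_diff_conj k W f : open W -> cont_diff k W f ->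
  cont_diff k W (fun x => Num.conj (f x)).
Proof.
have cc g x : {for x, continuous g} -> {for x, continuous (fun x => Num.conj (g x))}.
  by move=> cg; exact: (@continuous_comp _ _ _ g (fun z => Num.conj z) x cg (@continuous_conj _)).
move=> oW; elim: k f => [|k ih] f [cf hf].
  by split; [move=> x Wx; exact: (cc f x (cf x Wx))|].
apply: (cont_diffS (f' := fun s x => Num.conj (rderiv s f x))); first exact: oW.
- by move=> x Wx; exact: (cc f x (cf x Wx)).
- move=> s x Wx; apply: is_rderiv_conj; apply: is_rderivP.
  by have [+ _] := hf s; exact.
- by move=> s; apply: ih; have [] := hf s.
Qed.

Lemma cont_diff_coord k W (j : 'I_N) : open W ->
  cont_diff k W (fun x => x 0 j).
Proof.
move=> oW; case: k => [|k].
  by split; [move=> x _; exact: coordC_continuous|].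
apply: (cont_diffS (f' := fun s _ => rdir R s 0 j)); first exact: oW.
- by move=> x _; exact: coordC_continuous.
- by move=> s x _; exact: is_rderiv_coord.
- by move=> s; exact: cont_diff_cst.
Qed.

Lemma toC_comp_continuous (h : R -> R) (u : Cn R N -> R) x :
  {for x, continuous (fun x => toC (u x))} -> {for u x, continuous h} ->
  {for x, continuous (fun x => toC (h (u x)))}.
Proof.
move=> /continuous_CplxE[+ _] ch; move=> cu.
apply/continuous_CplxE; split; last exact: continuous_cstR.
exact: (@continuous_comp _ _ _ u h x cu ch).
Qed.

Lemma rderiv_real s (u : Cn R N -> R) x :
  rderiv s (fun y => toC (u y)) x = toC (reC (rderiv s (fun y => toC (u y)) x)).
Proof.
apply: Cplx_eq => //; rewrite imC_toC /rderiv imCD imCM imC_toC reCi imCi.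
by rewrite mul0r add0r mul1r reC_toC derive1_cst add0r.
Qed.

(** [h] lists successive derivatives on [A]. The induction on [k] runs over all indices at once,
    since differentiating h_i o u brings in h_(i+1) o u. *)
Lemma cont_diff_comp k W (A : set R) (h : nat -> R -> R) (u : Cn R N -> R) :
  open W -> (forall i t, A t -> is_derive t 1 (h i) (h i.+1 t)) ->
  (forall x, W x -> A (u x)) -> cont_diff k W (fun x => toC (u x)) ->
  cont_diff k W (fun x => toC (h 0%N (u x))).
Proof.
move=> oW dh WA.
have ch i x : W x -> {for u x, continuous (h i)}.
  move=> Wx; apply: differentiable_continuous; apply/derivable1_diffP.
  by have := dh i _ (WA _ Wx) => -[].
move: 0%N => i; elim: k i => [|k ih] i ku.
  have [cu _] := ku.
  by split; [move=> x Wx; exact: (@toC_comp_continuous (h i) u x (cu x Wx) (ch i x Wx))|].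
have [cu hu] := ku.
apply: (cont_diffS (f' := fun s x => toC (h i.+1 (u x)) *
   rderiv s (fun y => toC (u y)) x)); first exact: oW.
- by move=> x Wx; exact: (@toC_comp_continuous (h i) u x (cu x Wx) (ch i x Wx)).
- move=> s x Wx; rewrite rderiv_real -toCM; apply: is_rderiv_comp.
    exact/dh/WA.
  by rewrite -rderiv_real; apply: is_rderivP; have [+ _] := hu s; exact.
- move=> s; apply: cont_diffM => //; last by have [] := hu s.
  by apply: ih; exact: cont_diff_le.
Qed.

(** The induction closes because d(1/u) = - (1/u)^2 du is again a polynomial in 1/u and the
    derivatives of u. *)
Lemma cont_diff_inv k W (u : Cn R N -> R) : open W ->
  (forall x, W x -> 0 < u x) -> cont_diff k W (fun x => toC (u x)) ->
  cont_diff k W (fun x => toC (u x)^-1).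
Proof.
move=> oW u0; have ci x : W x -> {for u x, continuous (@GRing.inv R)}.
  by move=> Wx; apply: inv_continuous; rewrite gt_eqF // u0.
elim: k => [|k ih] ku.
  have [cu _] := ku.
  by split; [move=> x Wx; exact: (@toC_comp_continuous (@GRing.inv R) u x (cu x Wx) (ci x Wx))|].
have [cu hu] := ku.
apply: (cont_diffS (f' := fun s x => (toC (-1) *
   (toC (u x)^-1 * toC (u x)^-1)) * rderiv s (fun y => toC (u y)) x)); first exact: oW.
- by move=> x Wx; exact: (@toC_comp_continuous (@GRing.inv R) u x (cu x Wx) (ci x Wx)).
- move=> s x Wx; rewrite rderiv_real -!toCM.
  rewrite (_ : -1 * _ = - (u x) ^- 2); last first.
    by rewrite mulN1r -invfM -expr2.
  apply: is_rderiv_comp.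
    have := @is_deriveV R id (u x) 1 1; rewrite /GRing.scale /= mulr1; apply.
    by rewrite gt_eqF // u0.
  by rewrite -rderiv_real; apply: is_rderivP; have [+ _] := hu s; exact.
- move=> s; apply: cont_diffM => //; last by have [] := hu s.
  have kV := ih (cont_diff_le ku).
  apply: cont_diffM => //; first exact: cont_diff_cst.
  exact: cont_diffM.
Qed.

Lemma cont_diff_ln k W (u : Cn R N -> R) : open W ->
  (forall x, W x -> 0 < u x) -> cont_diff k W (fun x => toC (u x)) ->
  cont_diff k W (fun x => toC (ln (u x))).
Proof.
move=> oW u0; have ci x : W x -> {for u x, continuous (@ln R)}.
  by move=> Wx; apply: continuous_ln; exact: u0.
case: k => [|k] ku.
  have [cu _] := ku.
  by split; [move=> x Wx; exact: (@toC_comp_continuous (@ln R) u x (cu x Wx) (ci x Wx))|].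
have [cu hu] := ku.
apply: (cont_diffS (f' := fun s x => toC (u x)^-1 *
    rderiv s (fun y => toC (u y)) x)); first exact: oW.
- by move=> x Wx; exact: (@toC_comp_continuous (@ln R) u x (cu x Wx) (ci x Wx)).
- move=> s x Wx; rewrite rderiv_real -!toCM.
  apply: is_rderiv_comp; first exact/is_derive1_ln/u0.
  by rewrite -rderiv_real; apply: is_rderivP; have [+ _] := hu s; exact.
- move=> s; apply: cont_diffM => //; last by have [] := hu s.
  by apply: cont_diff_inv => //; exact: cont_diff_le.
Qed.

End SmoothFunctions.

Section SmoothOn.
Variables (R : realType) (N : nat).
Implicit Types (f g : Cn R N -> Cplx R) (x : Cn R N)
  (s : 'I_N * bool) (W : set (Cn R N)).

Lemma smooth_eq W f g : open W -> (forall x, W x -> f x = g x) ->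
  smooth_on W f -> smooth_on W g.
Proof.
move=> oW fg /smooth_onP h; apply/smooth_onP => k.
exact: (cont_diff_eq oW fg (h k)).
Qed.

Lemma smooth_sub W W' f : W' `<=` W -> smooth_on W f -> smooth_on W' f.
Proof. by move=> sW h l x W'x; exact: (h l x (sW _ W'x)). Qed.

Lemma smooth_local f :
  (forall x, exists W, [/\ open W, W x & smooth_on W f]) -> smooth_on setT f.
Proof. by move=> h l x _; have [W [_ Wx fW]] := h x; exact: (fW l x Wx). Qed.

Lemma smooth_cst W (c : Cplx R) : smooth_on W (fun=> c).
Proof. by apply/smooth_onP => k; exact: cont_diff_cst. Qed.

Lemma smoothD W f g : open W -> smooth_on W f -> smooth_on W g ->
  smooth_on W (fun x => f x + g x).
Proof.
move=> oW /smooth_onP hf /smooth_onP hg; apply/smooth_onP => k.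
exact: (cont_diffD oW (hf k) (hg k)).
Qed.

Lemma smoothM W f g : open W -> smooth_on W f -> smooth_on W g ->
  smooth_on W (fun x => f x * g x).
Proof.
move=> oW /smooth_onP hf /smooth_onP hg; apply/smooth_onP => k.
exact: (cont_diffM oW (hf k) (hg k)).
Qed.

Lemma smoothZ W (c : Cplx R) f : open W -> smooth_on W f ->
  smooth_on W (fun x => c * f x).
Proof. by move=> oW hf; exact: (@smoothM W (fun=> c) f oW (@smooth_cst W c) hf). Qed.

Lemma smooth_conj W f : open W -> smooth_on W f ->
  smooth_on W (fun x => Num.conj (f x)).
Proof.
move=> oW /smooth_onP hf; apply/smooth_onP => k.
exact: (cont_diff_conj oW (hf k)).
Qed.

Lemma smooth_coord W (j : 'I_N) : open W -> smooth_on W (fun x => x 0 j).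
Proof.
by move=> oW; apply/smooth_onP => k; exact: (cont_diff_coord k j oW).
Qed.

Lemma smooth_rderiv W s f : smooth_on W f -> smooth_on W (rderiv s f).
Proof.
move=> /smooth_onP hf; apply/smooth_onP => k.
by have [_ /(_ s)[_]] := hf k.+1.
Qed.

Lemma smooth_wirt W (j : 'I_N) f : open W -> smooth_on W f ->
  smooth_on W (wirt j f).
Proof.
move=> oW hf.
have h1 := smooth_rderiv (j, false) hf.
have h2 := smoothZ (- 'i) oW (smooth_rderiv (j, true) hf).
have h3 := smoothM oW (smoothD oW h1 h2) (@smooth_cst W 2^-1).
by apply: (smooth_eq oW _ h3) => x _; rewrite /wirt mulNr.
Qed.

Lemma smooth_wirtbar W (j : 'I_N) f : open W -> smooth_on W f ->
  smooth_on W (wirtbar j f).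
Proof.
move=> oW hf.
have h1 := smooth_rderiv (j, false) hf.
have h2 := smoothZ 'i oW (smooth_rderiv (j, true) hf).
exact: (smoothM oW (smoothD oW h1 h2) (@smooth_cst W 2^-1)).
Qed.

Lemma smooth_sum W (I : Type) (r : seq I) (P : pred I) (F : I -> Cn R N -> Cplx R) :
  open W -> (forall i, P i -> smooth_on W (F i)) ->
  smooth_on W (fun x => \sum_(i <- r | P i) F i x).
Proof.
move=> oW h; elim: r => [|i r ih].
  apply: (smooth_eq oW _ (@smooth_cst W 0)) => x _; by rewrite big_nil.
case Pi: (P i).
  apply: (smooth_eq oW _ (smoothD oW (h i Pi) ih)) => x _.
  by rewrite big_cons Pi.
by apply: (smooth_eq oW _ ih) => x _; rewrite big_cons Pi.
Qed.

Lemma smooth_prod W (I : Type) (r : seq I) (P : pred I) (F : I -> Cn R N -> Cplx R) :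
  open W -> (forall i, P i -> smooth_on W (F i)) ->
  smooth_on W (fun x => \prod_(i <- r | P i) F i x).
Proof.
move=> oW h; elim: r => [|i r ih].
  apply: (smooth_eq oW _ (@smooth_cst W 1)) => x _; by rewrite big_nil.
case Pi: (P i).
  apply: (smooth_eq oW _ (smoothM oW (h i Pi) ih)) => x _.
  by rewrite big_cons Pi.
by apply: (smooth_eq oW _ ih) => x _; rewrite big_cons Pi.
Qed.

Lemma smooth_reC W f : open W -> smooth_on W f ->
  smooth_on W (fun x => toC (reC (f x))).
Proof.
move=> oW hf.
have h := smoothZ (toC 2^-1) oW (smoothD oW hf (smooth_conj oW hf)).
apply: (smooth_eq oW _ h) => x _; apply: Cplx_eq.
  by rewrite reCM reCD reC_conj !reC_toC imC_toC; field.
by rewrite imCM imCD imC_conj reC_toC !imC_toC; ring.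
Qed.

Lemma smooth_imC W f : open W -> smooth_on W f ->
  smooth_on W (fun x => toC (imC (f x))).
Proof.
move=> oW hf.
have h := smooth_reC oW (smoothZ (- 'i) oW hf).
apply: (smooth_eq oW _ h) => x _; congr toC.
by rewrite mulNr reCN reCM reCi imCi; ring.
Qed.

Lemma smooth_comp W (A : set R) (h : nat -> R -> R) (u : Cn R N -> R) :
  open W -> (forall i t, A t -> is_derive t 1 (h i) (h i.+1 t)) ->
  (forall x, W x -> A (u x)) -> smooth_on W (fun x => toC (u x)) ->
  smooth_on W (fun x => toC (h 0%N (u x))).
Proof.
move=> oW hh hA /smooth_onP hu; apply/smooth_onP => k.
exact: (cont_diff_comp oW hh hA (hu k)).
Qed.

Lemma smooth_ln W (u : Cn R N -> R) : open W ->
  (forall x, W x -> 0 < u x) -> smooth_on W (fun x => toC (u x)) ->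
  smooth_on W (fun x => toC (ln (u x))).
Proof.
move=> oW u0 /smooth_onP hu; apply/smooth_onP => k.
exact: (cont_diff_ln oW u0 (hu k)).
Qed.

Lemma smooth_continuous W f x : smooth_on W f -> W x -> {for x, continuous f}.
Proof. by move=> /smooth_onP h Wx; exact: (cont_diff_continuous (h 0%N) Wx). Qed.

Lemma smooth_sqnorm_on W (J : {set 'I_N}) : open W ->
  smooth_on W (fun x => toC (\sum_(j in J) modC (x 0 j) ^+ 2)).
Proof.
move=> oW.
apply: (smooth_eq (f := fun x => \sum_(j in J) Num.conj (x 0 j) * x 0 j) oW).
  by move=> x _; rewrite toC_sum; apply: eq_bigr => j _; rewrite conj_mul_sq.
apply: (smooth_sum _ oW) => j _.
exact: (smoothM oW (smooth_conj oW (smooth_coord j oW)) (smooth_coord j oW)).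
Qed.

End SmoothOn.

(* [L] sends real coordinate lines to real coordinate lines or points. *)
Lemma smooth_linear_comp (R : realType) N N' (L : Cn R N -> Cn R N')
    (e : 'I_N * bool -> option ('I_N' * bool)) (f : Cn R N' -> Cplx R) :
  (forall s x t, L (along s x t) =
     if e s is Some s' then along s' (L x) t else L x) ->
  continuous L -> smooth_on setT f -> smooth_on setT (fun x => f (L x)).
Proof.
move=> Le cL /smooth_onP hf; apply/smooth_onP => k; move: f {hf}(hf k).
elim: k => [|k ih] f kf.
  by split; [move=> x _; exact: (@continuous_comp _ _ _ L f x (cL x)
    (cont_diff_continuous kf (I : setT (L x))))|].
have [_ hf] := kf.
apply: (cont_diffS (f' := fun s x => if e s is Some s' then rderiv s' f (L x)
    else 0)); first exact: openT.
- by move=> x _; exact: (@continuous_comp _ _ _ L f x (cL x)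
    (cont_diff_continuous kf (I : setT (L x)))).
- move=> s x _; rewrite /is_rderiv; under eq_fun do rewrite Le.
  under [X in _ /\ is_derive _ _ X _]eq_fun do rewrite Le.
  case: (e s) => [s'|]; last exact: (is_rderiv_cst s x (f (L x))).
  by apply: is_rderivP; have [+ _] := hf s'; exact.
- move=> s; case: (e s) => [s'|]; last exact: cont_diff_cst.
  by apply: ih; have [] := hf s'.
Qed.

Section Projections.
Variables (R : realType) (d n : nat).

Lemma bpart_coord (x : Cn R (d + n)) j : bpart x 0 j = x 0 (lshift n j).
Proof. by rewrite mxE. Qed.

Lemma fpart_coord (x : Cn R (d + n)) j : fpart x 0 j = x 0 (rshift d j).
Proof. by rewrite mxE. Qed.

Lemma bpart_continuous : continuous (@bpart R d n).
Proof.
move=> x; apply: (@continuous_CnP R d _ (@bpart R d n) x) => j.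
have -> : (fun t : Cn R (d + n) => bpart t 0 j) = (fun t => t 0 (lshift n j)).
  by apply/funext => t; rewrite bpart_coord.
exact: coordC_continuous.
Qed.

Lemma smooth_bpart (f : Cn R d -> Cplx R) :
  smooth_on setT f -> smooth_on setT (fun x : Cn R (d + n) => f (bpart x)).
Proof.
apply: (@smooth_linear_comp R (d + n) d (@bpart R d n)
  (fun s => if fintype.split s.1 is inl j then Some (j, s.2) else None));
  last exact: bpart_continuous.
move=> [j b] x t; apply/rowP => k /=.
case: splitP => i ji; rewrite bpart_coord !mxE /=.
  suff -> : lshift n k == j = (k == i) by [].
  by rewrite -!val_eqE /= ji.
suff -> : lshift n k == j = false by case: b; rewrite !mulr0 addr0.
by rewrite -val_eqE /= ji ltn_eqF // (leq_trans (ltn_ord k)) // leq_addr.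
Qed.

End Projections.

(** * The exterior algebra *)

Section ExteriorAlgebra.
Variables (R : realType) (N : nat).
Implicit Types (a b c : covec R N) (A B D S : {set 'I_(N + N)}) (z : Cplx R).

Lemma covecZE z c S : (z *: c) S = z * c S.
Proof. by rewrite ffunE. Qed.

Lemma covecDE a b S : (a + b) S = a S + b S.
Proof. by rewrite ffunE. Qed.

Lemma ecovE A S : ecov R A S = (S == A)%:R.
Proof. by rewrite ffunE. Qed.

Lemma wedgeE a b S : wedge a b S = \sum_(A : {set 'I_(N + N)} | A \subset S)
      wsign R A (S :\: A)%SET * a A * b (S :\: A)%SET.
Proof. by rewrite ffunE. Qed.

Lemma wedgeDl a b c : wedge (a + b) c = wedge a c + wedge b c.
Proof.
apply/ffunP => S; rewrite covecDE !wedgeE -big_split /=; apply: eq_bigr => A _.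
by rewrite covecDE mulrDr mulrDl.
Qed.

Lemma wedgeDr a b c : wedge a (b + c) = wedge a b + wedge a c.
Proof.
apply/ffunP => S; rewrite covecDE !wedgeE -big_split /=; apply: eq_bigr => A _.
by rewrite covecDE mulrDr.
Qed.

Lemma wedgeZl z a b : wedge (z *: a) b = z *: wedge a b.
Proof.
apply/ffunP => S; rewrite covecZE !wedgeE mulr_sumr; apply: eq_bigr => A _.
by rewrite covecZE; ring.
Qed.

Lemma wedgeZr z a b : wedge a (z *: b) = z *: wedge a b.
Proof.
apply/ffunP => S; rewrite covecZE !wedgeE mulr_sumr; apply: eq_bigr => A _.
by rewrite covecZE; ring.
Qed.

Lemma wedge0l b : wedge 0 b = 0.
Proof. by rewrite -(scale0r (0 : covec R N)) wedgeZl !scale0r. Qed.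

Lemma wedge0r a : wedge a 0 = 0.
Proof. by rewrite -(scale0r (0 : covec R N)) wedgeZr !scale0r. Qed.

Lemma wedgeNl a b : wedge (- a) b = - wedge a b.
Proof. by rewrite -scaleN1r wedgeZl scaleN1r. Qed.

Lemma wedgeNr a b : wedge a (- b) = - wedge a b.
Proof. by rewrite -scaleN1r wedgeZr scaleN1r. Qed.

Lemma wedge_suml I (r : seq I) (P : pred I) (F : I -> covec R N) b :
  wedge (\sum_(i <- r | P i) F i) b = \sum_(i <- r | P i) wedge (F i) b.
Proof.
elim: r => [|i r ih]; first by rewrite !big_nil wedge0l.
by rewrite !big_cons; case: (P i); rewrite ?wedgeDl ih.
Qed.

Lemma wedge_sumr I (r : seq I) (P : pred I) (F : I -> covec R N) a :
  wedge a (\sum_(i <- r | P i) F i) = \sum_(i <- r | P i) wedge a (F i).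
Proof.
elim: r => [|i r ih]; first by rewrite !big_nil wedge0r.
by rewrite !big_cons; case: (P i); rewrite ?wedgeDr ih.
Qed.

Lemma covecE c : c = \sum_(S : {set 'I_(N + N)}) c S *: ecov R S.
Proof.
apply/ffunP => S; rewrite sum_ffunE.
rewrite (eq_bigr (fun B => c B * (S == B)%:R)); last first.
  by move=> B _; rewrite covecZE ecovE.
rewrite (bigD1 S isT) /= eqxx mulr1 big1 ?addr0 // => B /negPf BS.
by rewrite eq_sym BS mulr0.
Qed.

Definition inversions A B :=
  #|[set ab in finset.setX A B | (ab.2 < ab.1)%N]%SET|.

Lemma wsignE A B : wsign R A B = (-1) ^+ inversions A B.
Proof. by []. Qed.

Lemma inversionsUl A B D : [disjoint A & B]%B ->
  inversions (A :|: B)%SET D = (inversions A D + inversions B D)%N.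
Proof.
move=> AB; rewrite /inversions -cardsUI.
rewrite (_ : _ :&: _ = finset.set0)%SET ?cards0 ?addn0; last first.
  apply/finset.setP => -[i j]; rewrite !inE /=; apply/negbTE/negP.
  move=> /andP[/andP[/andP[iA _] _] /andP[/andP[iB _] _]].
  by move/pred0P: AB => /(_ i) /=; rewrite iA iB.
by apply: eq_card => -[i j]; rewrite !inE /= -andb_orl -andb_orl.
Qed.

Lemma inversionsUr A B D : [disjoint B & D]%B ->
  inversions A (B :|: D)%SET = (inversions A B + inversions A D)%N.
Proof.
move=> BD; rewrite /inversions -cardsUI.
rewrite (_ : _ :&: _ = finset.set0)%SET ?cards0 ?addn0; last first.
  apply/finset.setP => -[i j]; rewrite !inE /=; apply/negbTE/negP.
  move=> /andP[/andP[/andP[_ jB] _] /andP[/andP[_ jD] _]].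
  by move/pred0P: BD => /(_ j) /=; rewrite jB jD.
by apply: eq_card => -[i j]; rewrite !inE /= -andb_orl -andb_orr.
Qed.

Lemma wedge_ecov A B : wedge (ecov R A) (ecov R B) =
  if [disjoint A & B]%B then wsign R A B *: ecov R (A :|: B)%SET else 0.
Proof.
apply/ffunP => S; rewrite wedgeE.
case: ifPn => dAB; last first.
  rewrite [RHS]ffunE big1 // => D DS; rewrite !ecovE.
  case: eqP => [DA|_]; last by rewrite mulr0 mul0r.
  case: eqP => [SB|_]; last by rewrite mulr0.
  move/negP: dAB; case; rewrite -finset.setI_eq0 -SB -DA; apply/eqP/finset.setP => i.
  by rewrite !inE; case: (i \in D); rewrite ?andbF.
rewrite covecZE ecovE; case: eqP => [->|SAB].
  rewrite (bigD1 A) ?finset.subsetUl //= !ecovE eqxx.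
  have -> : ((A :|: B) :\: A = B)%SET.
    by rewrite finset.setDUl finset.setDv finset.set0U; apply/finset.setDidPl; rewrite disjoint_sym.
  rewrite eqxx !mulr1 big1 ?addr0 // => D /andP[_ /negPf DA].
  by rewrite !ecovE DA mulr0 mul0r.
rewrite [RHS]mulr0 big1 // => D DS; rewrite !ecovE.
case: eqP => [DA|_]; last by rewrite mulr0 mul0r.
case: eqP => [SB|_]; last by rewrite mulr0.
by case: SAB; rewrite -SB -DA -{1}(finset.setID S D) (finset.setIidPr DS).
Qed.

Lemma ecov0l c : wedge (ecov R finset.set0) c = c.
Proof.
rewrite [in LHS](covecE c) wedge_sumr [RHS]covecE; apply: eq_bigr => S _.
rewrite wedgeZr wedge_ecov finset.set0U -finset.setI_eq0 finset.set0I eqxx.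
rewrite wsignE (_ : inversions _ _ = 0%N) ?expr0 ?scale1r //.
by apply/eqP; rewrite cards_eq0; apply/eqP/finset.setP => i; rewrite !inE.
Qed.

Lemma ecov0r c : wedge c (ecov R finset.set0) = c.
Proof.
rewrite [in LHS](covecE c) wedge_suml [RHS]covecE; apply: eq_bigr => S _.
rewrite wedgeZl wedge_ecov finset.setU0 -finset.setI_eq0 finset.setI0 eqxx.
rewrite wsignE (_ : inversions _ _ = 0%N) ?expr0 ?scale1r //.
by apply/eqP; rewrite cards_eq0; apply/eqP/finset.setP => i; rewrite !inE andbF.
Qed.

Lemma disjoint_setUl A B D :
  [disjoint (A :|: B)%SET & D]%B = [disjoint A & D]%B && [disjoint B & D]%B.
Proof. by rewrite -!finset.setI_eq0 finset.setIUl finset.setU_eq0. Qed.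

Lemma disjoint_setUr A B D :
  [disjoint A & (B :|: D)%SET]%B = [disjoint A & B]%B && [disjoint A & D]%B.
Proof. by rewrite -!finset.setI_eq0 finset.setIUr finset.setU_eq0. Qed.

Opaque wedge ecov wsign.

(** Inversions are additive under disjoint unions in either argument, so both sides carry the sign
    of inv(A,B) + inv(A,D) + inv(B,D). *)
Lemma wedgeA_ecov A B D : wedge (ecov R A) (wedge (ecov R B) (ecov R D)) =
  wedge (wedge (ecov R A) (ecov R B)) (ecov R D).
Proof.
rewrite (wedge_ecov B D) (wedge_ecov A B).
case BD: [disjoint B & D]%B; case AB: [disjoint A & B]%B.
- rewrite wedgeZr wedgeZl (wedge_ecov A) (wedge_ecov _ D).
  rewrite disjoint_setUl disjoint_setUr AB BD andbT /=.
  case: [disjoint A & D]%B; last by rewrite !scaler0.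
  rewrite !scalerA finset.setUA; congr (_ *: _).
  rewrite !wsignE -!exprD inversionsUl // inversionsUr //.
  by congr (_ ^+ _); lia.
- by rewrite wedgeZr wedge0l (wedge_ecov A) disjoint_setUr AB scaler0.
- by rewrite wedge0r wedgeZl (wedge_ecov _ D) disjoint_setUl BD andbF scaler0.
- by rewrite wedge0r wedge0l.
Qed.

End ExteriorAlgebra.

Lemma covec_linear_ext (R : realType) N (V : lmodType (Cplx R))
    (F G : covec R N -> V) :
  (forall z a b, F (z *: a + b) = z *: F a + F b) ->
  (forall z a b, G (z *: a + b) = z *: G a + G b) ->
  (forall A, F (ecov R A) = G (ecov R A)) -> F =1 G.
Proof.
move=> linF linG FG c; rewrite (covecE c).
have F0 (H : covec R N -> V) : (forall z a b, H (z *: a + b) = z *: H a + H b) ->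
    H 0 = 0.
  by move=> linH; have := linH (-1) 0 0; rewrite scaler0 addr0 scaleN1r addNr.
elim: (index_enum _) => [|A r ih]; first by rewrite !big_nil !F0.
by rewrite !big_cons linF linG FG ih.
Qed.

Section WedgeAssociativity.
Variables (R : realType) (N : nat).
Implicit Types (a b c : covec R N).

Lemma wedge_linearl c z a b :
  wedge (z *: a + b) c = z *: wedge a c + wedge b c.
Proof. by rewrite wedgeDl wedgeZl. Qed.

Lemma wedge_linearr c z a b :
  wedge c (z *: a + b) = z *: wedge c a + wedge c b.
Proof. by rewrite wedgeDr wedgeZr. Qed.

Lemma wedgeA a b c : wedge a (wedge b c) = wedge (wedge a b) c.
Proof.
move: a; apply: covec_linear_ext => [z a a'|z a a'|A]; rewrite ?wedge_linearl //.
move: b; apply: covec_linear_ext => [z a a'|z a a'|B].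
- by rewrite wedge_linearl wedge_linearr.
- by rewrite wedge_linearr wedge_linearl.
move: c; apply: covec_linear_ext => [z a a'|z a a'|D].
- by rewrite !wedge_linearr.
- by rewrite wedge_linearr.
exact: wedgeA_ecov.
Qed.

End WedgeAssociativity.

(** * Hermitian (1,1)-covectors and Lagrange's identity *)

Section OneOneForms.
Variables (R : realType) (N : nat).
Implicit Types (a : Cn R N) (c : covec R N) (J : {set 'I_N}) (z : Cplx R).

(** This is dz_j /\ dzbar_k, the basis in which [herm] expands a (1,1)-covector with the factor i
    taken out. *)
Definition dzbar (j k : 'I_N) : covec R N :=
  wedge (ecov R [set lshift N j]%SET) (ecov R [set rshift N k]%SET).

Definition herm (G : 'I_N -> 'I_N -> Cplx R) : covec R N :=
  'i *: \sum_j \sum_k G j k *: dzbar j k.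

Definition posform a : covec R N := 'i *: wedge (holcov a) (antiholcov a).

Lemma posformE a : posform a = herm (fun j k => a 0 j * Num.conj (a 0 k)).
Proof.
rewrite /posform /herm /holcov /antiholcov wedge_suml; congr (_ *: _).
apply: eq_bigr => j _; rewrite wedge_sumr; apply: eq_bigr => k _.
by rewrite wedgeZl wedgeZr scalerA.
Qed.

Lemma eq_herm G G' : (forall j k, G j k = G' j k) -> herm G = herm G'.
Proof.
move=> GG; congr (_ *: _); apply: eq_bigr => j _; apply: eq_bigr => k _.
by rewrite GG.
Qed.

Lemma hermD G G' : herm (fun j k => G j k + G' j k) = herm G + herm G'.
Proof.
rewrite /herm -scalerDr -big_split; congr (_ *: _); apply: eq_bigr => j _.
rewrite -big_split; apply: eq_bigr => k _.
by rewrite /= scalerDl.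
Qed.

Lemma hermZ z G : herm (fun j k => z * G j k) = z *: herm G.
Proof.
rewrite /herm !scaler_sumr; apply: eq_bigr => j _.
rewrite !scaler_sumr; apply: eq_bigr => k _.
by rewrite !scalerA; congr (_ *: _); ring.
Qed.

Lemma herm0 : herm (fun _ _ => 0) = 0.
Proof.
have -> : herm (fun _ _ => 0) = herm (fun _ _ => 0 * 0).
  by apply: eq_herm => j k; rewrite mul0r.
by rewrite hermZ scale0r.
Qed.

Lemma herm_sum I (r : seq I) (P : pred I) F :
  herm (fun j k => \sum_(i <- r | P i) F i j k) =
  \sum_(i <- r | P i) herm (F i).
Proof.
elim: r => [|i r ih].
  by rewrite big_nil -herm0; apply: eq_herm => j k; rewrite big_nil.
rewrite big_cons; case Pi: (P i); rewrite -ih -?hermD;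
  by apply: eq_herm => j k; rewrite big_cons Pi.
Qed.

Definition unitv (j : 'I_N) : Cn R N := delta_mx 0 j.

Lemma unitvE j k : unitv j 0 k = (k == j)%:R.
Proof. by rewrite mxE eqxx. Qed.

(** Up to normalisation, dd^c of the sum of |x_j|^2 over [J]. Restricting to a subset of the
    coordinates lets C^n and the fibre directions of C^(d+n) share the same formulas. *)
Definition kahler J : covec R N := \sum_(j in J) posform (unitv j).

Lemma kahlerE J : kahler J = herm (fun j k => ((j == k) && (j \in J))%:R).
Proof.
rewrite /kahler; under eq_bigr do rewrite posformE.
rewrite -herm_sum; apply: eq_herm => j k.
have [jJ|jJ] := boolP (j \in J); last first.
  rewrite andbF big1 // => i iJ; rewrite !unitvE.
  by rewrite (_ : j == i = false) ?mul0r //; apply: contraNF jJ => /eqP ->.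
rewrite (bigD1 j) //= !unitvE eqxx mul1r andbT big1 ?addr0.
  by rewrite Cconj_nat eq_sym.
move=> i /andP[_ /negPf ij]; rewrite !unitvE.
by rewrite eq_sym ij mul0r.
Qed.

(* Lagrange's identity for the covector a. *)
Lemma kahler_lagrange J a : (forall j, j \notin J -> a 0 j = 0) ->
  toC (\sum_(j in J) modC (a 0 j) ^+ 2) *: kahler J =
  posform a + toC 2^-1 *: \sum_(j in J) \sum_(k in J)
    posform (Num.conj (a 0 j) *: unitv k - Num.conj (a 0 k) *: unitv j).
Proof.
move=> aJ; rewrite kahlerE posformE.
pose W j k := Num.conj (a 0 j) *: unitv k - Num.conj (a 0 k) *: unitv j.
have -> : \sum_(j in J) \sum_(k in J) posform (W j k) = herm (fun p q =>
    \sum_(j in J) \sum_(k in J) W j k 0 p * Num.conj (W j k 0 q)).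
  rewrite herm_sum; apply: eq_bigr => j _; rewrite herm_sum.
  by apply: eq_bigr => k _; rewrite posformE.
rewrite -!hermZ -hermD; apply: eq_herm => p q.
have sumJ (F : 'I_N -> Cplx R) p' : \sum_(j in J) F j * (p' == j)%:R =
    if p' \in J then F p' else 0.
  rewrite big_mkcond (bigD1 p') //= eqxx mulr1 big1 ?addr0 // => i /negPf ip.
  by rewrite eq_sym ip mulr0 if_same.
pose A j := a 0 j; pose B j := Num.conj (a 0 j).
(* Each term becomes a factor in j times a factor in k, so that the double sums factor. *)
have E j k : W j k 0 p * Num.conj (W j k 0 q)
  = B j * A j * ((p == k)%:R * (q == k)%:R)
    - (B j * (q == j)%:R) * (A k * (p == k)%:R)
    - (A j * (p == j)%:R) * (B k * (q == k)%:R)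
    + ((p == j)%:R * (q == j)%:R) * (B k * A k).
  rewrite /W !mxE !eqxx /= CconjB !CconjM !CconjK !Cconj_nat -/(A j) -/(A k) -/(B j) -/(B k).
  by ring.
have -> : \sum_(j in J) \sum_(k in J) W j k 0 p * Num.conj (W j k 0 q) =
    \sum_(j in J) B j * A j * (\sum_(k in J) (p == k)%:R * (q == k)%:R)
    - (\sum_(j in J) B j * (q == j)%:R) * (\sum_(k in J) A k * (p == k)%:R)
    - (\sum_(j in J) A j * (p == j)%:R) * (\sum_(k in J) B k * (q == k)%:R)
    + (\sum_(j in J) (p == j)%:R * (q == j)%:R) * (\sum_(k in J) B k * A k).
  rewrite !mulr_suml -!sumrB -big_split; apply: eq_bigr => j _ /=.
  rewrite !mulr_sumr -!sumrB -big_split; apply: eq_bigr => k _ /=.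
  exact: E.
have S1 : \sum_(k in J) ((p == k)%:R * (q == k)%:R : Cplx R) =
    ((p == q) && (p \in J))%:R.
  by rewrite sumJ; have [->|_] := eqVneq p q; case: (q \in J).
rewrite S1 !sumJ -mulr_suml.
have -> : \sum_(i in J) B i * A i = toC (\sum_(j in J) modC (a 0 j) ^+ 2).
  by rewrite toC_sum; apply: eq_bigr => j _; rewrite conj_mul_sq.
have hA x : (if x \in J then A x else 0) = A x.
  by case: ifPn => // /aJ; rewrite /A => ->.
have hB x : (if x \in J then B x else 0) = B x.
  by case: ifPn => // /aJ; rewrite /B => ->; rewrite Cconj0.
rewrite !hA !hB -/(A p) -/(B q).
have -> : toC 2^-1 = 2^-1 :> Cplx R by rewrite toCV; congr (_^-1); rewrite /toC rmorph_nat.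
set x := toC _; set y := _%:R.
by field.
Qed.

End OneOneForms.

(** * Strongly positive covectors *)

Section StrongPositivity.
Variables (R : realType) (N : nat).
Implicit Types (a : Cn R N) (c : covec R N) (l : seq (Cn R N)) (J : {set 'I_N}).

(** Weighted lists in place of families indexed by ['I_r]: a sum of two combinations is then a
    concatenation. *)
Definition pos_comb (k : nat) c := exists2 s : seq (R * seq (Cn R N)),
  all (fun p => (0 <= p.1) && (size p.2 == k)) s &
  c = \sum_(p <- s) toC p.1 *: elemcov p.2.

Lemma pos_combP k c : strongly_positive_covec k c <-> pos_comb k c.
Proof.
split=> [[r [g [a [g0 ->]]]]|[s /allP hs ->]].
  exists [seq (g i, val (a i)) | i <- index_enum 'I_r].
    by apply/allP => _ /mapP[i _ ->] /=; rewrite g0 size_tuple eqxx.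
  by rewrite big_map.
pose F (p : R * seq (Cn R N)) : k.-tuple (Cn R N) := insubd [tuple of nseq k 0] p.2.
exists (size s), (fun i => (tnth (in_tuple s) i).1),
  (fun i => F (tnth (in_tuple s) i)); split.
  by move=> i; have /hs/andP[] := mem_tnth i (in_tuple s).
rewrite big_tnth; apply: eq_bigr => i _; congr (_ *: elemcov _).
by rewrite /F val_insubd; have /hs/andP[_ ->] := mem_tnth i (in_tuple s).
Qed.

Lemma pos_comb0 k : pos_comb k 0.
Proof. by exists [::]; rewrite ?big_nil. Qed.

Lemma pos_combD k c c' : pos_comb k c -> pos_comb k c' -> pos_comb k (c + c').
Proof.
move=> [s hs ->] [s' hs' ->]; exists (s ++ s'); first by rewrite all_cat hs hs'.
by rewrite big_cat.
Qed.

Lemma pos_combZ k (t : R) c : 0 <= t -> pos_comb k c -> pos_comb k (toC t *: c).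
Proof.
move=> t0 [s /allP hs ->]; exists [seq (t * p.1, p.2) | p <- s].
  apply/allP => _ /mapP[p /hs /andP[p0 sp] ->] /=.
  by rewrite mulr_ge0.
rewrite big_map scaler_sumr; apply: eq_bigr => p _.
by rewrite scalerA toCM.
Qed.

Lemma pos_comb_sum k I (r : seq I) (P : pred I) (F : I -> covec R N) :
  (forall i, P i -> pos_comb k (F i)) -> pos_comb k (\sum_(i <- r | P i) F i).
Proof.
move=> h; elim/big_rec: _ => [|i x Pi]; first exact: pos_comb0.
exact: pos_combD (h i Pi).
Qed.

Lemma elemcov_cons a l : elemcov (a :: l) = wedge (posform a) (elemcov l).
Proof. by []. Qed.

Lemma pos_comb_elemcov l : pos_comb (size l) (elemcov l).
Proof.
exists [:: (1, l)]; first by rewrite /= ler01 eqxx.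
by rewrite big_seq1 toC1 scale1r.
Qed.

Lemma elemcov_cat l l' : elemcov (l ++ l') = wedge (elemcov l) (elemcov l').
Proof.
elim: l => [|a l ih]; first by rewrite ecov0l.
by rewrite cat_cons !elemcov_cons ih wedgeA.
Qed.

Lemma pos_comb_wedge k k' c c' :
  pos_comb k c -> pos_comb k' c' -> pos_comb (k + k') (wedge c c').
Proof.
move=> [s /allP hs ->] [s' /allP hs' ->].
rewrite wedge_suml big_seq; apply: pos_comb_sum => p /hs /andP[p0 /eqP <-].
rewrite wedge_sumr big_seq; apply: pos_comb_sum => p' /hs' /andP[p'0 /eqP <-].
rewrite wedgeZl wedgeZr -elemcov_cat; apply: pos_combZ => //.
apply: pos_combZ => //; rewrite -size_cat; exact: pos_comb_elemcov.
Qed.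

Lemma pos_comb_posform a : pos_comb 1 (posform a).
Proof.
have := pos_comb_elemcov [:: a]; rewrite elemcov_cons.
by rewrite (_ : elemcov [::] = ecov R finset.set0) // ecov0r.
Qed.

Lemma pos_comb_kahler J : pos_comb 1 (kahler R J).
Proof. by apply: pos_comb_sum => j _; exact: pos_comb_posform. Qed.

(** Lagrange's identity writes the difference as half a sum of elementary positive covectors. Both
    the positivity of the kernels and the domination of weights rest on this. *)
Lemma pos_comb_lagrange J a : (forall j, j \notin J -> a 0 j = 0) ->
  pos_comb 1 (toC (\sum_(j in J) modC (a 0 j) ^+ 2) *: kahler R J - posform a).
Proof.
move=> /kahler_lagrange ->; rewrite addrC addKr; apply: pos_combZ.
  by rewrite invr_ge0 ler0n.
apply: pos_comb_sum => j _; apply: pos_comb_sum => k _; exact: pos_comb_posform.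
Qed.

Definition kahler_pow J k : covec R N :=
  iter k (wedge (kahler R J)) (ecov R finset.set0).

Lemma pos_comb_kahler_pow J k : pos_comb k (kahler_pow J k).
Proof.
elim: k => [|k ih]; first exact: (pos_comb_elemcov [::]).
exact: (pos_comb_wedge (pos_comb_kahler J) ih).
Qed.

(** Induction on the length. With b = |a|^2 and K the full [kahler], one has b t K^(k+1) - a /\ l =
    (b K - a) /\ t K^k + a /\ (t K^k - l), where a and l stand for their elementary covectors, and
    both terms are positive. *)
Lemma elemcov_dominated l : exists2 t : R, 0 <= t &
  pos_comb (size l) (toC t *: kahler_pow finset.setT (size l) - elemcov l).
Proof.
elim: l => [|a l [t t0 ih]].
  by exists 1 => //; rewrite toC1 scale1r subrr; exact: pos_comb0.
pose b := \sum_(j in finset.setT) modC (a 0 j) ^+ 2.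
have b0 : 0 <= b by apply: sumr_ge0 => j _; exact: sqr_ge0.
exists (b * t); first exact: mulr_ge0.
pose K := kahler R [set: 'I_N]%SET.
have -> : toC (b * t) *: kahler_pow finset.setT (size (a :: l)) - elemcov (a :: l)
   = wedge (toC b *: K - posform a) (toC t *: kahler_pow finset.setT (size l))
   + wedge (posform a) (toC t *: kahler_pow finset.setT (size l) - elemcov l).
  rewrite elemcov_cons wedgeDl wedgeDr wedgeNl wedgeNr addrA subrK.
  by rewrite wedgeZl wedgeZr scalerA -toCM.
apply: pos_combD.
  apply: (pos_comb_wedge (pos_comb_lagrange _)).
    by move=> j; rewrite inE.
  exact: pos_combZ (pos_comb_kahler_pow _ _).
exact: (pos_comb_wedge (pos_comb_posform a) ih).
Qed.

End StrongPositivity.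

(** * Elementary covectors span the covectors of bidegree (r, r) *)

Section Span.
Variables (R : realType) (N : nat).
Implicit Types (a : Cn R N) (c : covec R N) (l : seq (Cn R N)).

Definition elem_span (k : nat) c := exists2 s : seq (Cplx R * seq (Cn R N)),
  all (fun p => size p.2 == k) s & c = \sum_(p <- s) p.1 *: elemcov p.2.

Lemma elem_spanD k c c' : elem_span k c -> elem_span k c' -> elem_span k (c + c').
Proof.
move=> [s hs ->] [s' hs' ->]; exists (s ++ s'); first by rewrite all_cat hs hs'.
by rewrite big_cat.
Qed.

Lemma elem_spanZ k z c : elem_span k c -> elem_span k (z *: c).
Proof.
move=> [s /allP hs ->]; exists [seq (z * p.1, p.2) | p <- s].
  by apply/allP => _ /mapP[p /hs sp ->].
by rewrite big_map scaler_sumr; apply: eq_bigr => p _; rewrite scalerA.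
Qed.

Lemma elem_span_sum k I (r : seq I) (P : pred I) (F : I -> covec R N) :
  (forall i, P i -> elem_span k (F i)) -> elem_span k (\sum_(i <- r | P i) F i).
Proof.
move=> h; elim/big_rec: _ => [|i x Pi]; first by exists [::]; rewrite ?big_nil.
exact: elem_spanD (h i Pi).
Qed.

Lemma elem_span_posform k a c : elem_span k c -> elem_span k.+1 (wedge (posform a) c).
Proof.
move=> [s /allP hs ->]; exists [seq (p.1, a :: p.2) | p <- s].
  by apply/allP => _ /mapP[p /hs sp ->] /=; rewrite eqSS.
by rewrite big_map wedge_sumr; apply: eq_bigr => p _; rewrite wedgeZr.
Qed.

Lemma dzbar_herm (j k : 'I_N) :
  'i *: dzbar R j k = herm (fun p q => ((p == j) && (q == k))%:R).
Proof.
rewrite /herm; congr (_ *: _); rewrite (bigD1 j) //= (bigD1 k) //= !eqxx scale1r.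
rewrite big1 => [|q /negPf ->]; last by rewrite scale0r.
rewrite addr0 big1 ?addr0 // => p /negPf pj; rewrite big1 // => q _.
by rewrite pj scale0r.
Qed.

(** Polarisation over the fourth roots of unity: after weighting by i^s, only the mixed term dz_j /\
    dzbar_k survives the sum over s, and it occurs four times. *)
Lemma dzbar_polarization (j k : 'I_N) : 'i *: dzbar R j k =
  toC 4^-1 *: \sum_(s < 4) 'i ^+ s *: posform (unitv R j + 'i ^+ s *: unitv R k).
Proof.
rewrite dzbar_herm.
have -> : \sum_(s < 4) 'i ^+ s *: posform (unitv R j + 'i ^+ s *: unitv R k) =
  herm (fun p q => \sum_(s < 4) 'i ^+ s *
   ((unitv R j + 'i ^+ s *: unitv R k) 0 p *
     Num.conj ((unitv R j + 'i ^+ s *: unitv R k) 0 q))).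
  by rewrite herm_sum; apply: eq_bigr => s _; rewrite hermZ posformE.
rewrite -hermZ; apply: eq_herm => p q.
pose A : Cplx R := (p == j)%:R; pose B : Cplx R := (p == k)%:R.
pose D : Cplx R := (q == j)%:R; pose E : Cplx R := (q == k)%:R.
pose I : Cplx R := 'i; pose J := Num.conj I.
have II : I * I = -1 by rewrite -expr2 sqrCi.
have IJ : J = - I := conjCi _.
have -> : ((p == j) && (q == k))%:R = A * E by rewrite -natrM mulnb.
have F w : (unitv R j + w *: unitv R k) 0 p *
     Num.conj ((unitv R j + w *: unitv R k) 0 q) = (A + w * B) * (D + Num.conj w * E).
  by rewrite !mxE !eqxx /= !(CconjD, CconjM, Cconj_nat).
under eq_bigr do rewrite F.
have -> : toC 4^-1 = 4^-1 :> Cplx R.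
  by rewrite toCV; congr (_^-1); rewrite /toC rmorph_nat.
have p3 : I ^+ 3 = - I by rewrite exprS expr2 II mulrN1.
rewrite !big_ord_recr big_ord0 /= -/I p3 expr2 II expr1 expr0.
rewrite !CconjN Cconj1 -/J IJ add0r.
suff -> : A * E = 4^-1 * ((A + B) * (D + E) + (B * D - A * E) * (I * I) * 2
    - (A - B) * (D - E)) by congr (_ * _); ring.
by rewrite II; field.
Qed.
Definition holn (S : {set 'I_(N + N)}) := #|[set j : 'I_N | lshift N j \in S]%SET|.
Definition aholn (S : {set 'I_(N + N)}) := #|[set j : 'I_N | rshift N j \in S]%SET|.

Lemma wsign_sqr (A B : {set 'I_(N + N)}) : wsign R A B * wsign R A B = 1.
Proof. by rewrite wsignE -expr2 sqrr_sign. Qed.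

Lemma elem_span_dzbar k (i j : 'I_N) c :
  elem_span k c -> elem_span k.+1 (wedge (dzbar R i j) c).
Proof.
move=> hc.
have -> : dzbar R i j = - 'i *: ('i *: dzbar R i j).
  by rewrite scalerA mulNr -expr2 sqrCi opprK scale1r.
rewrite dzbar_polarization !wedgeZl; do 2! apply: elem_spanZ.
rewrite wedge_suml; apply: elem_span_sum => s _; rewrite wedgeZl.
by apply: elem_spanZ; exact: elem_span_posform.
Qed.

(** One dz_i and one dzbar_j are split off at a time. The reordering signs square to 1 and can be
    moved to the other side; the split factor is absorbed by polarisation. *)
Lemma ecov_span r (S : {set 'I_(N + N)}) : holn S = r -> aholn S = r ->
  elem_span r (ecov R S).
Proof.
elim: r S => [|r ih] S hS aS.
  exists [:: (1, [::])] => //; rewrite big_seq1 scale1r.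
  congr ecov; apply/finset.setP => x; rewrite [RHS]inE; apply/negbTE.
  rewrite -(splitK x); case: fintype.split => j /=; apply/negP => jS.
    have /eqP := hS; rewrite cards_eq0 => /eqP/finset.setP/(_ j).
    by rewrite !inE jS.
  have /eqP := aS; rewrite cards_eq0 => /eqP/finset.setP/(_ j).
  by rewrite !inE jS.
have [i +] : exists j, j \in [set j : 'I_N | lshift N j \in S]%SET.
  by apply/finset.set0Pn; rewrite -card_gt0 -/(holn S) hS.
have [j +] : exists j, j \in [set j : 'I_N | rshift N j \in S]%SET.
  by apply/finset.set0Pn; rewrite -card_gt0 -/(aholn S) aS.
rewrite !inE => jS iS.
pose A := [set lshift N i]%SET; pose B := [set rshift N j]%SET.
pose S' := (S :\: (A :|: B))%SET.
have lr (a b : 'I_N) : (lshift N a == rshift N b) = false by rewrite eq_lrshift.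
have rl (a b : 'I_N) : (rshift N a == lshift N b) = false by rewrite eq_rlshift.
have hS' : holn S' = r.
  apply/eqP; rewrite -eqSS -hS eq_sym /holn.
  rewrite (cardsD1 i [set a | lshift N a \in S]%SET) !inE iS add1n eqSS.
  apply/eqP; apply: eq_card => a; rewrite !inE lr orbF.
  by rewrite (inj_eq (@lshift_inj _ _)) andbC.
have aS' : aholn S' = r.
  apply/eqP; rewrite -eqSS -aS eq_sym /aholn.
  rewrite (cardsD1 j [set a | rshift N a \in S]%SET) !inE jS add1n eqSS.
  apply/eqP; apply: eq_card => a; rewrite !inE rl /=.
  by rewrite (inj_eq (@rshift_inj _ _)) andbC.
have dAB : [disjoint A & B]%B.
  by rewrite -finset.setI_eq0; apply/eqP/finset.setP => x; rewrite !inE;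
    case: eqP => // ->; rewrite lr.
have dS : [disjoint (A :|: B)%SET & S']%B.
  by rewrite -finset.setI_eq0; apply/eqP/finset.setP => x; rewrite !inE;
    case: (_ || _).
have SE : (A :|: B :|: S')%SET = S.
  apply/finset.setP => x; rewrite !inE; case: eqP => [->|_]; first by rewrite iS.
  by case: eqP => [->|_]; first by rewrite jS.
have -> : ecov R S = (wsign R A B * wsign R (A :|: B)%SET S') *:
    wedge (dzbar R i j) (ecov R S').
  rewrite /dzbar (wedge_ecov _ A B) dAB wedgeZl (wedge_ecov _ _ S') dS SE !scalerA.
  have sq (x y : Cplx R) : x * x = 1 -> y * y = 1 -> x * y * x * y = 1.
    by move=> x1 y1; rewrite (mulrAC x) x1 mul1r y1.
  by rewrite (sq _ _ (wsign_sqr _ _) (wsign_sqr _ _)) scale1r.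
apply: elem_spanZ; apply: elem_span_dzbar; exact: ih.
Qed.

End Span.

Section Bidegree.
Variables (R : realType) (N : nat).
Implicit Types (a b c : covec R N).

Lemma holnU (A B : {set 'I_(N + N)}) : [disjoint A & B]%B ->
  holn (A :|: B)%SET = (holn A + holn B)%N.
Proof.
move=> /pred0P dAB.
have I0 : ([set j : 'I_N | lshift N j \in A] :&: [set j | lshift N j \in B])%SET
    = finset.set0.
  by apply/finset.setP => i; rewrite !inE; exact: (dAB (lshift N i)).
rewrite /holn -cardsUI I0 cards0 addn0.
by apply: eq_card => i; rewrite !inE.
Qed.

Lemma aholnU (A B : {set 'I_(N + N)}) : [disjoint A & B]%B ->
  aholn (A :|: B)%SET = (aholn A + aholn B)%N.
Proof.
move=> /pred0P dAB.
have I0 : ([set j : 'I_N | rshift N j \in A] :&: [set j | rshift N j \in B])%SET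
    = finset.set0.
  by apply/finset.setP => i; rewrite !inE; exact: (dAB (rshift N i)).
rewrite /aholn -cardsUI I0 cards0 addn0.
by apply: eq_card => i; rewrite !inE.
Qed.

Lemma bidegree_wedge k l k' l' a b : bidegree_covec k l a ->
  bidegree_covec k' l' b -> bidegree_covec (k + k') (l + l') (wedge a b).
Proof.
move=> ha hb S; rewrite wedgeE => S0.
have [A AS nz] : exists2 A : {set 'I_(N + N)}, A \subset S &
    wsign R A (S :\: A)%SET * a A * b (S :\: A)%SET != 0.
  apply/exists_inP; apply: contraNT S0; rewrite negb_exists_in.
  move=> /forall_inP h; rewrite big1 // => A AS.
  by apply/eqP; have := h A AS; rewrite negbK.
have [] := ha A; first by apply: contraNneq nz => ->; rewrite mulr0 mul0r.
have [] := hb (S :\: A)%SET; first by apply: contraNneq nz => ->; rewrite mulr0.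
have dA : [disjoint A & (S :\: A)%SET]%B.
  by rewrite -finset.setI_eq0; apply/eqP/finset.setP => x; rewrite !inE; case: (x \in A).
have SE : S = (A :|: S :\: A)%SET.
  by rewrite finset.setDE finset.setUIr finset.setUCr finset.setIT; apply/esym/finset.setUidPr.
rewrite -/(holn _) -/(aholn _) => hb1 hb2; rewrite -/(holn _) -/(aholn _) => ha1 ha2.
by rewrite -/(holn S) -/(aholn S) SE holnU // aholnU // ha1 ha2 hb1 hb2.
Qed.

Lemma bidegreeD k l a b : bidegree_covec k l a -> bidegree_covec k l b ->
  bidegree_covec k l (a + b).
Proof.
move=> ha hb S; rewrite covecDE => ab.
have [aS|/negPn/eqP aS] := boolP (a S != 0); first exact: ha.
by apply: hb; rewrite aS add0r in ab.
Qed.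

Lemma bidegreeZ k l (z : Cplx R) a : bidegree_covec k l a -> bidegree_covec k l (z *: a).
Proof.
move=> ha S; rewrite covecZE => zS; apply: ha.
by apply: contraNneq zS => ->; rewrite mulr0.
Qed.

Lemma bidegree0 k l : bidegree_covec k l (0 : covec R N).
Proof. by move=> S; rewrite ffunE eqxx. Qed.

Lemma bidegree_sum k l I (r : seq I) (P : pred I) (F : I -> covec R N) :
  (forall i, P i -> bidegree_covec k l (F i)) ->
  bidegree_covec k l (\sum_(i <- r | P i) F i).
Proof.
move=> h; elim/big_rec: _ => [|i x Pi]; first exact: bidegree0.
exact: bidegreeD (h i Pi).
Qed.

Lemma bidegree_ecov (A : {set 'I_(N + N)}) : bidegree_covec (holn A) (aholn A) (ecov R A).
Proof. by move=> S; rewrite ecovE; case: (S =P A) => [->|]; rewrite ?eqxx. Qed.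

Lemma bidegree_one : bidegree_covec 0 0 (ecov R (finset.set0 : {set 'I_(N + N)})).
Proof.
have := @bidegree_ecov finset.set0.
have -> : holn (finset.set0 : {set 'I_(N + N)}) = 0%N.
  by apply/eqP; rewrite cards_eq0; apply/eqP/finset.setP => i; rewrite !inE.
have -> // : aholn (finset.set0 : {set 'I_(N + N)}) = 0%N.
by apply/eqP; rewrite cards_eq0; apply/eqP/finset.setP => i; rewrite !inE.
Qed.

Lemma bidegree_dzbar (i j : 'I_N) : bidegree_covec 1 1 (dzbar R i j).
Proof.
have lr (a b : 'I_N) : (lshift N a == rshift N b) = false by rewrite eq_lrshift.
have rl (a b : 'I_N) : (rshift N a == lshift N b) = false by rewrite eq_rlshift.
have E1 : holn [set lshift N i]%SET = 1%N.
  rewrite /holn -(cards1 i); apply: eq_card => k.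
  by rewrite !inE (inj_eq (@lshift_inj _ _)).
have E2 : aholn [set lshift N i]%SET = 0%N.
  by apply/eqP; rewrite cards_eq0; apply/eqP/finset.setP => k; rewrite !inE rl.
have E3 : aholn [set rshift N j]%SET = 1%N.
  rewrite /aholn -(cards1 j); apply: eq_card => k.
  by rewrite !inE (inj_eq (@rshift_inj _ _)).
have E4 : holn [set rshift N j]%SET = 0%N.
  by apply/eqP; rewrite cards_eq0; apply/eqP/finset.setP => k; rewrite !inE lr.
have h1 := @bidegree_ecov [set lshift N i]%SET; rewrite E1 E2 in h1.
have h2 := @bidegree_ecov [set rshift N j]%SET; rewrite E3 E4 in h2.
exact: (bidegree_wedge h1 h2).
Qed.

Lemma bidegree_herm (G : 'I_N -> 'I_N -> Cplx R) : bidegree_covec 1 1 (herm G).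
Proof.
apply: bidegreeZ; apply: bidegree_sum => i _; apply: bidegree_sum => j _.
by apply: bidegreeZ; exact: bidegree_dzbar.
Qed.

End Bidegree.

(** * Pullbacks and dd^c *)

Section DifferentialForms.
Variables (R : realType) (N : nat).
Implicit Types (x : Cn R N).

Lemma wirt_cst (k : 'I_N) (c : Cplx R) x : wirt k (fun=> c) x = 0.
Proof.
rewrite /wirt !(is_rderivE (is_rderiv_cst _ x c)).
by rewrite mulr0 subr0 mul0r.
Qed.

Lemma wirtbar_cst (k : 'I_N) (c : Cplx R) x : wirtbar k (fun=> c) x = 0.
Proof.
rewrite /wirtbar !(is_rderivE (is_rderiv_cst _ x c)).
by rewrite mulr0 addr0 mul0r.
Qed.

Lemma cov_sumE (I : finType) (A : I -> {set 'I_(N + N)}) (c : I -> Cplx R) S :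
  (\sum_i c i *: ecov R (A i)) S = \sum_i c i * (S == A i)%:R.
Proof.
by rewrite sum_ffunE; apply: eq_bigr => i _; rewrite covecZE ecovE.
Qed.

(** As [A] is injective, every coefficient is a single [c i] or zero. Hence [D 0 = 0] is all that is
    asked of the operator, and no differentiability of the [c i] has to be supplied. *)
Lemma wirt_covec (I : finType) (A : I -> {set 'I_(N + N)}) (inj : injective A)
    (c : I -> Cn R N -> Cplx R) (D : (Cn R N -> Cplx R) -> Cplx R) :
  D (fun=> 0) = 0 ->
  [ffun S => D (fun y => (\sum_i c i y *: ecov R (A i)) S)] =
  \sum_i D (c i) *: ecov R (A i).
Proof.
move=> D0; apply/ffunP => S; rewrite ffunE cov_sumE.
have [[j SA]|nS] := pselect (exists j, S = A j); last first.
  have nSA i : (S == A i) = false by apply/negP => /eqP e; apply: nS; exists i.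
  rewrite [RHS]big1 => [|i _]; last by rewrite nSA mulr0.
  rewrite -[RHS]D0; congr D; apply/funext => y.
  by rewrite cov_sumE big1 // => i _; rewrite nSA mulr0.
have sA (b : I -> Cplx R) : \sum_i b i * (S == A i)%:R = b j.
  rewrite (bigD1 j) //= SA eqxx mulr1 big1 ?addr0 // => i ij.
  by rewrite (inj_eq inj) eq_sym (negPf ij) mulr0.
by rewrite sA; congr D; apply/funext => y; rewrite cov_sumE sA.
Qed.

Lemma zformE (f : Cn R N -> Cplx R) :
  zform f = fun y => \sum_(i < 1) f y *: ecov R finset.set0.
Proof. by apply/funext => y; rewrite big_ord1. Qed.

Lemma injective_I1 (T : Type) (A : 'I_1 -> T) : injective A.
Proof. by move=> i j _; rewrite !ord1. Qed.

Lemma del_zform (f : Cn R N -> Cplx R) x :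
  del (zform f) x = \sum_j wirt j f x *: ecov R [set lshift N j]%SET.
Proof.
rewrite /del zformE; apply: eq_bigr => j _.
rewrite (@wirt_covec 'I_1 _ (@injective_I1 _ _) _ (fun g => wirt j g x) (wirt_cst j 0 x)).
by rewrite big_ord1 wedgeZr ecov0r.
Qed.

Lemma delbar_zform (f : Cn R N -> Cplx R) x :
  delbar (zform f) x = \sum_j wirtbar j f x *: ecov R [set rshift N j]%SET.
Proof.
rewrite /delbar zformE; apply: eq_bigr => j _.
rewrite (@wirt_covec 'I_1 _ (@injective_I1 _ _) _ (fun g => wirtbar j g x) (wirtbar_cst j 0 x)).
by rewrite big_ord1 wedgeZr ecov0r.
Qed.

Lemma ddc_zform (f : Cn R N -> Cplx R) x :
  ddc (zform f) x = toC pi^-1 *: herm (fun j k => wirt j (wirtbar k f) x).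
Proof.
rewrite /ddc /herm scalerA mulrC toCV; congr (_ *: _).
rewrite (_ : delbar (zform f) = fun x => \sum_j wirtbar j f x *:
    ecov R [set rshift N j]%SET); last first.
  by apply/funext => y; rewrite delbar_zform.
rewrite /del; apply: eq_bigr => j _.
have inj : injective (fun j : 'I_N => [set rshift N j]%SET).
  by move=> a b /finset.set1_inj /rshift_inj.
rewrite (@wirt_covec _ _ inj _ (fun g => wirt j g x) (wirt_cst j 0 x)).
rewrite wedge_sumr; apply: eq_bigr => k _; by rewrite wedgeZr.
Qed.

End DifferentialForms.

(** * Pullback of covectors under maps that select and rescale coordinates *)

Section Pullback.
Variables (R : realType) (N' N : nat) (s : 'I_N' -> 'I_N) (u : 'I_N' -> Cplx R).
Hypothesis s_mono : forall i j : 'I_N', (i < j)%N -> (s i < s j)%N.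

Definition pull_index (a : 'I_(N' + N')) : 'I_(N + N) :=
  match fintype.split a with
  | inl j => lshift N (s j) | inr j => rshift N (s j) end.

Definition pull_coef (a : 'I_(N' + N')) : Cplx R :=
  match fintype.split a with inl j => u j | inr j => Num.conj (u j) end.

(** Pullback under the linear map whose j-th coordinate is u_j z_(s j). Both projections and all
    dilations have this form, and as [s] is increasing, basis covectors go to multiples of basis
    covectors without reordering. *)
Definition pull (w : covec R N') : covec R N :=
  \sum_(S : {set 'I_(N' + N')})
    w S *: ((\prod_(a in S) pull_coef a) *: ecov R (pull_index @: S)%SET).

Lemma pull_index_mono (a b : 'I_(N' + N')) :
  (a < b)%N -> (pull_index a < pull_index b)%N.
Proof.
rewrite /pull_index; case: splitP => i ->; case: splitP => j -> /=.
- exact: s_mono.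
- by move=> _; rewrite (leq_trans (ltn_ord (s i))) // leq_addr.
- by move=> h; have := ltn_ord j; lia.
- by rewrite !ltn_add2l; exact: s_mono.
Qed.

Lemma pull_index_inj : injective pull_index.
Proof.
move=> a b ab; apply: ord_inj; have [h|h|//] := ltngtP a b.
  by have := pull_index_mono h; rewrite ab ltnn.
by have := pull_index_mono h; rewrite ab ltnn.
Qed.

Lemma pull_linear z a b : pull (z *: a + b) = z *: pull a + pull b.
Proof.
rewrite /pull scaler_sumr -big_split; apply: eq_bigr => S _.
move: (_ *: ecov R _) => X /=.
by rewrite (covecDE (z *: a) b S) (covecZE z a S) scalerDl scalerA.
Qed.

Lemma pull0 : pull 0 = 0.
Proof. by have := pull_linear (-1) 0 0; rewrite scaler0 addr0 scaleN1r addNr. Qed.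

Lemma pullZ z a : pull (z *: a) = z *: pull a.
Proof. by have := pull_linear z a 0; rewrite !addr0 pull0 addr0. Qed.

Lemma pullD a b : pull (a + b) = pull a + pull b.
Proof. by have := pull_linear 1 a b; rewrite !scale1r. Qed.

Lemma pull_sum I (r : seq I) (P : pred I) (F : I -> covec R N') :
  pull (\sum_(i <- r | P i) F i) = \sum_(i <- r | P i) pull (F i).
Proof. exact: (big_morph _ pullD pull0). Qed.

Lemma pull_ecov S : pull (ecov R S) =
  (\prod_(a in S) pull_coef a) *: ecov R (pull_index @: S)%SET.
Proof.
rewrite /pull (bigD1 S isT) /= ecovE eqxx scale1r [X in _ + X]big1 ?addr0 // => A /negPf AS.
by rewrite ecovE AS scale0r.
Qed.

Lemma pull_one : pull (ecov R finset.set0) = ecov R finset.set0.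
Proof. by rewrite pull_ecov imset0 big_set0 scale1r. Qed.

Lemma inversions_pull (A B : {set 'I_(N' + N')}) :
  inversions (pull_index @: A)%SET (pull_index @: B)%SET = inversions A B.
Proof.
pose f (p : 'I_(N' + N') * 'I_(N' + N')) := (pull_index p.1, pull_index p.2).
have f_inj : injective f.
  by move=> [a b] [a' b'] [/pull_index_inj -> /pull_index_inj ->].
have ltE a b : (pull_index a < pull_index b)%N = (a < b)%N.
  apply/idP/idP; last exact: pull_index_mono.
  apply: contraTT; rewrite -!leqNgt leq_eqVlt => /orP[/eqP/val_inj ->//|].
  by move=> /pull_index_mono /ltnW.
rewrite /inversions -(card_imset _ f_inj); apply: eq_card => -[i j].
rewrite !inE /=; apply/idP/idP.
  move=> /andP[/andP[/imsetP[a aA ->] /imsetP[b bB ->]]]; rewrite ltE => ba.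
  by apply/imsetP; exists (a, b) => //; rewrite !inE /= aA bB.
move=> /imsetP[[a b]]; rewrite !inE /= => /andP[/andP[aA bB] ba] [-> ->].
by rewrite !imset_f //= ltE.
Qed.

(** On basis covectors: the increasing index map preserves inversions and disjointness, and the
    coefficients multiply over a disjoint union. *)
Lemma pull_wedge a b : pull (wedge a b) = wedge (pull a) (pull b).
Proof.
move: a; apply: covec_linear_ext => [z a a'|z a a'|A].
- by rewrite wedge_linearl pull_linear.
- by rewrite pull_linear wedge_linearl.
move: b; apply: covec_linear_ext => [z a a'|z a a'|B].
- by rewrite wedge_linearr pull_linear.
- by rewrite pull_linear wedge_linearr.
rewrite !pull_ecov wedgeZl wedgeZr (wedge_ecov _ A B) wedge_ecov.
rewrite imset_disjoint; last exact: pull_index_inj.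
case AB: [disjoint A & B]%B; last by rewrite pull0 !scaler0.
rewrite pullZ pull_ecov imsetU !scalerA; congr (_ *: _).
rewrite !wsignE inversions_pull mulrC; congr (_ * _).
rewrite -bigU //; apply: eq_bigl => x; by rewrite !inE.
Qed.

(** The transpose of the linear map, acting on the coefficient vectors of (1,0)-covectors. *)
Definition pull_vec (a : Cn R N') : Cn R N := \sum_j (a 0 j * u j) *: unitv R (s j).

Lemma pull_index_l j : pull_index (lshift N' j) = lshift N (s j).
Proof. by rewrite /pull_index -[lshift _ _]/(unsplit (inl j)) unsplitK. Qed.
Lemma pull_index_r j : pull_index (rshift N' j) = rshift N (s j).
Proof. by rewrite /pull_index -[rshift _ _]/(unsplit (inr j)) unsplitK. Qed.
Lemma pull_coef_l j : pull_coef (lshift N' j) = u j.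
Proof. by rewrite /pull_coef -[lshift _ _]/(unsplit (inl j)) unsplitK. Qed.
Lemma pull_coef_r j : pull_coef (rshift N' j) = Num.conj (u j).
Proof. by rewrite /pull_coef -[rshift _ _]/(unsplit (inr j)) unsplitK. Qed.

Lemma pull_vecE a k : pull_vec a 0 k = \sum_j a 0 j * u j * (k == s j)%:R.
Proof. by rewrite summxE; apply: eq_bigr => j _; rewrite mxE unitvE. Qed.

Lemma pull_holcov a : pull (holcov a) = holcov (pull_vec a).
Proof.
rewrite /holcov pull_sum.
rewrite [RHS](eq_bigr (fun k => \sum_j (a 0 j * u j * (k == s j)%:R) *:
  ecov R [set lshift N k]%SET)); last first.
  by move=> k _; rewrite pull_vecE scaler_suml.
rewrite [RHS]exchange_big /=; apply: eq_bigr => j _.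
rewrite pullZ pull_ecov imset_set1 big_set1 pull_index_l pull_coef_l scalerA /=.
rewrite (bigD1 (s j)) //= eqxx mulr1 big1 ?addr0 // => k /negPf kj.
by rewrite kj mulr0 scale0r.
Qed.

Lemma pull_antiholcov a : pull (antiholcov a) = antiholcov (pull_vec a).
Proof.
rewrite /antiholcov pull_sum.
rewrite [RHS](eq_bigr (fun k => \sum_j (Num.conj (a 0 j * u j) * (k == s j)%:R) *:
  ecov R [set rshift N k]%SET)); last first.
  move=> k _; rewrite pull_vecE Cconj_sum scaler_suml; apply: eq_bigr => j _.
  by rewrite CconjM Cconj_nat.
rewrite [RHS]exchange_big /=; apply: eq_bigr => j _.
rewrite pullZ pull_ecov imset_set1 big_set1 pull_index_r pull_coef_r scalerA /=.
rewrite (bigD1 (s j)) //= eqxx mulr1 big1 ?addr0 => [|k /negPf kj].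
  by rewrite CconjM.
by rewrite kj mulr0 scale0r.
Qed.

Lemma pull_posform a : pull (posform a) = posform (pull_vec a).
Proof. by rewrite /posform pullZ pull_wedge pull_holcov pull_antiholcov. Qed.

Lemma pull_elemcov l : pull (elemcov l) = elemcov (map pull_vec l).
Proof.
elim: l => [|a l ih]; first exact: pull_one.
by rewrite map_cons !elemcov_cons pull_wedge pull_posform ih.
Qed.

Lemma pull_pos_comb k c : pos_comb k c -> pos_comb k (pull c).
Proof.
move=> [t /allP ht ->]; exists [seq (p.1, map pull_vec p.2) | p <- t].
  by apply/allP => _ /mapP[p /ht + ->] /=; rewrite size_map.
rewrite pull_sum big_map; apply: eq_bigr => p _.
by rewrite pullZ pull_elemcov.
Qed.

Lemma pull_iter_wedge a k : pull (iter k (wedge a) (ecov R finset.set0)) =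
  iter k (wedge (pull a)) (ecov R finset.set0).
Proof. by elim: k => [|k ih]; rewrite ?pull_one //= pull_wedge ih. Qed.

Lemma pull_bidegree k l c : bidegree_covec k l c -> bidegree_covec k l (pull c).
Proof.
move=> hc; apply: bidegree_sum => S _.
have [S0|/negPn/eqP ->] := boolP (c S != 0); last by rewrite scale0r; exact: bidegree0.
do 2! apply: bidegreeZ.
have s_inj : injective s.
  move=> i j ij; apply: ord_inj; have [h|h|//] := ltngtP i j.
    by have := s_mono h; rewrite ij ltnn.
  by have := s_mono h; rewrite ij ltnn.
have [<- <-] := hc S S0.
have hE (i : 'I_N') : (pull_index (lshift N' i) \in pull_index @: S)%SET = (lshift N' i \in S).
  by rewrite mem_imset //; exact: pull_index_inj.
have aE (i : 'I_N') : (pull_index (rshift N' i) \in pull_index @: S)%SET = (rshift N' i \in S).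
  by rewrite mem_imset //; exact: pull_index_inj.
have -> : #|[set j | lshift N' j \in S]%SET| = holn (pull_index @: S)%SET.
  rewrite -(card_imset _ s_inj); apply: eq_card => j.
  rewrite !inE; apply/imsetP/imsetP => [[i iS ->]|[a aS]].
    by rewrite inE in iS; exists (lshift N' i); rewrite ?pull_index_l.
  rewrite -(splitK a) in aS *; move: aS; case: fintype.split => i /= iS.
    by rewrite pull_index_l => /lshift_inj ->; exists i; rewrite ?inE.
  by rewrite pull_index_r => /eqP; rewrite eq_lrshift.
have -> : #|[set j | rshift N' j \in S]%SET| = aholn (pull_index @: S)%SET.
  rewrite -(card_imset _ s_inj); apply: eq_card => j.
  rewrite !inE; apply/imsetP/imsetP => [[i iS ->]|[a aS]].
    by rewrite inE in iS; exists (rshift N' i); rewrite ?pull_index_r.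
  rewrite -(splitK a) in aS *; move: aS; case: fintype.split => i /= iS.
    by rewrite pull_index_l => /eqP; rewrite eq_rlshift.
  by rewrite pull_index_r => /rshift_inj ->; exists i; rewrite ?inE.
exact: bidegree_ecov.
Qed.

End Pullback.

(** * The cutoff and the kernels *)

Section CutoffFunction.
Variables (R : realType) (chi : R -> R).
Hypothesis hchi : cutoff chi.

Definition chi_ (k : nat) : R -> R := derive1n k chi.

Lemma chi_is_derive k (t : R) : is_derive t 1 (chi_ k) (chi_ k.+1 t).
Proof.
rewrite /chi_ derive1nS derive1E; apply: derivableP.
exact: cutoff_smooth.
Qed.

Lemma chi_is_derive0 (t : R) : is_derive t 1 chi (chi_ 1 t).
Proof. exact: (chi_is_derive 0). Qed.

Lemma is_derive_ge (f : R -> R) (x df c d : R) : is_derive x 1 f df -> 0 < d ->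
  (forall h, 0 < h < d -> c <= h^-1 * (f (x + h) - f x)) -> c <= df.
Proof.
move=> [fd <-] d0 h.
have cv : (fun h => h^-1 *: (f (h *: 1 + x) - f x)) @ 0^'+ --> 'D_1 f x.
  by apply: (cvg_dnbhs_at_right fd).
apply: (cvgr_to_ge cv); near=> e.
rewrite /GRing.scale /= mulr1 addrC (addrC e); rewrite [_ + _]addrC; apply: h.
by apply/andP; split; [near: e; exact: nbhs_right_gt|near: e; exact: nbhs_right_lt].
Unshelve. all: by end_near. Qed.

Lemma chi_convex (x y t : R) : 0 <= t -> t <= 1 ->
  chi (t * x + (1 - t) * y) <= t * chi x + (1 - t) * chi y.
Proof.
move=> t0 t1; 
by have := cutoff_convex hchi (Itv01 t0 t1) (x := x) (y := y);
  rewrite !inE /= => /(_ Logic.I Logic.I).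
Qed.

Let slope (x y : R) := (chi y - chi x) / (y - x).

(** By convexity, the chord over [x, x + h] is at most as steep as the one over [x, y], and the
    chord over [y - h, y] at least as steep; then h tends to 0. *)
Lemma chi1_slope (x y : R) : x < y -> chi_ 1 x <= slope x y <= chi_ 1 y.
Proof.
move=> xy; have d0 : 0 < y - x by rewrite subr_gt0.
have dn : y - x != 0 by rewrite gt_eqF.
apply/andP; split.
  rewrite -lerN2; apply: (is_derive_ge (is_deriveN (chi_is_derive0 x)) d0).
  move=> h /andP[h0 hd]; have hn : h != 0 by rewrite gt_eqF.
  have := @chi_convex y x (h / (y - x)) (divr_ge0 (ltW h0) (ltW d0)).
  rewrite ler_pdivrMr // mul1r => /(_ (ltW hd)).
  rewrite (_ : _ * y + _ = x + h); last by field.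
  rewrite /= => hc; rewrite -opprB !opprK mulrN lerN2 mulrC ler_pdivrMr //.
  rewrite addrC lerBlDr; apply: (le_trans hc).
  by rewrite le_eqVlt; apply/orP; left; apply/eqP; rewrite /slope; field.
(* The function t |-> - chi (- t) turns left difference quotients at y into right ones at -y, which
   is what [is_derive_ge] takes. *)
have gd : is_derive (- y) 1 (fun t => - chi (- t)) (- (chi_ 1 (- - y) * -1)).
  by apply: is_deriveN; apply: is_derive1_comp; exact: chi_is_derive0.
rewrite opprK mulrN1 opprK in gd.
apply: (is_derive_ge gd d0).
move=> h /andP[h0 hd]; have hn : h != 0 by rewrite gt_eqF.
have := @chi_convex x y (h / (y - x)) (divr_ge0 (ltW h0) (ltW d0)).
rewrite ler_pdivrMr // mul1r => /(_ (ltW hd)).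
rewrite (_ : _ * x + _ = y - h); last by field.
rewrite opprD !opprK => hc; rewrite mulrC ler_pdivlMr //.
rewrite addrC lerBrDr addrC -lerBrDr; apply: (le_trans hc).
by rewrite le_eqVlt; apply/orP; left; apply/eqP; rewrite /slope; field.
Qed.

Lemma chi1_homo : {homo chi_ 1 : x y / x <= y}.
Proof.
move=> x y; rewrite le_eqVlt => /predU1P[->//|/chi1_slope/andP[]].
exact: le_trans.
Qed.

Lemma chi1_ge0 t : 0 <= chi_ 1 t.
Proof.
apply: (is_derive_ge (chi_is_derive0 t) ltr01) => h /andP[h0 _].
rewrite mulr_ge0 ?invr_ge0 ?(ltW h0) // subr_ge0.
by apply: (cutoff_incr hchi); rewrite lerDl ltW.
Qed.

Lemma chi2_ge0 t : 0 <= chi_ 2 t.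
Proof.
apply: (is_derive_ge (chi_is_derive 1 t) ltr01) => h /andP[h0 _].
rewrite mulr_ge0 ?invr_ge0 ?(ltW h0) // subr_ge0.
by apply: chi1_homo; rewrite lerDl ltW.
Qed.

Lemma is_derive_near_unique (f g : R -> R) (x a b : R) :
  (\forall y \near x, f y = g y) -> is_derive x 1 f a -> is_derive x 1 g b -> a = b.
Proof.
move=> fg fa gb; have ga := near_eq_is_derive fg fa.
by rewrite -(@derive_val _ _ _ _ _ _ _ ga) -(@derive_val _ _ _ _ _ _ _ gb).
Qed.

Lemma near_lt (t a : R) : t < a -> \forall s \near t, s < a.
Proof. exact: lt_nbhsl. Qed.

Lemma near_gt (t a : R) : a < t -> \forall s \near t, a < s.
Proof. exact: lt_nbhsr. Qed.

Lemma chi1_left t : t < -1 -> chi_ 1 t = 0.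
Proof.
move=> t1; apply: (is_derive_near_unique _ (chi_is_derive0 t) (is_derive_cst (0 : R) t 1)).
by apply: filterS (near_lt t1) => s /ltW s1; exact: cutoff_left.
Qed.

Lemma chi2_left t : t < -1 -> chi_ 2 t = 0.
Proof.
move=> t1; apply: (is_derive_near_unique _ (chi_is_derive 1 t) (is_derive_cst (0 : R) t 1)).
by apply: filterS (near_lt t1) => s s1; exact: chi1_left.
Qed.

Lemma chi1_right t : 1 < t -> chi_ 1 t = 1.
Proof.
move=> t1; apply: (is_derive_near_unique _ (chi_is_derive0 t) (is_derive_id t 1)).
by apply: filterS (near_gt t1) => s /ltW s1; exact: cutoff_right.
Qed.

Lemma chi2_right t : 1 < t -> chi_ 2 t = 0.
Proof.
move=> t1; apply: (is_derive_near_unique _ (chi_is_derive 1 t) (is_derive_cst (1 : R) t 1)).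
by apply: filterS (near_gt t1) => s s1; exact: chi1_right.
Qed.

Lemma chi1_le1 t : chi_ 1 t <= 1.
Proof.
rewrite -(chi1_right (_ : 1 < Num.max t 1 + 1)); last first.
  by rewrite ltr_pwDr // le_max lexx orbT.
by apply: chi1_homo; rewrite (le_trans _ (_ : Num.max t 1 <= _)) ?lerDl // le_max lexx.
Qed.

End CutoffFunction.

Section FormPullback.
Variables (R : realType) (N' N : nat) (s : 'I_N' -> 'I_N) (u : 'I_N' -> Cplx R).
Hypothesis s_mono : forall i j : 'I_N', (i < j)%N -> (s i < s j)%N.

(** The wedge over [S] enumerates the indices increasingly and [e] is increasing, so the factors
    arrive already sorted and no sign appears. *)
Lemma wedge_ecov_prod m (e : 'I_m -> 'I_(N + N)) (c : 'I_m -> Cplx R)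
    (S : {set 'I_m}) : (forall i j : 'I_m, (i < j)%N -> (e i < e j)%N) ->
  \big[@wedge R N/ecov R finset.set0]_(a in S) (c a *: ecov R [set e a]%SET) =
  (\prod_(a in S) c a) *: ecov R (e @: S)%SET.
Proof.
move=> e_mono.
have enumE : index_enum 'I_m = enum 'I_m by rewrite enumT /index_enum unlock.
have : sorted ltn (map val (index_enum 'I_m)).
  by rewrite enumE val_enum_ord iota_ltn_sorted.
suff H (r : seq 'I_m) : sorted ltn (map val r) ->
    \big[@wedge R N/ecov R finset.set0]_(a <- r | a \in S)
      (c a *: ecov R [set e a]%SET) =
    (\prod_(a <- r | a \in S) c a) *:
      ecov R (e @: [set a in r | a \in S])%SET.
  have SE : [set a in index_enum 'I_m | a \in S]%SET = S.
    by apply/finset.setP => a; rewrite !inE mem_index_enum.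
  by move=> /H ->; rewrite SE.
elim: r => [|a r ih] sr.
  have -> : [set a in ([::] : seq 'I_m) | a \in S]%SET = finset.set0.
    by apply/finset.setP => a; rewrite !inE.
  by rewrite !big_nil scale1r imset0.
have {}ih := ih (path_sorted sr).
rewrite !big_cons ih; case: ifPn => aS; last first.
  have -> // : [set b in a :: r | b \in S]%SET = [set b in r | b \in S]%SET.
  apply/finset.setP => b; rewrite !inE.
  by case: eqP => // ->; rewrite (negPf aS) !andbF.
rewrite wedgeZl wedgeZr scalerA.
set B := (e @: [set a in r | a \in S])%SET.
have lt_B b : b \in B -> (e a < b)%N.
  move=> /imsetP[x]; rewrite !inE => /andP[xr _] ->; apply: e_mono.
  by have /allP := order_path_min ltn_trans sr; apply; exact: map_f.
have aB : e a \notin B by apply/negP => /lt_B; rewrite ltnn.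
rewrite (wedge_ecov _ [set e a]%SET B) -finset.setI_eq0.
have -> : ([set e a] :&: B = finset.set0)%SET.
  apply/finset.setP => b; rewrite !inE; case: eqP => // ->.
  by rewrite (negPf aB).
rewrite eqxx wsignE (_ : inversions _ _ = 0%N) ?expr0 ?scale1r.
  congr (_ *: ecov R _); apply/finset.setP => b; rewrite !inE.
  apply/orP/imsetP => [[/eqP ->|/imsetP[x]]|[x]].
  - by exists a; rewrite // !inE eqxx aS.
  - by rewrite !inE => /andP[xr xS] ->; exists x; rewrite // !inE xr xS orbT.
  rewrite !inE => /andP[/orP[/eqP -> _ ->|xr xS ->]]; first by left.
  by right; apply/imsetP; exists x; rewrite // !inE xr.
apply/eqP; rewrite cards_eq0; apply/eqP/finset.setP => -[i j]; rewrite !inE /=.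
apply/negbTE/negP => /andP[/andP[/eqP -> /lt_B]] h.
by rewrite ltnNge ltnW.
Qed.

Lemma dform_zform (f : Cn R N -> Cplx R) x : dform (zform f) x =
  \sum_j wirt j f x *: ecov R [set lshift N j]%SET +
  \sum_j wirtbar j f x *: ecov R [set rshift N j]%SET.
Proof. by rewrite /dform del_zform delbar_zform. Qed.

Lemma rdirE (t : 'I_N * bool) k : rdir R t 0 k =
  (if t.2 then 'i else 1) * (k == t.1)%:R.
Proof. by rewrite !mxE eqxx. Qed.

Lemma wirt_linear (c : Cplx R) (k j : 'I_N) x :
  wirt j (fun y : Cn R N => c * y 0 k) x = c * (k == j)%:R /\
  wirtbar j (fun y : Cn R N => c * y 0 k) x = 0.
Proof.
have h t := is_rderivE (is_rderivM (is_rderiv_cst t x c) (is_rderiv_coord t x k)).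
have ii : 'i * 'i = -1 :> Cplx R by rewrite -expr2 sqrCi.
rewrite /wirt /wirtbar !h !rdirE /=; split.
  move: 'i ii (x 0 k) (k == j)%:R => I ii X D.
  rewrite (_ : 0 * X + c * (1 * D) - I * (0 * X + c * (I * D)) = c * D * (1 - I * I)); last by ring.
  by rewrite ii; field.
move: 'i ii (x 0 k) (k == j)%:R => I ii X D.
rewrite (_ : 0 * X + c * (1 * D) + I * (0 * X + c * (I * D)) = c * D * (1 + I * I)); last by ring.
by rewrite ii subrr mulr0 mul0r.
Qed.

Lemma wirt_antilinear (c : Cplx R) (k j : 'I_N) x :
  wirt j (fun y : Cn R N => c * Num.conj (y 0 k)) x = 0 /\
  wirtbar j (fun y : Cn R N => c * Num.conj (y 0 k)) x = c * (k == j)%:R.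
Proof.
have h t := is_rderivE (is_rderivM (is_rderiv_cst t x c)
  (is_rderiv_conj (is_rderiv_coord t x k))).
have ii : 'i * 'i = -1 :> Cplx R by rewrite -expr2 sqrCi.
have ci : Num.conj ('i : Cplx R) = - 'i := conjCi _.
rewrite /wirt /wirtbar !h !rdirE /= !CconjM Cconj1 ci Cconj_nat {ci}; split.
  move: 'i ii (Num.conj (x 0 k)) (k == j)%:R => I ii X D.
  rewrite (_ : 0 * X + c * (1 * D) - I * (0 * X + c * (- I * D)) = c * D * (1 + I * I)); last by ring.
  by rewrite ii subrr mulr0 mul0r.
move: 'i ii (Num.conj (x 0 k)) (k == j)%:R => I ii X D.
rewrite (_ : 0 * X + c * (1 * D) + I * (0 * X + c * (- I * D)) = c * D * (1 - I * I)); last by ring.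
by rewrite ii; field.
Qed.

(** The differential of each coordinate of F is one multiple of a basis covector, so the wedge of
    differentials is the sorted product of [wedge_ecov_prod]. *)
Lemma form_pullbackE (F : Cn R N -> Cn R N') (w : cform R N') x :
  (forall y j, F y 0 j = u j * y 0 (s j)) ->
  form_pullback F w x = pull s u (w (F x)).
Proof.
move=> FE; rewrite /form_pullback /pull; apply: eq_bigr => S _.
congr (_ *: _); rewrite -(wedge_ecov_prod _ _ (pull_index_mono s_mono)).
apply: eq_bigr => a _; rewrite dform_zform /pull_index /pull_coef /coordf.
case: (fintype.split a) => j.
  have -> : (fun y => F y 0 j) = (fun y : Cn R N => u j * y 0 (s j)).
    by apply/funext => y; rewrite FE.
  rewrite [X in _ + X]big1 => [|k _]; last by have [_ ->] := wirt_linear (u j) (s j) k x; rewrite scale0r.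
  rewrite addr0 (bigD1 (s j)) //= big1 => [|k /negPf kj].
    by have [-> _] := wirt_linear (u j) (s j) (s j) x; rewrite eqxx mulr1 addr0.
  by have [-> _] := wirt_linear (u j) (s j) k x; rewrite eq_sym kj mulr0 scale0r.
have -> : (fun y => Num.conj (F y 0 j)) =
    (fun y : Cn R N => Num.conj (u j) * Num.conj (y 0 (s j))).
  by apply/funext => y; rewrite FE CconjM.
rewrite big1 => [|k _]; last first.
  by have [-> _] := wirt_antilinear (Num.conj (u j)) (s j) k x; rewrite scale0r.
rewrite add0r (bigD1 (s j)) //= big1 => [|k /negPf kj].
  by have [_ ->] := wirt_antilinear (Num.conj (u j)) (s j) (s j) x; rewrite eqxx mulr1 addr0.
by have [_ ->] := wirt_antilinear (Num.conj (u j)) (s j) k x; rewrite eq_sym kj mulr0 scale0r.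
Qed.

End FormPullback.

(** * The dd^c of functions of the squared norm of some coordinates *)

Section RadialForms.
Variables (R : realType) (N : nat).
Implicit Types (x y : Cn R N) (J : {set 'I_N}).

Definition radsq J x : R := \sum_(j in J) modC (x 0 j) ^+ 2.

(** The vector whose [holcov] is the (1,0)-part of the differential of [radsq J]. *)
Definition conj_part J x : Cn R N :=
  \row_j (if j \in J then Num.conj (x 0 j) else 0).

Lemma conj_partE J x j :
  conj_part J x 0 j = if j \in J then Num.conj (x 0 j) else 0.
Proof. by rewrite mxE. Qed.

Lemma radsq_ge0 J x : 0 <= radsq J x.
Proof. by apply: sumr_ge0 => j _; exact: sqr_ge0. Qed.

Lemma eq_is_rderiv t x (f g : Cn R N -> Cplx R) D :
  f =1 g -> is_rderiv t f x D -> is_rderiv t g x D.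
Proof. by move=> /funext ->. Qed.

Lemma is_rderiv_sum t x (P : pred 'I_N) (f : 'I_N -> Cn R N -> Cplx R) D :
  (forall j, P j -> is_rderiv t (f j) x (D j)) ->
  is_rderiv t (fun y => \sum_(j | P j) f j y) x (\sum_(j | P j) D j).
Proof.
move=> h; elim: (index_enum _) => [|j r ih].
  rewrite big_nil; apply: eq_is_rderiv (is_rderiv_cst t x 0) => y.
  by rewrite big_nil.
rewrite big_cons; case: ifPn => Pj.
  by apply: eq_is_rderiv (is_rderivD (h j Pj) ih) => y; rewrite big_cons Pj.
by apply: eq_is_rderiv ih => y; rewrite big_cons (negPf Pj).
Qed.

Lemma toC_radsq J y : toC (radsq J y) = \sum_(j in J) Num.conj (y 0 j) * y 0 j.
Proof. by rewrite toC_sum; apply: eq_bigr => j _; rewrite conj_mul_sq. Qed.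

Lemma is_rderiv_radsq t J x : is_rderiv t (fun y => toC (radsq J y)) x
  (\sum_(j in J) (Num.conj (rdir R t 0 j) * x 0 j + Num.conj (x 0 j) * rdir R t 0 j)).
Proof.
rewrite (_ : (fun y => toC (radsq J y)) =
  fun y => \sum_(j in J) Num.conj (y 0 j) * y 0 j); last first.
  by apply/funext => y; rewrite toC_radsq.
apply: is_rderiv_sum => j _; apply: is_rderivM; last exact: is_rderiv_coord.
exact: is_rderiv_conj (is_rderiv_coord t x j).
Qed.

Lemma rderiv_radsq k b J x : rderiv (k, b) (fun y => toC (radsq J y)) x =
  if k \in J then Num.conj (if b then 'i else 1) * x 0 k +
    Num.conj (x 0 k) * (if b then 'i else 1) else 0.
Proof.
rewrite (is_rderivE (is_rderiv_radsq (k, b) J x)) /=.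
have E j : Num.conj (rdir R (k, b) 0 j) * x 0 j + Num.conj (x 0 j) * rdir R (k, b) 0 j
   = (Num.conj (if b then 'i else 1) * x 0 j +
    Num.conj (x 0 j) * (if b then 'i else 1)) * (j == k)%:R.
  by rewrite rdirE /= CconjM Cconj_nat; ring.
under eq_bigr do rewrite E.
rewrite big_mkcond (bigD1 k) //= eqxx mulr1 big1 ?addr0 // => j /negPf jk.
by rewrite jk mulr0 if_same.
Qed.

Lemma wirt_radsq k J x : wirt k (fun y => toC (radsq J y)) x =
  if k \in J then Num.conj (x 0 k) else 0.
Proof.
rewrite /wirt !rderiv_radsq; case: ifPn => _; last by rewrite mulr0 subrr mul0r.
have ci : Num.conj ('i : Cplx R) = - 'i := conjCi _.
have ii : 'i * 'i = -1 :> Cplx R by rewrite -expr2 sqrCi.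
rewrite Cconj1 ci {ci}; move: 'i ii (x 0 k) (Num.conj _) => I ii X Y.
rewrite (_ : 1 * X + Y * 1 - I * (- I * X + Y * I) =
  X + Y + (I * I) * (X - Y)); last by ring.
by rewrite ii; field.
Qed.

Lemma wirtbar_radsq k J x : wirtbar k (fun y => toC (radsq J y)) x =
  if k \in J then x 0 k else 0.
Proof.
rewrite /wirtbar !rderiv_radsq; case: ifPn => _; last by rewrite mulr0 addr0 mul0r.
have ci : Num.conj ('i : Cplx R) = - 'i := conjCi _.
have ii : 'i * 'i = -1 :> Cplx R by rewrite -expr2 sqrCi.
rewrite Cconj1 ci {ci}; move: 'i ii (x 0 k) (Num.conj _) => I ii X Y.
rewrite (_ : 1 * X + Y * 1 + I * (- I * X + Y * I) =
  X + Y - (I * I) * (X - Y)); last by ring.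
by rewrite ii; field.
Qed.

Lemma near_rderiv t (f g : Cn R N -> Cplx R) x :
  (\forall y \near x, f y = g y) -> rderiv t f x = rderiv t g x.
Proof.
move=> /(near_along t) fg; rewrite /rderiv !derive1E.
by congr (toC _ + _ * toC _); apply: near_eq_derive; apply: filterS fg => r ->.
Qed.

Lemma near_wirt j (f g : Cn R N -> Cplx R) x :
  (\forall y \near x, f y = g y) -> wirt j f x = wirt j g x.
Proof. by move=> fg; rewrite /wirt !(near_rderiv _ fg). Qed.

Lemma near_wirtbar j (f g : Cn R N -> Cplx R) x :
  (\forall y \near x, f y = g y) -> wirtbar j f x = wirtbar j g x.
Proof. by move=> fg; rewrite /wirtbar !(near_rderiv _ fg). Qed.

Lemma near_near (T : topologicalType) (z : T) (P : T -> Prop) :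
  (\forall y \near z, P y) -> \forall y \near z, \forall w \near y, P w.
Proof. exact: near_join. Qed.

Lemma near_ddc_zform (f g : Cn R N -> Cplx R) x :
  (\forall y \near x, f y = g y) -> ddc (zform f) x = ddc (zform g) x.
Proof.
move=> fg; rewrite (ddc_zform f x) (ddc_zform g x).
apply: (congr1 (fun c : covec R N => toC pi^-1 *: c)); apply: eq_herm => j k.
apply: near_wirt.
apply: (@filterS _ (nbhs x) _ _ _ _ (near_near fg)) => y.
exact: near_wirtbar.
Qed.

(** With rho = [radsq J] and h1, h2 the values of H', H'' at rho, this is dd^c (H o rho): H'
    multiplies i del delbar rho, which is [kahler], and H'' multiplies i del rho /\ delbar rho. *)
Definition radial_form J (h1 h2 : R) x : covec R N :=
  toC pi^-1 *: (toC h1 *: kahler R J + toC h2 *: posform (conj_part J x)).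

(** The chain rule, twice. The first derivative of [H] is asked for near x because it is
    differentiated once more; the second one only at x. *)
Lemma real_ddc_radial J (H H1 : R -> R) (h2 : R) x :
  (\forall y \near x, is_derive (radsq J y) 1 H (H1 (radsq J y))) ->
  is_derive (radsq J x) 1 H1 h2 ->
  real_ddc (fun y => H (radsq J y)) x = radial_form J (H1 (radsq J x)) h2 x.
Proof.
move=> dH dH1; rewrite /real_ddc ddc_zform /radial_form.
apply: (congr1 (fun c : covec R N => toC pi^-1 *: c)).
rewrite kahlerE posformE -!hermZ -hermD.
pose r y := toC (radsq J y).
have rr t y : rderiv t r y = toC (reC (rderiv t r y)) by exact: rderiv_real.
have hr t y : is_rderiv t r y (rderiv t r y).
  apply: is_rderivP; exact: is_rderiv_rderivable (is_rderiv_radsq t J y).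
apply: eq_herm => j k.
have nearE : \forall y \near x, wirtbar k (fun y => toC (H (radsq J y))) y =
    toC (H1 (radsq J y)) * (if k \in J then y 0 k else 0).
  apply: (@filterS _ (nbhs x) _ _ _ _ dH) => y dHy.
  rewrite -wirtbar_radsq /wirtbar.
  have E t : rderiv t (fun y => toC (H (radsq J y))) y = toC (H1 (radsq J y)) * rderiv t r y.
    apply: is_rderivE; rewrite rr -toCM; apply: is_rderiv_comp => //.
    by rewrite -rr.
  rewrite (E (k, false)) (E (k, true)) -[fun y => toC (radsq J y)]/r.
  move: (rderiv (k, false) r y) (rderiv (k, true) r y) (toC _) 'i => A B C I.
  by ring.
rewrite (near_wirt _ nearE) {nearE}.
have E t : rderiv t (fun y => toC (H1 (radsq J y)) * (if k \in J then y 0 k else 0)) x =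
    toC h2 * rderiv t r x * (if k \in J then x 0 k else 0) +
    toC (H1 (radsq J x)) * (if k \in J then rdir R t 0 k else 0).
  apply: is_rderivE; apply: is_rderivM.
    by rewrite rr -toCM; apply: is_rderiv_comp => //; rewrite -rr.
  by case: (k \in J); [exact: is_rderiv_coord|exact: is_rderiv_cst].
have W : (rderiv (j, false) r x - 'i * rderiv (j, true) r x) / 2 =
  if j \in J then Num.conj (x 0 j) else 0 := wirt_radsq j J x.
rewrite [LHS]/wirt (E (j, false)) (E (j, true)).
have split_wirt (h1 h2' A B X P Q I : Cplx R) :
    (h2' * A * X + h1 * P - I * (h2' * B * X + h1 * Q)) / 2 =
    h2' * ((A - I * B) / 2) * X + h1 * ((P - I * Q) / 2) by ring.
rewrite split_wirt {split_wirt}.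
rewrite W addrC; congr (_ + _).
  congr (_ * _); rewrite !rdirE /=.
  have ii : 'i * 'i = -1 :> Cplx R by rewrite -expr2 sqrCi.
  have [->|jk] := eqVneq j k; last by rewrite /= !mulr0 if_same mulr0 subrr mul0r.
  rewrite /= !mulr1; case: (k \in J) => /=; last by rewrite mulr0 subrr mul0r.
  by rewrite ii opprK -mulr2n -mulr_natl mulr1 mulfV // pnatr_eq0.
by rewrite !mxE; case: (k \in J); rewrite ?Cconj0 ?CconjK ?mulrA.
Qed.

End RadialForms.

(** * Functions of log |y| as functions of t = |y|^2 *)

Section LogarithmicProfiles.
Variable R : realType.
Implicit Types (p q : R -> R) (c t : R).

(** At t = |y|^2 this is p (log |y| + c). Its first two derivatives in t are [profile1 p' c] and
    [profile2 p' p'' c]. The value 0 for t <= 0 is the right extension when p vanishes near -oo. *)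
Definition profile p c t : R := if t <= 0 then 0 else p (ln t / 2 + c).
Definition profile1 p c t : R := if t <= 0 then 0 else p (ln t / 2 + c) / (2 * t).
Definition profile2 p q c t : R := if t <= 0 then 0 else
  q (ln t / 2 + c) / (4 * t ^+ 2) - p (ln t / 2 + c) / (2 * t ^+ 2).

Lemma is_derive_log_arg c t : 0 < t ->
  is_derive t 1 (fun t => ln t / 2 + c) (2 * t)^-1.
Proof.
move=> t0; have dl := is_derive1_ln t0.
have tn : t != 0 by rewrite gt_eqF.
have H := is_deriveD (is_deriveM dl (is_derive_cst (2^-1 : R) t 1)) (is_derive_cst c t 1).
apply: (is_derive_eq H); rewrite /GRing.scale /=; field.
by rewrite tn.
Qed.

Lemma is_derive_profile p q c t : 0 < t -> (forall s : R, is_derive s 1 p (q s)) ->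
  is_derive t 1 (profile p c) (profile1 q c t).
Proof.
move=> t0 dp; rewrite /profile1 leNgt t0 /=.
have h : is_derive t 1 (fun t => p (ln t / 2 + c)) (q (ln t / 2 + c) * (2 * t)^-1).
  exact: (@is_derive1_comp _ p (fun t => ln t / 2 + c) t _ _ (dp _) (is_derive_log_arg c t0)).
apply: near_eq_is_derive h.
by apply: filterS (near_gt t0) => s s0; rewrite /profile leNgt s0.
Qed.

Lemma is_derive_profile1 p q c t : 0 < t -> (forall s : R, is_derive s 1 p (q s)) ->
  is_derive t 1 (profile1 p c) (profile2 p q c t).
Proof.
move=> t0 dp; rewrite /profile2 leNgt t0 /=.
have tn : t != 0 by rewrite gt_eqF.
have h : is_derive t 1 (fun t => p (ln t / 2 + c)) (q (ln t / 2 + c) * (2 * t)^-1).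
  exact: (@is_derive1_comp _ p (fun t => ln t / 2 + c) t _ _ (dp _) (is_derive_log_arg c t0)).
have hv : is_derive t 1 (fun t : R => (2 * t)^-1) (- (2 * t) ^- 2 *: 2).
  apply: (@is_deriveV _ (fun t => 2 * t)); first by rewrite mulf_neq0.
  by apply: is_derive_eq; rewrite /GRing.scale /= !(mulr1, mulr0, addr0).
have g : is_derive t 1 (fun t => p (ln t / 2 + c) / (2 * t))
  (q (ln t / 2 + c) / (4 * t ^+ 2) - p (ln t / 2 + c) / (2 * t ^+ 2)).
  apply: (is_derive_eq (is_deriveM h hv)).
  by rewrite /GRing.scale /=; field.
apply: near_eq_is_derive g.
by apply: filterS (near_gt t0) => s s0; rewrite /profile1 leNgt s0.
Qed.

(** The t at which log (sqrt t) + c equals -1, up to which chi vanishes. *)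
Definition profile_cut c : R := expR (2 * (- 1 - c)).

Lemma profile_cut_gt0 c : 0 < profile_cut c. Proof. exact: expR_gt0. Qed.

Lemma log_arg_lt c t : 0 < t -> t < profile_cut c -> ln t / 2 + c < -1.
Proof.
move=> t0; rewrite -ltr_ln ?posrE ?expR_gt0 // expRK => h; lra.
Qed.

Variables (chi : R -> R) (hchi : cutoff chi).
Let chi1 := chi_ chi 1.
Let chi2 := chi_ chi 2.

Lemma profile_near0 c t : t < profile_cut c -> profile chi c t = 0.
Proof.
move=> tc; rewrite /profile; case: leP => // t0; apply: cutoff_left => //.
exact/ltW/log_arg_lt.
Qed.

Lemma profile1_near0 c t : t < profile_cut c -> profile1 chi1 c t = 0.
Proof.
move=> tc; rewrite /profile1; case: leP => // t0.
by rewrite /chi1 chi1_left ?mul0r //; exact: log_arg_lt.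
Qed.

Lemma profile2_near0 c t : t < profile_cut c -> profile2 chi1 chi2 c t = 0.
Proof.
move=> tc; rewrite /profile2; case: leP => // t0.
by rewrite /chi1 /chi2 chi1_left ?chi2_left ?mul0r ?subrr //; exact: log_arg_lt.
Qed.

(** This holds at every real t, including 0: below [profile_cut c] the functions vanish identically
    on an open set, and above it t is positive. *)
Lemma is_derive_profile_chi c t : is_derive t 1 (profile chi c) (profile1 chi1 c t).
Proof.
have [tc|tc] := ltP t (profile_cut c).
  rewrite profile1_near0 //; apply: near_eq_is_derive (is_derive_cst (0 : R) t 1).
  by apply: filterS (near_lt tc) => s sc; rewrite profile_near0.
apply: is_derive_profile; first exact: lt_le_trans (profile_cut_gt0 c) tc.
by move=> s; exact: chi_is_derive0.
Qed.

Lemma is_derive_profile1_chi c t :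
  is_derive t 1 (profile1 chi1 c) (profile2 chi1 chi2 c t).
Proof.
have [tc|tc] := ltP t (profile_cut c).
  rewrite profile2_near0 //; apply: near_eq_is_derive (is_derive_cst (0 : R) t 1).
  by apply: filterS (near_lt tc) => s sc; rewrite profile1_near0.
apply: is_derive_profile1; first exact: lt_le_trans (profile_cut_gt0 c) tc.
by move=> s; exact: chi_is_derive.
Qed.

End LogarithmicProfiles.

Section ExplicitForms.
Variables (R : realType) (chi : R -> R) (hchi : cutoff chi) (N : nat).
Implicit Types (x y : Cn R N) (J : {set 'I_N}).
Local Notation chi1 := (chi_ chi 1).
Local Notation chi2 := (chi_ chi 2).

(** The dd^c of P (log |x_J| + c) with P' = p and P'' = q. For p = 1 and q = 0 it is dd^c log |x_J|,
    with value 0 where x_J = 0. *)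
Definition log_form (p q : R -> R) J (c : R) x : covec R N :=
  radial_form J (profile1 p c (radsq J x)) (profile2 p q c (radsq J x)) x.

(** One formula for both kernels: K_theta^m is the case of the fibre coordinates with c = - log
    |theta|, and Omega_m on C^n is the case of all coordinates with c = M. *)
Definition kernel_form J (c : R) (m : nat) x : covec R N :=
  if m is m'.+1 then wedge (log_form chi1 chi2 J c x)
    (iter m' (wedge (log_form (fun=> 1) (fun=> 0) J 0 x)) (ecov R finset.set0))
  else ecov R finset.set0.

Lemma radsq_continuous J : continuous (radsq J : Cn R N -> R).
Proof.
move=> x; have h := smooth_sqnorm_on J openT : smooth_on setT (fun x => toC (radsq J x)).
by have /continuous_CplxE[+ _] := smooth_continuous h (Logic.I : setT x).
Qed.

Lemma near_radsq_gt J x a : a < radsq J x -> \forall y \near x, a < radsq J y.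
Proof. by move=> ax; exact: (@radsq_continuous J x [set r | a < r] (near_gt ax)). Qed.

Lemma real_ddc_profile J c k x :
  real_ddc (fun y => profile chi c (radsq J y) + k) x = log_form chi1 chi2 J c x.
Proof.
apply: (@real_ddc_radial _ _ J (fun t => profile chi c t + k) (profile1 chi1 c)).
  apply: (@filterS _ (nbhs x) _ setT); last exact: filterT.
  move=> y _.
  have H := is_deriveD (is_derive_profile_chi hchi c (radsq J y))
    (is_derive_cst k (radsq J y) 1).
  by rewrite addr0 in H.
exact: is_derive_profile1_chi.
Qed.

Lemma real_ddc_log J x : 0 < radsq J x ->
  real_ddc (fun y => ln (Num.sqrt (radsq J y))) x =
  log_form (fun=> 1) (fun=> 0) J 0 x.
Proof.
move=> x0.
have D1 : \forall y \near x, is_derive (radsq J y) 1 (profile id 0)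
    (profile1 (fun=> 1) 0 (radsq J y)).
  apply: (@filterS _ (nbhs x) _ _ _ _ (near_radsq_gt x0)) => y y0.
  by apply: is_derive_profile => // s; exact: is_derive_id.
have D2 : is_derive (radsq J x) 1 (profile1 (fun=> 1) 0)
    (profile2 (fun=> 1) (fun=> 0) 0 (radsq J x)).
  by apply: is_derive_profile1 => // s; exact: is_derive_cst.
rewrite /log_form -(real_ddc_radial D1 D2).
apply: near_ddc_zform; apply: (@filterS _ (nbhs x) _ _ _ _ (near_radsq_gt x0)).
move=> y y0; rewrite /profile leNgt y0 /= addr0; congr toC.
rewrite -{2}(sqr_sqrtr (ltW y0)) lnXn ?sqrtr_gt0 //; by field.
Qed.

Lemma log_form0 (p q : R -> R) J c x : radsq J x <= 0 -> log_form p q J c x = 0.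
Proof.
move=> x0; rewrite /log_form /profile1 /profile2 x0 /radial_form.
by rewrite toC0 !scale0r addr0 scaler0.
Qed.

Lemma kernel_form0 J c m x : radsq J x < profile_cut c ->
  kernel_form J c m.+1 x = 0.
Proof.
move=> xc; rewrite /kernel_form /log_form profile1_near0 // profile2_near0 //.
by rewrite /radial_form toC0 !scale0r addr0 scaler0 wedge0l.
Qed.

Lemma wpowE (a : cform R N) k x : wpow a k x = iter k (wedge (a x)) (ecov R finset.set0).
Proof.
elim: k => [|k ih]; first by rewrite /wpow /zform /= scale1r.
by rewrite [LHS]/(wedge (a x) (wpow a k x)) ih.
Qed.

(** Where [radsq J] is 0 the first factor vanishes, so the default values taken there by the dd^c of
    the logarithm do not matter. *)
Lemma kernel_formE J c m (a b : cform R N) x :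
  a x = log_form chi1 chi2 J c x ->
  (0 < radsq J x -> b x = log_form (fun=> 1) (fun=> 0) J 0 x) ->
  wform a (wpow b m) x = kernel_form J c m.+1 x.
Proof.
move=> ax bx; rewrite /wform ax wpowE /kernel_form.
have [x0|x0] := ltP 0 (radsq J x); first by rewrite bx.
by rewrite log_form0 // !wedge0l.
Qed.

(** With t = [radsq J x], a the vector [conj_part J x] and P, Q the values of p, q, the form is, up
    to 1/pi, P/(2t^2) (t kahler - posform a) + Q/(4t^2) posform a. The first bracket is positive by
    Lagrange's identity, as |a|^2 = t. *)
Lemma pos_comb_log_form (p q : R -> R) J c x :
  (forall s, 0 <= p s) -> (forall s, 0 <= q s) -> pos_comb 1 (log_form p q J c x).
Proof.
move=> p0 q0; have [x0|x0] := leP (radsq J x) 0.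
  by rewrite log_form0 //; exact: pos_comb0.
rewrite /log_form /profile1 /profile2 leNgt x0 /=.
set t := radsq J x; set P := p _; set Q := q _.
have a0 : forall j, j \notin J -> conj_part J x 0 j = 0.
  by move=> j /negPf jJ; rewrite mxE jJ.
have rt : \sum_(j in J) modC (conj_part J x 0 j) ^+ 2 = t.
  by apply: eq_bigr => j jJ; rewrite mxE jJ modC_conj.
have L := pos_comb_lagrange a0; rewrite rt in L.
have -> : radial_form J (P / (2 * t)) (Q / (4 * t ^+ 2) - P / (2 * t ^+ 2)) x =
  toC pi^-1 *: (toC (P / (2 * t ^+ 2)) *: (toC t *: kahler R J - posform (conj_part J x))
   + toC (Q / (4 * t ^+ 2)) *: posform (conj_part J x)).
  apply: (congr1 (fun c : covec R N => toC pi^-1 *: c)).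
  have -> : P / (2 * t) = P / (2 * t ^+ 2) * t by field; rewrite gt_eqF.
  move: (kahler R J) (posform _) (P / _) (Q / _) => K W A B.
  by rewrite toCM toCB scalerBl scalerBr scalerA addrCA addrC -addrA.
apply: pos_combZ; first by rewrite invr_ge0 pi_ge0.
apply: pos_combD; apply: pos_combZ => //.
- by rewrite divr_ge0 ?p0 // mulr_ge0 // sqr_ge0.
- by rewrite divr_ge0 ?q0 // mulr_ge0 // sqr_ge0.
- exact: pos_comb_posform.
Qed.

Lemma pos_comb_kernel_form J c m x : pos_comb m (kernel_form J c m x).
Proof.
case: m => [|m]; first exact: (pos_comb_elemcov [::]).
apply: (@pos_comb_wedge _ _ 1 m).
  by apply: pos_comb_log_form => s; [exact: chi1_ge0|exact: chi2_ge0].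
elim: m => [|m ih]; first exact: (pos_comb_elemcov [::]).
apply: (@pos_comb_wedge _ _ 1 m _ _ _ ih).
by apply: pos_comb_log_form => s; rewrite ?ler01.
Qed.

Lemma bidegree_log_form (p q : R -> R) J c x : bidegree_covec 1 1 (log_form p q J c x).
Proof.
apply: bidegreeZ; apply: bidegreeD; apply: bidegreeZ.
  by rewrite kahlerE; exact: bidegree_herm.
by rewrite posformE; exact: bidegree_herm.
Qed.

Lemma bidegree_kernel_form J c m x : bidegree_covec m m (kernel_form J c m x).
Proof.
case: m => [|m]; first exact: bidegree_one.
apply: (@bidegree_wedge _ _ 1 1 m m); first exact: bidegree_log_form.
elim: m => [|m ih]; first exact: bidegree_one.
apply: (@bidegree_wedge _ _ 1 1 m m _ _ _ ih); exact: bidegree_log_form.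
Qed.

(** Beyond both thresholds the arguments of chi' and chi'' exceed 1, where chi' = 1 and chi'' = 0,
    and both forms are powers of dd^c log |x_J|. *)
Lemma kernel_form_tail J c c' m x :
  expR (2 * (1 - c)) < radsq J x -> expR (2 * (1 - c')) < radsq J x ->
  kernel_form J c m x = kernel_form J c' m x.
Proof.
move=> h h'; case: m => [|m]; first exact: erefl.
have x0 : 0 < radsq J x by exact: lt_trans (expR_gt0 _) h.
have gt1 e : expR (2 * (1 - e)) < radsq J x -> 1 < ln (radsq J x) / 2 + e.
  rewrite -ltr_ln ?posrE ?expR_gt0 // expRK => H; lra.
have E e : expR (2 * (1 - e)) < radsq J x ->
    log_form chi1 chi2 J e x = log_form (fun=> 1) (fun=> 0) J 0 x.
  move=> /gt1 he; rewrite /log_form /profile1 /profile2.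
  by rewrite (chi1_right hchi he) (chi2_right hchi he) leNgt x0.
by rewrite /kernel_form (E c h) (E c' h').
Qed.

End ExplicitForms.

Section SmoothForms.
Variables (R : realType) (N : nat).
Implicit Types (W : set (Cn R N)) (a b w : cform R N).

Lemma smooth_formD W a b : open W -> smooth_form W a -> smooth_form W b ->
  smooth_form W (fun x => a x + b x).
Proof.
move=> oW ha hb S; apply: (smooth_eq oW _ (smoothD oW (ha S) (hb S))) => x _.
by rewrite covecDE.
Qed.

Lemma smooth_form_scale W (f : Cn R N -> Cplx R) (c : covec R N) : open W ->
  smooth_on W f -> smooth_form W (fun x => f x *: c).
Proof.
move=> oW hf S; apply: (smooth_eq oW _ (smoothM oW hf (@smooth_cst _ _ W (c S)))) => x _.
by rewrite covecZE.
Qed.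

Lemma smooth_form_sum W (I : Type) (r : seq I) (P : pred I) (F : I -> cform R N) :
  open W -> (forall i, P i -> smooth_form W (F i)) ->
  smooth_form W (fun x => \sum_(i <- r | P i) F i x).
Proof.
move=> oW h S; have hS i : P i -> smooth_on W (fun x => F i x S) by move=> Pi; exact: h.
apply: (smooth_eq oW _ (smooth_sum r oW hS)) => x _.
by rewrite sum_ffunE.
Qed.

Lemma smooth_form_wedge W a b : open W -> smooth_form W a -> smooth_form W b ->
  smooth_form W (wform a b).
Proof.
move=> oW ha hb S.
have h (A : {set 'I_(N + N)}) : A \subset S ->
    smooth_on W (fun x => wsign R A (S :\: A)%SET * a x A * b x (S :\: A)%SET).
  move=> _; exact: (smoothM oW (smoothZ _ oW (ha A)) (hb _)).
apply: (smooth_eq oW _ (smooth_sum _ oW h)) => x _.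
by rewrite /wform wedgeE.
Qed.

Lemma smooth_form_eq W a b : open W -> (forall x, W x -> a x = b x) ->
  smooth_form W a -> smooth_form W b.
Proof. by move=> oW ab h S; apply: (smooth_eq oW _ (h S)) => x Wx; rewrite ab. Qed.

Lemma smooth_form_cst W (c : covec R N) : smooth_form W (fun=> c).
Proof. by move=> S; exact: smooth_cst. Qed.

Lemma smooth_form_wpow W a k : open W -> smooth_form W a -> smooth_form W (wpow a k).
Proof.
move=> oW ha; elim: k => [|k ih]; last exact: (smooth_form_wedge oW ha ih).
apply: (smooth_form_eq oW _ (@smooth_form_cst W (ecov R finset.set0))) => x _.
by rewrite wpowE.
Qed.

Lemma smooth_form_ddc W (f : Cn R N -> Cplx R) : open W -> smooth_on W f ->
  smooth_form W (ddc (zform f)).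
Proof.
move=> oW hf.
have h1 j k : smooth_form W (fun x => wirt j (wirtbar k f) x *: dzbar R j k).
  exact: (smooth_form_scale _ oW (smooth_wirt j oW (smooth_wirtbar k oW hf))).
have h2 j := smooth_form_sum (index_enum 'I_N) oW (fun k (_ : xpredT k) => h1 j k).
have h3 := smooth_form_sum (index_enum 'I_N) oW (fun j (_ : xpredT j) => h2 j).
move=> S; apply: (smooth_eq oW _ (smoothZ (toC pi^-1 * 'i) oW (h3 S))) => x _.
by rewrite ddc_zform /herm scalerA covecZE.
Qed.

Lemma smooth_zform W (f : Cn R N -> Cplx R) :
  open W -> smooth_on W f -> smooth_form W (zform f).
Proof. by move=> oW hf; exact: (smooth_form_scale _ oW hf). Qed.

Lemma zform_set0 (f : Cn R N -> Cplx R) x : zform f x finset.set0 = f x.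
Proof. by rewrite /zform covecZE ecovE eqxx mulr1. Qed.

Lemma zform_eq0 (f : Cn R N -> Cplx R) x : zform f x = 0 -> f x = 0.
Proof. by move=> f0; rewrite -(zform_set0 f x) f0 ffunE. Qed.

Lemma wform_zform a (f : Cn R N -> Cplx R) x : wform a (zform f) x = f x *: a x.
Proof. by rewrite /wform /zform wedgeZr ecov0r. Qed.

End SmoothForms.

Section KernelForms.
Variables (R : realType) (chi : R -> R) (hchi : cutoff chi) (d n : nat).
Implicit Types (x : Cn R (d + n)).

Definition fiber : {set 'I_(d + n)} := (@rshift d n @: finset.setT)%SET.

Lemma radsq_setT N (y : Cn R N) : radsq finset.setT y = sqnorm y.
Proof. by apply: eq_bigl => j; rewrite inE. Qed.

Lemma radsq_fiber x : radsq fiber x = sqnorm (fpart x).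
Proof.
rewrite /radsq big_imset; last by move=> i j _ _; exact: rshift_inj.
rewrite -radsq_setT; apply: eq_bigr => j _; by rewrite fpart_coord.
Qed.

Lemma sqnorm_ge0 N (y : Cn R N) : 0 <= sqnorm y.
Proof. by rewrite -radsq_setT radsq_ge0. Qed.

Lemma sqnorm_eq0 N (y : Cn R N) : (sqnorm y == 0) = (y == 0).
Proof.
rewrite psumr_eq0 => [|j _]; last exact: sqr_ge0.
apply/allP/eqP => [h|->]; last first.
  by move=> j _; rewrite mxE modC0 expr0n eqxx.
apply/rowP => j; rewrite mxE; apply/eqP.
by have := h j (mem_index_enum j); rewrite sqrf_eq0 modC_eq0.
Qed.

Lemma chilogE N c (y : Cn R N) : chilog chi c y = profile chi c (sqnorm y).
Proof.
rewrite /chilog /profile /lognorm -sqnorm_eq0.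
have [->|y0] := eqVneq (sqnorm y) 0; first by rewrite lexx.
have yp : 0 < sqnorm y by rewrite lt_def y0 sqnorm_ge0.
rewrite leNgt yp /= -{2}(sqr_sqrtr (ltW yp)) lnXn ?sqrtr_gt0 //.
by congr (chi (_ + _)); field.
Qed.

Lemma KformE (theta : Cplx R) m x :
  @Kform R d n chi theta m x = kernel_form chi fiber (- ln (modC theta)) m x.
Proof.
case: m => [|m]; first by rewrite /Kform /zform scale1r.
apply: kernel_formE => [|x0].
  rewrite -(real_ddc_profile hchi _ _ (ln (modC theta))).
  apply: near_ddc_zform; apply: (@filterS _ (nbhs x) _ setT); last exact: filterT.
  by move=> y _; rewrite /uK chilogE radsq_fiber.
rewrite -(real_ddc_log x0); apply: near_ddc_zform.
apply: (@filterS _ (nbhs x) _ setT); last exact: filterT.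
by move=> y _; rewrite /lognorm radsq_fiber.
Qed.

Lemma OmegaE M m (y : Cn R n) :
  Omega chi M m y = kernel_form chi finset.setT M m y.
Proof.
case: m => [|m]; first by rewrite /Omega /zform scale1r.
apply: kernel_formE => [|x0].
  rewrite -(real_ddc_profile hchi _ _ 0).
  apply: near_ddc_zform; apply: (@filterS _ (nbhs y) _ setT); last exact: filterT.
  by move=> z _; rewrite chilogE radsq_setT addr0.
rewrite -(real_ddc_log x0); apply: near_ddc_zform.
apply: (@filterS _ (nbhs y) _ setT); last exact: filterT.
by move=> z _; rewrite /lognorm radsq_setT.
Qed.

(** Two open sets cover the space: {radsq < [profile_cut]}, where the form is identically 0, and
    {x'' <> 0}, where log |x''| is smooth. *)
Lemma smooth_Kform (theta : Cplx R) m : smooth_form setT (@Kform R d n chi theta m).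
Proof.
set c := - ln (modC theta).
have rs := @smooth_sqnorm_on R (d + n) setT fiber openT.
have o1 : open [set x : Cn R (d + n) | radsq fiber x < profile_cut c].
  exact: (open_comp (fun x _ => @radsq_continuous R (d + n) fiber x) (@open_lt R _)).
have o2 : open [set x : Cn R (d + n) | 0 < radsq fiber x].
  exact: (open_comp (fun x _ => @radsq_continuous R (d + n) fiber x) (@open_gt R _)).
case: m => [|m].
  apply: (smooth_form_eq openT _ (@smooth_form_cst _ _ setT (ecov R finset.set0))).
  by move=> x _; rewrite KformE.
move=> S; apply: smooth_local => x.
have [xc|xc] := ltP (radsq fiber x) (profile_cut c).
  exists [set x : Cn R (d + n) | radsq fiber x < profile_cut c]; split => //.
  apply: (smooth_eq o1 _ (@smooth_cst _ _ _ 0)) => y yc.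
  by rewrite KformE kernel_form0 // ffunE.
exists [set x : Cn R (d + n) | 0 < radsq fiber x]; split => //.
  exact: lt_le_trans (profile_cut_gt0 c) xc.
set W := [set x : Cn R (d + n) | 0 < radsq fiber x] in o2 *.
have ls : smooth_on W (fun x => toC (ln (radsq fiber x))).
  by apply: smooth_ln => //; exact: (smooth_sub (@subsetT _ _) rs).
have ls2 : smooth_on W (fun x => toC (ln (radsq fiber x) / 2)).
  apply: (smooth_eq o2 _ (smoothZ (toC 2^-1) o2 ls)) => y _.
  by rewrite -toCM mulrC.
have us : smooth_on W (fun x => toC (uK chi theta x)).
  have h : smooth_on W (fun x => toC (ln (radsq fiber x) / 2 + c)).
    apply: (smooth_eq o2 _ (smoothD o2 ls2 (@smooth_cst _ _ _ (toC c)))) => y _.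
    by rewrite -toCD.
  have hc := @smooth_comp _ _ W setT (chi_ chi) _ o2
    (fun i t _ => chi_is_derive hchi i t) (fun _ _ => Logic.I) h.
  apply: (smooth_eq o2 _ (smoothD o2 hc (@smooth_cst _ _ _ (toC (ln (modC theta)))))).
  move=> y y0; rewrite -toCD; congr toC; rewrite /uK chilogE -radsq_fiber /profile.
  by rewrite leNgt y0.
have lg : smooth_on W (fun x : Cn R (d + n) => toC (lognorm (fpart x))).
  apply: (smooth_eq o2 _ ls2) => y y0; congr toC.
  rewrite /lognorm -radsq_fiber -{1}(sqr_sqrtr (ltW y0)) lnXn ?sqrtr_gt0 //.
  by field.
have kw := smooth_form_wedge o2 (smooth_form_ddc o2 us)
  (smooth_form_wpow m o2 (smooth_form_ddc o2 lg)).
exact: kw.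
Qed.

End KernelForms.

Lemma kahler_sum (R : realType) N (J : {set 'I_N}) :
  kahler R J = \sum_(j in J) posform (unitv R j).
Proof. by []. Qed.

Opaque posform herm kahler conj_part unitv pull_vec.

(** * The kernels under projections and dilations *)

Section KernelPullback.
Variables (R : realType) (chi : R -> R) (hchi : cutoff chi) (d n : nat).
Implicit Types (x : Cn R (d + n)) (lam : Cplx R) (p q : R -> R) (c a t : R).
Local Notation F := (fiber d n).

Lemma posformZ N lam (a : Cn R N) :
  posform (lam *: a) = toC (modC lam ^+ 2) *: posform a.
Proof.
rewrite !posformE -hermZ; apply: eq_herm => j k.
by rewrite !mxE CconjM -conj_mul_sq; ring.
Qed.

Lemma pull_radial_form N N' (s : 'I_N' -> 'I_N) (u : 'I_N' -> Cplx R)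
    (J : {set 'I_N'}) h1 h2 y :
  (forall i j : 'I_N', (i < j)%N -> (s i < s j)%N) ->
  pull s u (radial_form J h1 h2 y) =
  toC pi^-1 *: (toC h1 *: (\sum_(j in J) posform (u j *: unitv R (s j))) +
    toC h2 *: posform (pull_vec s u (conj_part J y))).
Proof.
move=> sm; rewrite /radial_form (pullZ _ _ (toC pi^-1)) pullD.
rewrite (pullZ _ _ (toC h1)) (pullZ _ _ (toC h2)) pull_sum.
apply: (congr2 (fun c e : covec R N => toC pi^-1 *: (toC h1 *: c + toC h2 *: e)));
  last exact: pull_posform.
apply: eq_bigr => j _.
apply: (eq_trans (pull_posform u sm (unitv R j))); apply: (congr1 (@posform R N)).
apply/rowP => k.
rewrite pull_vecE (bigD1 j) //= unitvE eqxx mul1r big1 ?addr0.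
  by rewrite !mxE eqxx.
by move=> i /negPf ij; rewrite unitvE ij !mul0r.
Qed.

Lemma rshift_mono (i j : 'I_n) : (i < j)%N -> (rshift d i < rshift d j)%N.
Proof. by rewrite ltn_add2l. Qed.

Lemma lshift_mono (i j : 'I_d) : (i < j)%N -> (lshift n i < lshift n j)%N.
Proof. by []. Qed.

Lemma form_pullback_fpart (w : cform R n) x :
  form_pullback (@fpart R d n) w x = pull (@rshift d n) (fun=> 1) (w (fpart x)).
Proof.
apply: form_pullbackE; first exact: rshift_mono.
by move=> y j; rewrite fpart_coord mul1r.
Qed.

Lemma form_pullback_bpart (w : cform R d) x :
  form_pullback (@bpart R d n) w x = pull (@lshift d n) (fun=> 1) (w (bpart x)).
Proof.
apply: form_pullbackE; first exact: lshift_mono.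
by move=> y j; rewrite bpart_coord mul1r.
Qed.

Definition dil_coef lam (k : 'I_(d + n)) : Cplx R :=
  if fintype.split k is inr _ then lam else 1.

Lemma dilation_coord lam x k : dilation lam x 0 k = dil_coef lam k * x 0 k.
Proof.
rewrite /dilation /dil_coef -{1}(splitK k); case E: (fintype.split k) => [j|j] /=.
  by rewrite row_mxEl bpart_coord mul1r -[lshift n j]/(unsplit (inl j)) -E splitK.
by rewrite row_mxEr mxE fpart_coord -[rshift d j]/(unsplit (inr j)) -E splitK.
Qed.

Lemma form_pullback_dilation lam (w : cform R (d + n)) x :
  form_pullback (dilation lam) w x = pull id (dil_coef lam) (w (dilation lam x)).
Proof. by apply: form_pullbackE => // y j; rewrite dilation_coord. Qed.

Lemma dil_coef_r lam j : dil_coef lam (rshift d j) = lam.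
Proof. by rewrite /dil_coef -[rshift _ _]/(unsplit (inr j)) unsplitK. Qed.

Lemma dil_coef_l lam j : dil_coef lam (lshift n j) = 1.
Proof. by rewrite /dil_coef -[lshift _ _]/(unsplit (inl j)) unsplitK. Qed.

Lemma dil_coef_fiber lam k : k \in F -> dil_coef lam k = lam.
Proof. by move=> /imsetP[j _ ->]; rewrite dil_coef_r. Qed.

Lemma bpart_dilation lam x : bpart (dilation lam x) = bpart x.
Proof. by apply/rowP => j; rewrite !bpart_coord dilation_coord dil_coef_l mul1r. Qed.

Lemma radsq_dilation lam x : radsq F (dilation lam x) = modC lam ^+ 2 * radsq F x.
Proof.
rewrite /radsq mulr_sumr; apply: eq_bigr => j jF.
by rewrite dilation_coord dil_coef_fiber // modCM exprMn.
Qed.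

(** Multiplying |y| by a adds ln a to log |y|. The factor a^2, and a^4 in [profile2_scale], is the
    one that the dilation produces from [kahler] and from [posform (conj_part _ _)],
    respectively. *)
Lemma profile1_scale p c a t : 0 < a ->
  profile1 p c (a ^+ 2 * t) * a ^+ 2 = profile1 p (c + ln a) t.
Proof.
move=> a0; rewrite /profile1 pmulr_rle0 ?exprn_gt0 //; case: leP => t0.
  by rewrite mul0r.
rewrite lnM ?posrE ?exprn_gt0 // lnXn //.
have -> : (ln a *+ 2 + ln t) / 2 + c = ln t / 2 + (c + ln a) by field.
by field; rewrite !gt_eqF.
Qed.

Lemma profile2_scale p q c a t : 0 < a ->
  profile2 p q c (a ^+ 2 * t) * a ^+ 4 = profile2 p q (c + ln a) t.
Proof.
move=> a0; rewrite /profile2 pmulr_rle0 ?exprn_gt0 //; case: leP => t0.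
  by rewrite mul0r.
rewrite lnM ?posrE ?exprn_gt0 // lnXn //.
have -> : (ln a *+ 2 + ln t) / 2 + c = ln t / 2 + (c + ln a) by field.
by field; rewrite !gt_eqF.
Qed.

Lemma conj_part_dilation lam x : pull_vec id (dil_coef lam) (conj_part F (dilation lam x))
  = toC (modC lam ^+ 2) *: conj_part F x.
Proof.
apply/rowP => k; rewrite pull_vecE (bigD1 k) //= eqxx mulr1 big1 ?addr0.
  rewrite [RHS]mxE !conj_partE; case: ifPn => kF; last by rewrite mul0r mulr0.
  by rewrite dilation_coord dil_coef_fiber // CconjM -conj_mul_sq; ring.
by move=> j /negPf jk; rewrite eq_sym jk mulr0.
Qed.

Lemma log_form_dilation p q c lam x : lam != 0 ->
  pull id (dil_coef lam) (log_form p q F c (dilation lam x)) =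
  log_form p q F (c + ln (modC lam)) x.
Proof.
move=> lam0; have a0 : 0 < modC lam by rewrite modC_gt0.
have idm (i j : 'I_(d + n)) : (i < j)%N -> (id i < id j)%N by [].
rewrite /log_form; apply: (eq_trans (pull_radial_form _ _ _ _ _ idm)).
rewrite conj_part_dilation radsq_dilation.
rewrite -(profile1_scale p c _ a0) -(profile2_scale p q c _ a0) /radial_form.
apply: (congr2 (fun c e : covec R (d + n) => toC pi^-1 *: (c + e))).
  rewrite toCM -scalerA.
  apply: (congr1 (fun e : covec R (d + n) => toC (profile1 p c _) *: e)).
  rewrite kahler_sum scaler_sumr; apply: eq_bigr => j jF.
  by rewrite dil_coef_fiber // posformZ.
apply: (eq_trans (congr1 (fun e : covec R (d + n) => _ *: e) (posformZ _ _))).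
rewrite scalerA -toCM modC_toC ger0_norm ?sqr_ge0 //.
by rewrite -exprM.
Qed.

Lemma log_form_fpart p q c x :
  pull (@rshift d n) (fun=> 1) (log_form p q finset.setT c (fpart x)) =
  log_form p q F c x.
Proof.
rewrite /log_form; apply: (eq_trans (pull_radial_form _ _ _ _ _ rshift_mono)).
rewrite radsq_setT radsq_fiber /radial_form.
apply: (congr2 (fun e e' : covec R (d + n) =>
  toC pi^-1 *: (toC _ *: e + toC _ *: e'))).
  rewrite !kahler_sum big_imset; last by move=> i j _ _; exact: rshift_inj.
  by apply: eq_bigr => j _; rewrite scale1r.
apply: (congr1 (@posform R (d + n))).
apply/rowP => k; rewrite pull_vecE conj_partE.
case: ifPn => [/imsetP[j _ ->]|kF].
  rewrite (bigD1 j) //= eqxx big1 ?addr0 ?mulr1.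
    by rewrite conj_partE inE fpart_coord.
  by move=> i /negPf ij; rewrite (inj_eq (@rshift_inj _ _)) eq_sym ij mulr0.
rewrite big1 // => j _; case: eqP => [kj|]; last by rewrite mulr0.
by move/negP: kF; case; rewrite kj; apply: imset_f; rewrite inE.
Qed.

Lemma kernel_form_dilation c lam m x : lam != 0 ->
  pull id (dil_coef lam) (kernel_form chi F c m.+1 (dilation lam x)) =
  kernel_form chi F (c + ln (modC lam)) m.+1 x.
Proof.
move=> lam0; rewrite /kernel_form pull_wedge // log_form_dilation //.
(* The factors dd^c log |x''| are unchanged: their p and q are constant functions, so the shift by
   ln |lam| has no effect on them. *)
by rewrite pull_iter_wedge // log_form_dilation.
Qed.

End KernelPullback.

(** * The test forms at which the currents are evaluated *)

Section SlicedForms.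
Variables (R : realType) (chi : R -> R) (hchi : cutoff chi) (d n : nat).
Implicit Types (x : Cn R (d + n)) (lam : Cplx R) (c : R) (m r : nat)
  (phi : cform R d) (f : Cn R (d + n) -> Cplx R).
Local Notation F := (fiber d n).

Definition base_pull (w : covec R d) : covec R (d + n) :=
  pull (@lshift d n) (fun=> 1) w.

(** Evaluating T at this form with c = - log |theta| gives T /\ K_theta^m /\ pi_V^* phi at f;
    evaluating T_infty with c = M gives T_infty /\ pi_F^* Omega_m /\ pi_V^* phi at f. *)
Definition sliced_form c m phi f : cform R (d + n) := fun x =>
  f x *: wedge (kernel_form chi F c m x) (base_pull (phi (bpart x))).

Lemma sliced_Kform theta m phi f :
  wform (wform (@Kform R d n chi theta m) (form_pullback (@bpart R d n) phi)) (zform f)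
  = sliced_form (- ln (modC theta)) m phi f.
Proof.
apply/funext => x; rewrite wform_zform /sliced_form; congr (_ *: _).
by rewrite /wform (KformE hchi) form_pullback_bpart.
Qed.

Lemma kernel_form_fpart c m x :
  pull (@rshift d n) (fun=> 1) (kernel_form chi finset.setT c m (fpart x)) =
  kernel_form chi F c m x.
Proof.
have mono := @rshift_mono d n.
case: m => [|m]; first exact: pull_one.
apply: (eq_trans (pull_wedge _ mono _ _)).
apply: (congr2 (@wedge R (d + n))); first exact: log_form_fpart.
apply: (eq_trans (pull_iter_wedge _ mono _ _)).
by apply: (congr1 (fun e => iter m (wedge e) _)); exact: log_form_fpart.
Qed.

Lemma sliced_Omega M m phi f :
  wform (wform (form_pullback (@fpart R d n) (@Omega R n chi M m))
     (form_pullback (@bpart R d n) phi)) (zform f)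
  = sliced_form M m phi f.
Proof.
apply/funext => x; rewrite wform_zform /sliced_form; congr (_ *: _).
rewrite /wform form_pullback_fpart form_pullback_bpart (OmegaE hchi).
by rewrite kernel_form_fpart.
Qed.

Lemma pull_base_dilation lam (w : covec R d) :
  pull id (dil_coef lam) (base_pull w) = base_pull w.
Proof.
move: w; apply: covec_linear_ext => [z a b|z a b|A].
- by rewrite /base_pull !pull_linear.
- by rewrite /base_pull pull_linear.
rewrite /base_pull pull_ecov pullZ; apply: (congr1 (fun e => _ *: e)).
rewrite pull_ecov; set B := (_ @: A)%SET.
have -> : (pull_index (id : 'I_(d + n) -> 'I_(d + n)) @: B)%SET = B.
  rewrite -[RHS]imset_id; apply: eq_imset => a.
  rewrite /pull_index -[RHS](splitK a); by case: (fintype.split a).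
rewrite big1 ?scale1r // => _ /imsetP[a _ ->].
rewrite /pull_index; case: (fintype.split a) => j.
  by rewrite pull_coef_l dil_coef_l.
by rewrite pull_coef_r dil_coef_l Cconj1.
Qed.

(** Dilations fix the base and scale only the fibre, so just the level c and the test function
    change. This transports the convergence to the tangent current to the kernels. *)
Lemma sliced_dilation c lam m phi f : lam != 0 ->
  form_pullback (dilation lam) (sliced_form c m phi f) =
  sliced_form (c + ln (modC lam)) m phi (fun x => f (dilation lam x)).
Proof.
move=> lam0; apply/funext => x; rewrite form_pullback_dilation /sliced_form.
have idm (i j : 'I_(d + n)) : (i < j)%N -> (id i < id j)%N by [].
rewrite pullZ; apply: (congr1 (fun e : covec R (d + n) => _ *: e)).
apply: (eq_trans (pull_wedge _ idm _ _)).
apply: (congr2 (@wedge R (d + n))).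
  case: m => [|m]; first exact: pull_one.
  exact: kernel_form_dilation.
by rewrite bpart_dilation pull_base_dilation.
Qed.

Lemma sliced_formD c m phi psi f : sliced_form c m (fun y => phi y + psi y) f =
  fun x => sliced_form c m phi f x + sliced_form c m psi f x.
Proof.
apply/funext => x; rewrite /sliced_form /base_pull pullD wedgeDr.
exact: scalerDr.
Qed.

Lemma sliced_formZ c m (z : Cplx R) phi f : sliced_form c m (fun y => z *: phi y) f =
  fun x => z *: sliced_form c m phi f x.
Proof.
apply/funext => x; rewrite /sliced_form /base_pull pullZ wedgeZr.
by rewrite !scalerA mulrC.
Qed.

Lemma sliced_fun_linear c m phi (z : Cplx R) f g :
  sliced_form c m phi (fun x => z * f x + g x) =
  fun x => z *: sliced_form c m phi f x + sliced_form c m phi g x.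
Proof.
by apply/funext => x; rewrite /sliced_form scalerDl scalerA.
Qed.

Lemma smooth_base_pull phi : smooth_form setT phi ->
  smooth_form setT (fun x => base_pull (phi (bpart x))).
Proof.
move=> sp; apply: smooth_form_sum; first exact: openT.
by move=> S _; apply: smooth_form_scale; [exact: openT|exact: smooth_bpart (sp S)].
Qed.

Lemma smooth_kernel_form c m :
  smooth_form setT (fun x => kernel_form chi F c m x).
Proof.
(* Every level c is attained by some K_theta, namely for theta = exp (- c). *)
have E : - ln (modC (toC (expR (- c)))) = c.
  by rewrite modC_toC ger0_norm ?expR_ge0 // expRK opprK.
have h := @smooth_Kform _ _ hchi d n (toC (expR (- c))) m.
apply: (smooth_form_eq openT _ h) => x _.
by apply: (eq_trans (KformE hchi _ _ _)); rewrite E.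
Qed.

Lemma sliced_test W c m r phi f : test_fun W f ->
  smooth_form setT phi -> bidegree r r phi ->
  test_form W (m + r) (m + r) (sliced_form c m phi f).
Proof.
move=> [sf _ [K [cK KW f0]]] sphi bphi; split.
- have sf' : smooth_on setT f.
    by apply: (smooth_eq openT _ (sf finset.set0)) => x _; rewrite zform_set0.
  have sw := smooth_form_wedge openT (smooth_form_wedge openT (smooth_kernel_form c m)
    (smooth_base_pull sphi)) (smooth_zform openT sf').
  by apply: (smooth_form_eq openT _ sw) => x _; rewrite wform_zform.
- move=> x; apply: bidegreeZ; apply: bidegree_wedge.
    exact: bidegree_kernel_form.
  by apply: pull_bidegree; [exact: lshift_mono|exact: bphi].
- exists K; split; [exact: cK|exact: KW|move=> x Kx].
  by rewrite /sliced_form (zform_eq0 (f0 x Kx)) scale0r.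
Qed.

Lemma sliced_positive c m r phi f x :
  (forall y, pos_comb r (phi y)) -> (exists2 t : R, 0 <= t & f x = toC t) ->
  strongly_positive_covec (m + r) (sliced_form c m phi f x).
Proof.
move=> pphi [t t0 fx]; apply/pos_combP; rewrite /sliced_form fx.
apply: pos_combZ => //; apply: pos_comb_wedge; first exact: pos_comb_kernel_form.
by apply: pull_pos_comb; [exact: lshift_mono|exact: pphi].
Qed.

End SlicedForms.

(** * Test functions and partitions of unity *)

Section RealTestFunctions.
Variables (R : realType) (N : nat).
Implicit Types (f g : Cn R N -> R) (W : set (Cn R N)) (x : Cn R N).

Definition smooth_real f := smooth_on setT (fun x => toC (f x)).

Definition supported_in W f := exists K : set (Cn R N),
  [/\ compact K, K `<=` W & forall x, ~ K x -> f x = 0].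

Definition real_test W f := smooth_real f /\ supported_in W f.

Lemma test_funE W (f : Cn R N -> Cplx R) : test_fun W f <->
  smooth_on setT f /\ exists K : set (Cn R N),
     [/\ compact K, K `<=` W & forall x, ~ K x -> f x = 0].
Proof.
split=> [[sf _ [K [cK KW f0]]]|[sf [K [cK KW f0]]]].
  split; last by exists K; split => // x /f0; exact: zform_eq0.
  by apply: (smooth_eq openT _ (sf finset.set0)) => x _; rewrite zform_set0.
split; first exact: smooth_zform openT sf.
  by move=> x; apply: bidegreeZ; exact: bidegree_one.
by exists K; split => // x /f0 fx; rewrite /zform fx scale0r.
Qed.

Lemma real_testP W f : real_test W f <-> test_fun W (fun x => toC (f x)).
Proof.
split=> [[sf [K [cK KW f0]]]|/test_funE[sf [K [cK KW f0]]]].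
  by apply/test_funE; split => //; exists K; split => // x /f0 ->.
by split => //; exists K; split => // x /f0 /toC_inj.
Qed.

Lemma smooth_realD f g : smooth_real f -> smooth_real g ->
  smooth_real (fun x => f x + g x).
Proof.
move=> hf hg; apply: (smooth_eq openT _ (smoothD openT hf hg)) => x _.
by rewrite toCD.
Qed.

Lemma smooth_realM f g : smooth_real f -> smooth_real g ->
  smooth_real (fun x => f x * g x).
Proof.
move=> hf hg; apply: (smooth_eq openT _ (smoothM openT hf hg)) => x _.
by rewrite toCM.
Qed.

Lemma smooth_real_cst (c : R) : smooth_real (fun=> c).
Proof. exact: smooth_cst. Qed.

Lemma smooth_real_comp (h : nat -> R -> R) f :
  (forall i (t : R), is_derive t 1 (h i) (h i.+1 t)) -> smooth_real f ->
  smooth_real (fun x => h 0%N (f x)).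
Proof.
move=> dh hf.
exact: (@smooth_comp _ _ setT setT h f openT (fun i t _ => dh i t)
  (fun _ _ => Logic.I) hf).
Qed.

Lemma smooth_real_continuous f : smooth_real f -> continuous f.
Proof.
move=> hf x.
by have /continuous_CplxE[+ _] := smooth_continuous hf (Logic.I : setT x).
Qed.

Lemma real_test_continuous W f : real_test W f -> continuous f.
Proof. by case=> /smooth_real_continuous. Qed.

Lemma supported_in_sub W W' f : W `<=` W' -> supported_in W f -> supported_in W' f.
Proof.
by move=> sW [K [cK KW f0]]; exists K; split => // x /KW /sW.
Qed.

Lemma real_test_sub W W' f : W `<=` W' -> real_test W f -> real_test W' f.
Proof. by move=> sW [sf /(supported_in_sub sW)]. Qed.

Lemma real_test_mul W f g : smooth_real g -> real_test W f ->
  real_test W (fun x => f x * g x).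
Proof.
move=> sg [sf [K [cK KW f0]]]; split; first exact: smooth_realM.
by exists K; split => // x /f0 ->; rewrite mul0r.
Qed.

Lemma real_testZ W (c : R) f : real_test W f -> real_test W (fun x => c * f x).
Proof.
move=> /(real_test_mul (smooth_real_cst c)) [sf hf].
have E : (fun x => f x * c) = (fun x => c * f x).
  by apply/funext => x; rewrite mulrC.
by rewrite E in sf hf; split.
Qed.

Lemma real_testD W f g : real_test W f -> real_test W g ->
  real_test W (fun x => f x + g x).
Proof.
move=> [sf [K [cK KW f0]]] [sg [L [cL LW g0]]]; split; first exact: smooth_realD.
exists (K `|` L); split; first exact: compactU.
  by move=> x [/KW|/LW].
by move=> x /not_orP[/f0 -> /g0 ->]; rewrite addr0.
Qed.

Lemma real_testB W f g : real_test W f -> real_test W g ->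
  real_test W (fun x => f x - g x).
Proof.
move=> hf hg; have := real_testD hf (real_testZ (-1) hg).
by under eq_fun do rewrite mulN1r.
Qed.

Lemma real_test0 W : real_test W (fun=> 0).
Proof.
split; first exact: smooth_real_cst.
by exists set0; split => //; exact: compact0.
Qed.

Lemma real_test_sum W (I : eqType) (r : seq I) (F : I -> Cn R N -> R) :
  (forall i, i \in r -> real_test W (F i)) ->
  real_test W (fun x => \sum_(i <- r) F i x).
Proof.
elim: r => [|i r ih] h.
  by under eq_fun do rewrite big_nil; exact: real_test0.
under eq_fun do rewrite big_cons; apply: real_testD.
  by apply: h; rewrite mem_head.
by apply: ih => j jr; apply: h; rewrite in_cons jr orbT.
Qed.

End RealTestFunctions.

(** * Partitions of unity subordinate to grids of small cubes *)

Section Cells.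
Variables (R : realType) (chi : R -> R) (hchi : cutoff chi) (N : nat).
Implicit Types (x y : Cn R N) (q L : nat) (W : set (Cn R N)).
Local Notation step := (chi_ chi 1).
Local Notation dir := ('I_N * bool)%type.

Definition real_coord x (s : dir) : R :=
  if s.2 then imC (x 0 s.1) else reC (x 0 s.1).

Lemma smooth_real_coord s : smooth_real (real_coord^~ s).
Proof.
case: s => j []; rewrite /smooth_real /real_coord /=.
  exact: (smooth_imC openT (smooth_coord j openT)).
exact: (smooth_reC openT (smooth_coord j openT)).
Qed.

Lemma le_real_coord x s : `|real_coord x s| <= modC (x 0 s.1).
Proof. by case: s => j []; rewrite /real_coord ?le_reC_modC ?le_imC_modC. Qed.

Lemma modC_real_coord_le x y j e :
  (forall s, `|real_coord x s - real_coord y s| <= e) ->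
  modC (x 0 j - y 0 j) <= e + e.
Proof.
move=> h; rewrite (le_trans (modC_le_reC_imC _)) // reCB imCB.
by rewrite lerD //; [exact: (h (j, false))|exact: (h (j, true))].
Qed.

(** As chi' rises from 0 before -1 to 1 after 1, this is a bump supported in [-1, 2] whose integer
    translates telescope. *)
Definition bump (t : R) := step t - step (t - 1).

Lemma bump_ge0 t : 0 <= bump t.
Proof. by rewrite subr_ge0; apply: chi1_homo; rewrite // lerBlDr lerDl ler01. Qed.

Lemma bump_eq0 t : t < -1 \/ 2 < t -> bump t = 0.
Proof.
move=> [h|h]; rewrite /bump.
  by rewrite !chi1_left ?subrr //; lra.
by rewrite !chi1_right ?subrr //; lra.
Qed.

Lemma sum_bump (t : R) m : \sum_(i < m) bump (t - i%:R) = step t - step (t - m%:R).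
Proof.
elim: m => [|m ih]; first by rewrite big_ord0 subr0 subrr.
rewrite big_ord_recr ih /bump /= addrA subrK; congr (_ - step _).
by rewrite -natr1; lra.
Qed.

Definition scale q : R := q.+1%:R.

Definition cell_bump q (a : {ffun dir -> int}) x : R :=
  \prod_s bump (scale q * real_coord x s - (a s)%:~R).

Definition cell q (a : {ffun dir -> int}) : set (Cn R N) :=
  [set x | forall s, -1 <= scale q * real_coord x s - (a s)%:~R <= 2].

Lemma scale_gt0 q : 0 < scale q. Proof. by rewrite ltr0n. Qed.

Lemma cell_compact q a : compact (cell q a).
Proof.
have -> : cell q a = box (fun s => (scale q)^-1 * ((a s)%:~R - 1))
    (fun s => (scale q)^-1 * ((a s)%:~R + 2)).
  have E (r b : R) : (-1 <= scale q * r - b <= 2) =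
      ((scale q)^-1 * (b - 1) <= r <= (scale q)^-1 * (b + 2)).
    rewrite ler_pdivrMl ?scale_gt0 // ler_pdivlMl ?scale_gt0 //.
    by apply/idP/idP => /andP[h1 h2]; apply/andP; split; lra.
  rewrite eqEsubset; split=> x h.
    move=> j; split; [have := h (j, false)|have := h (j, true)];
      by rewrite /real_coord /= E.
  by move=> [j []]; rewrite E; have [] := h j.
exact: box_compact.
Qed.

Lemma cell_bump_ge0 q a x : 0 <= cell_bump q a x.
Proof. by apply: prodr_ge0 => s _; exact: bump_ge0. Qed.

Lemma cell_bump_eq0 q a x : ~ cell q a x -> cell_bump q a x = 0.
Proof.
move=> /existsNP[s hs]; rewrite /cell_bump (bigD1 s) //= bump_eq0 ?mul0r //.
move/negP: hs; rewrite negb_and -!ltNge => /orP[]; first by left.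
by right.
Qed.

Lemma smooth_cell_bump q a : smooth_real (cell_bump q a).
Proof.
have sb s : smooth_real (fun x => bump (scale q * real_coord x s - (a s)%:~R)).
  have su : smooth_real (fun x => scale q * real_coord x s - (a s)%:~R).
    apply: smooth_realD; last exact: smooth_real_cst.
    by apply: smooth_realM; [exact: smooth_real_cst|exact: smooth_real_coord].
  have su' : smooth_real (fun x => scale q * real_coord x s - (a s)%:~R - 1).
    exact: (smooth_realD su (smooth_real_cst _)).
  have h1 := smooth_real_comp (fun i t => chi_is_derive hchi i.+1 t) su.
  have h2 := smooth_real_comp (fun i t => chi_is_derive hchi i.+1 t) su'.
  have := smooth_realD h1 (smooth_realM (smooth_real_cst (-1)) h2).
  by under eq_fun do rewrite mulN1r.
have := smooth_prod (index_enum dir) openT (fun s (_ : xpredT s) => sb s).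
apply: (smooth_eq openT) => x _.
by rewrite /toC rmorph_prod.
Qed.

Lemma real_test_cell_bump W q a : cell q a `<=` W -> real_test W (cell_bump q a).
Proof.
move=> cW; split; first exact: smooth_cell_bump.
by exists (cell q a); split; [exact: cell_compact| |exact: cell_bump_eq0].
Qed.

Definition grid L (b : {ffun dir -> 'I_(L + L)}) : {ffun dir -> int} :=
  [ffun s => (b s)%:Z - L%:Z].

(** Distributivity turns the sum over the grid into a product, over the real directions, of
    one-variable sums that telescope. *)
Lemma sum_cell_bump q L x : \sum_b cell_bump q (@grid L b) x =
  \prod_s (step (scale q * real_coord x s + L%:R)
           - step (scale q * real_coord x s - L%:R)).
Proof.
transitivity (\prod_s \sum_(i < L + L)
    bump (scale q * real_coord x s + L%:R - i%:R)).
  rewrite bigA_distr_bigA; apply: eq_bigr => b _; apply: eq_bigr => s _.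
  by rewrite ffunE rmorphB /= opprB addrA.
apply: eq_bigr => s _; rewrite sum_bump; congr (_ - step _).
by rewrite natrD; lra.
Qed.

Lemma sum_cell_bump_le1 q L x : \sum_b cell_bump q (@grid L b) x <= 1.
Proof.
rewrite sum_cell_bump; apply: prodr_ile1 => s _; apply/andP; split.
  by rewrite subr_ge0; apply: chi1_homo => //; rewrite lerD // (@le_trans _ _ 0) ?oppr_le0.
by rewrite lerBlDr (le_trans (chi1_le1 hchi _)) // lerDl chi1_ge0.
Qed.

Lemma sum_cell_bump_eq1 q L (B : R) x : (forall s, `|real_coord x s| <= B) ->
  scale q * B + 2 <= L%:R -> \sum_b cell_bump q (@grid L b) x = 1.
Proof.
move=> xB BL; rewrite sum_cell_bump big1 // => s _.
have : `|scale q * real_coord x s| <= scale q * B.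
  by rewrite normrM gtr0_norm ?scale_gt0 // ler_wpM2l // ltW ?scale_gt0.
rewrite ler_norml => /andP[h1 h2].
by rewrite chi1_right ?chi1_left ?subr0 //; lra.
Qed.

(** A cell has side 3 / scale in every real direction; the real and the imaginary part contribute
    one side each. *)
Lemma cell_diameter q a x y j : cell q a x -> cell q a y ->
  modC (x 0 j - y 0 j) <= 6 / scale q.
Proof.
move=> hx hy; have -> : 6 / scale q = 3 / scale q + 3 / scale q.
  by rewrite -mulrDl; congr (_ / _); lra.
apply: modC_real_coord_le => s.
rewrite -(ler_pM2l (scale_gt0 q)) mulrCA mulfV ?gt_eqF ?scale_gt0 // mulr1.
rewrite -{1}(gtr0_norm (scale_gt0 q)) -normrM mulrBr ler_norml.
by have /andP[? ?] := hx s; have /andP[? ?] := hy s; apply/andP; split; lra.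
Qed.

Lemma near_scale_lt (e : R) : 0 < e -> \forall q \near \oo, 6 / scale q < e.
Proof.
move=> e0; near=> q.
rewrite ltr_pdivrMr ?scale_gt0 // mulrC -ltr_pdivrMr //.
rewrite (lt_trans (archi_boundP _)) // ?divr_ge0 ?ltW //.
rewrite ltr_nat ltnS; near: q; exact: nbhs_infty_ge.
Unshelve. all: by end_near. Qed.

(* Lebesgue's number lemma, for the cells. *)
Lemma small_cells (K : set (Cn R N)) (P : set (set (Cn R N))) : compact K ->
  (forall x, K x -> exists O, [/\ open O, O x & P O]) ->
  \forall q \near \oo, forall a, cell q a `&` K !=set0 ->
    exists2 O, P O & cell q a `<=` O.
Proof.
move=> /compact_near_coveringP cK hP.
have [] := cK nat \oo (fun q x => exists2 O, P O &
  forall y : Cn R N, (forall j, modC (x 0 j - y 0 j) <= 6 / scale q) -> O y).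
  move=> x Kx; have [U [oO Ox PO]] := hP x Kx.
  have /nbhs_CnP[e e0 he] : nbhs x U by exact: open_nbhs_nbhs.
  exists ([set y : Cn R N | forall j, modC (x 0 j - y 0 j) < e / 2],
          [set q | 6 / scale q < e / 2]).
    split; first by apply/nbhs_CnP; exists (e / 2) => //; rewrite divr_gt0.
    by apply: near_scale_lt; rewrite divr_gt0.
  move=> [y q] /= [xy qe]; exists U => // z yz; apply: he => j.
  rewrite -(subrK (y 0 j) (x 0 j)) -addrA (le_lt_trans (modCD _ _)) //.
  by rewrite (splitr e) ltrD // (le_lt_trans (yz j)).
move=> q0 _ h; exists q0 => // q q0q a [x [ax Kx]].
have [U PO hO] := h q q0q x Kx.
by exists U => // y ay; apply: hO => j; exact: cell_diameter ax ay.
Qed.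

Lemma compact_bounded (K : set (Cn R N)) : compact K ->
  exists B : R, forall x, K x -> forall s, `|real_coord x s| <= B.
Proof.
move=> /compact_CnE[_ [B hB]]; exists B => x Kx s.
exact: le_trans (le_real_coord x s) (hB x Kx _).
Qed.

(** Discarding the cells that miss [K] does not change the sum on [K], where their bumps vanish, and
    can only lower it elsewhere. *)
Lemma cell_partition (K : set (Cn R N)) q : compact K ->
  exists s : seq {ffun dir -> int},
  [/\ forall a, a \in s -> cell q a `&` K !=set0,
      forall x, \sum_(a <- s) cell_bump q a x <= 1 &
      forall x, K x -> \sum_(a <- s) cell_bump q a x = 1].
Proof.
move=> /compact_bounded[B hB].
have [L hL] : exists L : nat, scale q * B + 2 <= L%:R.
  exists (Num.bound `|scale q * B + 2|).
  by rewrite (le_trans (ler_norm _)) // ltW // archi_boundP.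
exists [seq grid b | b <- index_enum {ffun dir -> 'I_(L + L)} &
    `[< cell q (grid b) `&` K !=set0 >]].
split=> [a /mapP[b]|x|x Kx].
- by rewrite mem_filter => /andP[/asboolP + _] ->.
- rewrite big_map big_filter (le_trans _ (sum_cell_bump_le1 q L x)) //.
  by rewrite big_mkcond ler_sum // => b _; case: ifP => _ //; exact: cell_bump_ge0.
rewrite big_map big_filter -[RHS](sum_cell_bump_eq1 (hB x Kx) hL) big_mkcond.
apply: eq_bigr => b _; case: asboolP => // nK; apply/esym.
by apply: cell_bump_eq0 => bx; apply: nK; exists x.
Qed.

(** The sum of the bumps of the cells meeting [K], on a mesh so fine that each of these cells lies
    in [O]. *)
Lemma smooth_cutoff (K O : set (Cn R N)) : compact K -> open O -> K `<=` O ->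
  exists g, [/\ real_test O g, forall x, 0 <= g x <= 1 & forall x, K x -> g x = 1].
Proof.
move=> cK oO KO.
have [q _ hq] : \forall q \near \oo, forall a, cell q a `&` K !=set0 ->
    exists2 O', [set O] O' & cell q a `<=` O'.
  by apply: small_cells => // x Kx; exists O; split => //; exact: KO.
have [s [sK s1 sE]] := cell_partition q cK.
exists (fun x => \sum_(a <- s) cell_bump q a x); split => //.
  apply: real_test_sum => a /sK aK; apply: real_test_cell_bump.
  by have [U -> //] := hq q (leqnn q) a aK.
by move=> x; rewrite s1 andbT sumr_ge0 // => a _; exact: cell_bump_ge0.
Qed.

(** A countable family of bumps approximates every test function. The error is bounded by e times a
    fixed test function, and not merely by e, because this is the kind of bound that a positive
    functional preserves. *)
Lemma cell_approximation W (oW : open W) f : real_test W f ->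
  exists2 g, real_test W g /\ (forall x, 0 <= g x) &
  forall e, 0 < e -> exists q (s : seq {ffun dir -> int}) (c : {ffun dir -> int} -> R),
    (forall a, a \in s -> cell q a `<=` W) /\
    forall x, `|f x - \sum_(a <- s) c a * cell_bump q a x| <= e * g x.
Proof.
move=> hf; have [sf [K [cK KW f0]]] := hf; have cf := real_test_continuous hf.
have [g1 [tg g01 g1K]] := smooth_cutoff cK oW KW.
have cg := real_test_continuous tg.
(* The cells used below lie in {g1 > 1/2}, where 2 g1 exceeds 1. *)
exists (fun x => 2 * g1 x).
  split; first exact: real_testZ.
  by move=> x; rewrite mulr_ge0 //; have /andP[] := g01 x.
move=> e e0.
have supp_g x : 2^-1 < g1 x -> W x.
  case: tg => _ [K' [_ K'W g0]] gx; apply: K'W; apply: contrapT => /g0 gx0.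
  by move: gx; rewrite gx0 ltNge invr_ge0 ler0n.
pose P O := (forall x, O x -> 2^-1 < g1 x) /\
  (forall x y, O x -> O y -> `|f x - f y| <= e).
have [q _ hq] : \forall q \near \oo, forall a, cell q a `&` K !=set0 ->
    exists2 O, P O & cell q a `<=` O.
  apply: small_cells => // x Kx.
  exists ([set y | 2^-1 < g1 y] `&` [set y | `|f x - f y| < e / 2]); split.
  - apply: openI; first exact: (open_comp (fun y _ => cg y) (@open_gt R _)).
    have cfx : continuous (fun y => `|f x - f y|).
      move=> y; apply: (@continuous_comp _ _ _ (fun y => f x - f y) (@Num.norm R R) y).
        exact: (@continuousB _ _ _ (fun=> f x) f y (@continuous_cstR _ _ (f x) y) (cf y)).
      exact: norm_continuous.
    exact: (open_comp (fun y _ => cfx y) (@open_lt R _)).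
  - by split; rewrite /= ?g1K ?subrr ?normr0 ?divr_gt0 // invf_lt1 // ltr1n.
  - split=> [y []//|y z [_ /= xy] [_ /= xz]].
    rewrite -(subrK (f x) (f y)) -addrA (le_trans (ler_normD _ _)) //.
    by rewrite distrC (splitr e) ltW // ltrD.
have [s [sK s1 sE]] := cell_partition q cK.
exists q, s.
(* The coefficient of a cell is the value of [f] at one of its points. *)
have cP a : exists r : R, a \in s -> exists2 z, cell q a z & r = f z.
  have [as_|] := boolP (a \in s); last by exists 0.
  by have [z [az _]] := sK a as_; exists (f z) => _; exists z.
have {cP}[c cP] := choice cP; exists c; split.
  move=> a as_ x ax; have [U [hO _] aO] := hq q (leqnn q) a (sK a as_).
  exact/supp_g/hO/aO.
move=> x.
have fE : f x = \sum_(a <- s) f x * cell_bump q a x.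
  rewrite -mulr_sumr; have [Kx|/f0 ->] := pselect (K x); last by rewrite mul0r.
  by rewrite sE // mulr1.
rewrite {1}fE -sumrB (le_trans (ler_norm_sum _ _ _)) //.
have [gx|gx] := ltP (2^-1) (g1 x); last first.
  rewrite big_seq big1.
    apply: mulr_ge0; first exact: ltW.
    by apply: mulr_ge0 => //; have /andP[] := g01 x.
  move=> a as_; have [U [hO _] aO] := hq q (leqnn q) a (sK a as_).
  rewrite cell_bump_eq0 ?mulr0 ?subrr ?normr0 // => /aO /hO.
  by rewrite ltNge gx.
apply: (@le_trans _ _ (\sum_(a <- s) e * cell_bump q a x)).
  rewrite big_seq [leRHS]big_seq; apply: ler_sum => a as_.
  have [U [_ hO] aO] := hq q (leqnn q) a (sK a as_).
  rewrite -mulrBl normrM (ger0_norm (cell_bump_ge0 _ _ _)).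
  have [ax|/cell_bump_eq0 ->] := pselect (cell q a x); last by rewrite !mulr0.
  rewrite ler_wpM2r ?cell_bump_ge0 //.
  by have [z az ->] := cP a as_; apply: hO; exact: aO.
rewrite -mulr_sumr ler_pM2l // (le_trans (s1 x)) //.
by move: gx; rewrite -(ltr_pM2l (ltr0n R 2)) mulfV ?pnatr_eq0 // => /ltW.
Qed.

End Cells.

(** * The Riesz representation theorem *)

Definition measure_of_axioms (dis : measure_display) (T : measurableType dis)
  (R : realType) (mu : set T -> \bar R) (m0 : mu set0 = 0%E)
  (mge0 : forall A, (0 <= mu A)%E) (ms : semi_sigma_additive mu) :
  {measure set T -> \bar R} := HB.pack mu (isMeasure.Build dis T R mu m0 mge0 ms).

Definition outer_measure_of_axioms (T : Type) (R : realType)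
  (mu : set T -> \bar R) (m0 : mu set0 = 0%E) (mge0 : forall A, (0 <= mu A)%E)
  (le_mu : {homo mu : A B / A `<=` B >-> (A <= B)%E})
  (ms : sigma_subadditive mu) : {outer_measure set T -> \bar R} :=
  HB.pack mu (isOuterMeasure.Build R T mu m0 mge0 le_mu ms).

(** [S 0] forces c <= M, so c is finite as soon as M is, and can then be moved to the other side. *)
Lemma ereal_supD_le (R : realType) (S : set (\bar R)) (c M : \bar R) :
  S 0%E -> (0 <= c)%E -> (forall x, S x -> (x + c <= M)%E) ->
  (ereal_sup S + c <= M)%E.
Proof.
move=> S0 c0 h; case: M h => [M| |] h; last 2 first.
- by rewrite leey.
- by have := h _ S0; rewrite add0e => /(le_trans c0); rewrite leeNy_eq.
have cfin : c \is a fin_num.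
  rewrite ge0_fin_numE //; have := h _ S0; rewrite add0e => /le_lt_trans; apply.
  by rewrite ltry.
rewrite -leeBrDr //; apply: ge_ereal_sup => x Sx.
by rewrite leeBrDr //; exact: h.
Qed.

Record positive_functional (R : realType) N (W : set (Cn R N))
    (L : (Cn R N -> R) -> R) : Prop := {
  pos_fun_linear : forall c f g, real_test W f -> real_test W g ->
    L (fun x => c * f x + g x) = c * L f + L g;
  pos_fun_ge0 : forall f, real_test W f -> (forall x, 0 <= f x) -> 0 <= L f }.

Section PositiveFunctional.
Variables (R : realType) (N : nat) (W : set (Cn R N)) (L : (Cn R N -> R) -> R).
Hypothesis hL : positive_functional W L.
Implicit Types (f g : Cn R N -> R).

Lemma pos_fun0 : L (fun=> 0) = 0.
Proof.
have h := pos_fun_linear hL (-1) (real_test0 W) (real_test0 W).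
rewrite (_ : (fun x => _) = (fun=> 0)) in h.
  by lra.
by apply/funext => x; rewrite mulr0 addr0.
Qed.

Lemma pos_funZ c f : real_test W f -> L (fun x => c * f x) = c * L f.
Proof.
move=> hf; have := pos_fun_linear hL c hf (real_test0 W).
rewrite pos_fun0 addr0 => <-; congr L.
by apply/funext => x; rewrite addr0.
Qed.

Lemma pos_funD f g : real_test W f -> real_test W g ->
  L (fun x => f x + g x) = L f + L g.
Proof.
move=> hf hg; have := pos_fun_linear hL 1 hf hg.
rewrite mul1r => <-; congr L.
by apply/funext => x; rewrite mul1r.
Qed.

Lemma pos_funB f g : real_test W f -> real_test W g ->
  L (fun x => f x - g x) = L f - L g.
Proof.
move=> hf hg; have := pos_fun_linear hL (-1) hg hf.
rewrite mulN1r addrC => <-; congr L.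
by apply/funext => x; rewrite mulN1r addrC.
Qed.

Lemma pos_fun_le f g : real_test W f -> real_test W g ->
  (forall x, f x <= g x) -> L f <= L g.
Proof.
move=> hf hg fg; rewrite -subr_ge0 -pos_funB //.
apply: (pos_fun_ge0 hL); first exact: real_testB.
by move=> x; rewrite subr_ge0.
Qed.

Lemma pos_fun_sum (I : eqType) (r : seq I) (F : I -> Cn R N -> R) :
  (forall i, i \in r -> real_test W (F i)) ->
  L (fun x => \sum_(i <- r) F i x) = \sum_(i <- r) L (F i).
Proof.
elim: r => [|i r ih] h.
  by rewrite big_nil -[RHS]pos_fun0; congr L; apply/funext => x; rewrite big_nil.
have hr : forall j, j \in r -> real_test W (F j).
  by move=> j jr; apply: h; rewrite in_cons jr orbT.
rewrite big_cons -ih // -pos_funD.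
- by congr L; apply/funext => x; rewrite big_cons.
- by apply: h; rewrite mem_head.
- exact: real_test_sum.
Qed.

Lemma pos_fun_norm f g : real_test W f -> real_test W g ->
  (forall x, `|f x| <= g x) -> `|L f| <= L g.
Proof.
move=> hf hg fg; rewrite ler_norml -mulN1r -pos_funZ //.
apply/andP; split; apply: pos_fun_le => //; first exact: real_testZ.
  by move=> x; have := fg x; rewrite ler_norml mulN1r => /andP[].
by move=> x; have := fg x; rewrite ler_norml => /andP[].
Qed.

Definition subunit (O : set (Cn R N)) f := real_test O f /\ forall x, 0 <= f x <= 1.

(** The mass that Riesz' construction gives to an open set. The outer measure below extends it from
    outside to all sets. *)
Definition riesz_open (O : set (Cn R N)) : \bar R :=
  ereal_sup [set (L f)%:E | f in subunit O].

Lemma subunit0 O : subunit O (fun=> 0).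
Proof. by split; [exact: real_test0|move=> x; rewrite lexx ler01]. Qed.

Lemma riesz_open_has0 O : [set (L f)%:E | f in subunit O] 0%E.
Proof. by exists (fun=> 0); [exact: subunit0|rewrite pos_fun0]. Qed.

Lemma riesz_open_ge0 O : (0 <= riesz_open O)%E.
Proof. exact: ereal_sup_ubound (riesz_open_has0 O). Qed.

Lemma riesz_open_ge O f : subunit O f -> ((L f)%:E <= riesz_open O)%E.
Proof. by move=> hf; apply: ereal_sup_ubound; exists f. Qed.

Lemma le_riesz_open O O' : O `<=` O' -> (riesz_open O <= riesz_open O')%E.
Proof.
move=> OO'; apply: ge_ereal_sup => _ [f [tf f01] <-].
by apply: riesz_open_ge; split => //; exact: real_test_sub tf.
Qed.

(** Only the part of [A] inside [W] has to be covered: the outer measure is defined on all subsets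
    of C^N and carried by [W]. *)
Definition admissible (A O : set (Cn R N)) := [/\ open O, O `<=` W & A `&` W `<=` O].

Definition riesz_outer (A : set (Cn R N)) : \bar R :=
  ereal_inf [set riesz_open O | O in admissible A].

Lemma riesz_outer_le A O : admissible A O -> (riesz_outer A <= riesz_open O)%E.
Proof. by move=> hO; apply: ereal_inf_lbound; exists O. Qed.

Lemma riesz_outer_open O : open O -> O `<=` W -> riesz_outer O = riesz_open O.
Proof.
move=> oO OW; apply/eqP; rewrite eq_le; apply/andP; split.
  by apply: riesz_outer_le; split => // x [].
apply: le_ereal_inf_tmp => _ [G [_ _ OO'] <-]; apply: le_riesz_open => x Ox.
by apply: OO'; split => //; exact: OW.
Qed.

Lemma riesz_outer_ge0 A : (0 <= riesz_outer A)%E.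
Proof. by apply: le_ereal_inf_tmp => _ [G _ <-]; exact: riesz_open_ge0. Qed.

Lemma le_riesz_outer : {homo riesz_outer : A B / A `<=` B >-> (A <= B)%E}.
Proof.
move=> A B AB; apply: le_ereal_inf_tmp => _ [G [oG GW BG] <-].
by apply: riesz_outer_le; split => // x [/AB Bx Wx]; exact: BG.
Qed.

Lemma riesz_outer0 : riesz_outer set0 = 0%E.
Proof.
apply/eqP; rewrite eq_le riesz_outer_ge0 andbT.
have h : admissible set0 (set0 : set (Cn R N)).
  by split; [exact: open0|exact: sub0set|rewrite set0I].
apply: (le_trans (riesz_outer_le h)); apply: ge_ereal_sup => _ [f [[_ [K [_ K0 f0]]] _] <-].
rewrite (_ : f = fun=> 0) ?pos_fun0 //.
by apply/funext => x; apply: f0 => /K0.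
Qed.

Hypothesis oW : open W.
Variables (chi : R -> R) (hchi : cutoff chi).

(** On a fine enough mesh each cell meeting the support of f lies in some O_i. Grouping the cells by
    the chosen index writes f as a finite sum of functions between 0 and 1, each supported in its
    own O_i. *)
Lemma riesz_open_bigcup (O : nat -> set (Cn R N)) :
  (forall i, open (O i)) -> (forall i, O i `<=` W) ->
  (riesz_open (\bigcup_i O i) <= \sum_(i <oo) riesz_open (O i))%E.
Proof.
move=> oO OW; apply: ge_ereal_sup => _ [f [tf f01] <-].
have [sf [K [cK KO f0]]] := tf.
have [q _ hq] : \forall q \near \oo, forall a, cell q a `&` K !=set0 ->
    exists2 U, range O U & cell q a `<=` U.
  apply: small_cells => // x Kx; have [i _ Oix] := KO x Kx.
  by exists (O i); split => //; exists i.
have [s [sK s1 sE]] := cell_partition hchi q cK.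
have ci a : exists i, a \in s -> cell q a `<=` O i.
  have [as_|] := boolP (a \in s); last by exists 0%N.
  by have [_ [i _ <-] h] := hq q (leqnn q) a (sK a as_); exists i => _.
have {ci}[i hi] := choice ci.
pose m := \max_(a <- s) i a; pose n := m.+1.
have i_lt a : a \in s -> (i a < n)%N.
  by move=> as_; rewrite ltnS; exact: leq_bigmax_seq.
pose F (k : 'I_n) x := \sum_(a <- s | inord (i a) == k) f x * cell_bump chi q a x.
have tF (k : 'I_n) : subunit (O k) (F k).
  split.
    rewrite /F; under eq_fun do rewrite -big_filter.
    apply: real_test_sum => a; rewrite mem_filter => /andP[/eqP iak as_].
    have [sfm _] := real_test_mul (smooth_cell_bump hchi q a) tf.
    split => //; have [_ [K' [cK' K'a b0]]] := real_test_cell_bump hchi (hi a as_).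
    exists K'; rewrite -iak inordK ?i_lt //; split => // x /b0 ->.
    by rewrite mulr0.
  move=> x; have /andP[fx0 fx1] := f01 x; apply/andP; split.
    by apply: sumr_ge0 => a _; rewrite mulr_ge0 // cell_bump_ge0.
  rewrite /F -mulr_sumr -[leRHS]mulr1 ler_pM //.
    by apply: sumr_ge0 => a _; exact: cell_bump_ge0.
  apply: le_trans (s1 x); rewrite [leRHS](bigID (fun a => inord (i a) == k)) /= lerDl.
  by apply: sumr_ge0 => a _; exact: cell_bump_ge0.
have fE : f = fun x => \sum_(k <- index_enum 'I_n) F k x.
  apply/funext => x; rewrite /F.
  transitivity (\sum_(a <- s) f x * cell_bump chi q a x).
    rewrite -mulr_sumr; have [Kx|/f0 ->] := pselect (K x); last by rewrite mul0r.
    by rewrite sE // mulr1.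
  by rewrite (partition_big (fun a => inord (i a) : 'I_n) xpredT).
rewrite fE pos_fun_sum; last first.
  by move=> k _; apply: real_test_sub (OW k) _; have [] := tF k.
apply: (@le_trans _ _ (\sum_(k < n) riesz_open (O k))%E).
  by rewrite -sumEFin; apply: lee_sum => k _; exact: riesz_open_ge.
rewrite -(big_mkord xpredT (fun k => riesz_open (O k))).
by apply: nneseries_lim_ge => k _ _; exact: riesz_open_ge0.
Qed.

End PositiveFunctional.

Section RieszMeasure.
Variables (R : realType) (N : nat) (W : set (Cn R N)) (L : (Cn R N -> R) -> R).
Hypothesis hL : positive_functional W L.
Hypothesis oW : open W.
Variables (chi : R -> R) (hchi : cutoff chi).
Local Notation outer := (riesz_outer W L).

Lemma riesz_sigma_subadditive : sigma_subadditive outer.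
Proof.
move=> F; apply/lee_addgt0Pr => e e0.
have hG i : exists G, admissible W (F i) G /\
    (riesz_open L G <= outer (F i) + (e / (2 ^ i.+1)%:R)%:E)%E.
  have ei : 0 < e / (2 ^ i.+1)%:R by rewrite divr_gt0 // ltr0n expn_gt0.
  have [ff|nf] := boolP (outer (F i) \is a fin_num).
    have [_ [G aG <-] hG] := lb_ereal_inf_adherent ei ff.
    by exists G; split => //; exact: ltW.
  (* If the outer measure of F i is infinite, any admissible set will do. *)
  exists W; split; first by split => // x [].
  move: nf; rewrite ge0_fin_numE ?riesz_outer_ge0 // -leNgt leye_eq => /eqP ->.
  by rewrite addye // leey.
have {hG}[G hG] := choice hG.
apply: (@le_trans _ _ (riesz_open L (\bigcup_i G i))).
  apply: riesz_outer_le; split.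
  - by apply: bigcup_open => i _; have [[]] := hG i.
  - by move=> x [i _]; have [[_ + _] _] := hG i; exact.
  - by move=> x [[i _ Fx] Wx]; exists i => //; have [[_ _ +] _] := hG i; apply.
apply: (le_trans (riesz_open_bigcup hL hchi _ _)).
- by move=> i; have [[]] := hG i.
- by move=> i; have [[]] := hG i.
apply: (@le_trans _ _ (\sum_(0 <= i <oo) (outer (F i) + (e / (2 ^ i.+1)%:R)%:E))%E).
  apply: lee_nneseries => i *; first exact: (riesz_open_ge0 hL).
  by have [] := hG i.
by apply: epsilon_trick; [move=> i; exact: (riesz_outer_ge0 hL)|exact: ltW].
Qed.

Definition riesz_outer_measure : {outer_measure set (Cn R N) -> \bar R} :=
  outer_measure_of_axioms (riesz_outer0 hL) (riesz_outer_ge0 hL)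
    (@le_riesz_outer _ _ W L) riesz_sigma_subadditive.

(** For an open A covering X, let f be supported in a compact K inside A and G. The open set A minus
    K contains A minus G, and if g is supported in it, then f + g is still at most 1, because the
    supports are disjoint. Taking suprema over g, then over f, gives the inequality. *)
Lemma riesz_open_caratheodory (G : set (Cn R N)) : open G ->
  caratheodory_measurable outer G.
Proof.
move=> oG; apply: (@le_caratheodory_measurable _ _ riesz_outer_measure) => X.
rewrite -[(riesz_outer_measure : set _ -> _)]/outer.
apply: le_ereal_inf_tmp => _ [A [oA AW XA] <-].
apply: (@le_trans _ _ (riesz_open L (A `&` G) + outer (A `\` G))%E).
  apply: leeD.
    apply: riesz_outer_le; split; first exact: openI.
      by move=> x [/AW].
    by move=> x [[Xx Gx] Wx]; split => //; apply: XA.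
  (* The outer measure only sees the part of a set inside [W]. *)
  have -> : outer (X `&` ~` G) = outer ((X `&` W) `\` G).
    rewrite /riesz_outer; congr (ereal_inf (_ @` _)).
    apply/seteqP; split=> B [oB BW h]; split => // x [].
      by move=> [[Xx Wx] Gx] _; apply: h.
    by move=> [Xx Gx] Wx; apply: h.
  by apply: le_riesz_outer => x [/XA Ax Gx].
apply: ereal_supD_le.
- exact: (riesz_open_has0 hL).
- exact: (riesz_outer_ge0 hL).
move=> _ [f [tf f01] <-]; have [sf [K [cK KAG f0]]] := tf.
have cK' : closed K by have [] := compact_CnE cK.
apply: (@le_trans _ _ ((L f)%:E + riesz_open L (A `\` K))%E).
  apply: leeD => //; apply: riesz_outer_le; split.
  - by rewrite setDE; apply: openI => //; exact: closed_openC.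
  - by move=> x [/AW].
  - by move=> x [[Ax Gx] _]; split => // /KAG [].
rewrite addeC; apply: ereal_supD_le.
- exact: (riesz_open_has0 hL).
- rewrite lee_fin; apply: (pos_fun_ge0 hL).
    by apply: real_test_sub tf => x [/AW].
  by move=> x; have /andP[] := f01 x.
move=> _ [g [tg g01] <-]; rewrite -EFinD -(pos_funD hL) //; last 2 first.
- by apply: real_test_sub tg => x [/AW].
- by apply: real_test_sub tf => x [/AW].
apply: riesz_open_ge; split.
  apply: real_testD; first by apply: real_test_sub tg => x [].
  by apply: real_test_sub tf => x [].
move=> x; have [_ [K' [_ K'A g0]]] := tg.
have [Kx|/f0 ->] := pselect (K x); last by rewrite addr0.
by rewrite g0 ?add0r // => /K'A [].
Qed.

Lemma borel_caratheodory (A : set (borelCn R N)) : measurable A ->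
  caratheodory_measurable outer A.
Proof.
apply: smallest_sub; last by move=> B; exact: riesz_open_caratheodory.
split.
- exact: (caratheodory_measurable_set0 riesz_outer_measure).
- move=> B; rewrite setTD; exact: (@caratheodory_measurable_setC _ _ riesz_outer_measure).
- exact: (@caratheodory_measurable_bigcup _ _ riesz_outer_measure).
Qed.

Lemma riesz_semi_sigma_additive :
  semi_sigma_additive (outer : set (borelCn R N) -> \bar R).
Proof.
move=> A mA tA mUA.
apply: (@caratheodory_measure_sigma_additive _ _ riesz_outer_measure) => //.
  by move=> i; exact: borel_caratheodory.
exact: borel_caratheodory.
Qed.

Definition riesz_measure : {measure set (borelCn R N) -> \bar R} :=
  @measure_of_axioms _ (borelCn R N) R outer (riesz_outer0 hL) (riesz_outer_ge0 hL)
    riesz_semi_sigma_additive.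

Lemma riesz_measureE A : riesz_measure A = outer A. Proof. by []. Qed.

Lemma riesz_measure_open G : open G -> G `<=` W -> riesz_measure G = riesz_open L G.
Proof. by move=> oG GW; rewrite riesz_measureE riesz_outer_open. Qed.

Lemma riesz_open_le G f : real_test W f -> (forall x, 0 <= f x) ->
  G `<=` W -> (forall x, G x -> 1 <= f x) -> (riesz_open L G <= (L f)%:E)%E.
Proof.
move=> tf f0 GW f1; apply: ge_ereal_sup => _ [g [tg g01] <-]; rewrite lee_fin.
apply: (pos_fun_le hL) => //; first exact: real_test_sub tg.
move=> x; have [gx0|gx] := eqVneq (g x) 0; first by rewrite gx0.
have /andP[_ g1] := g01 x; apply: (le_trans g1); apply: f1.
have [_ [K [_ KG g0]]] := tg; apply: KG; apply: contrapT => /g0 h.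
by rewrite h eqxx in gx.
Qed.

(** For a cutoff g equal to 1 on [K], the open set {g > 1/2} contains [K] and 2 g >= 1 on it, so its
    mass is at most L (2 g). *)
Lemma riesz_measure_compact (K : set (Cn R N)) : compact K -> K `<=` W ->
  (riesz_measure K < +oo)%E.
Proof.
move=> cK KW; have [g [tg g01 gK]] := smooth_cutoff hchi cK oW KW.
have cg := real_test_continuous tg.
pose G := [set x | 2^-1 < g x].
have oG : open G by apply: (open_comp (fun y _ => cg y) (@open_gt R _)).
have GW : G `<=` W.
  move=> x; rewrite /G /= => gx; have [_ [K' [_ K'W g0]]] := tg.
  apply: K'W; apply: contrapT => /g0 h.
  by move: gx; rewrite h ltNge invr_ge0 ler0n.
apply: (@le_lt_trans _ _ (L (fun x => 2 * g x))%:E); last by rewrite ltry.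
apply: (@le_trans _ _ (riesz_open L G)).
  rewrite -riesz_measure_open //; apply: le_riesz_outer => x Kx.
  by rewrite /G /= gK // invf_lt1 // ltr1n.
apply: riesz_open_le => //; first exact: real_testZ.
  by move=> x; have /andP[? _] := g01 x; rewrite mulr_ge0.
by move=> x; rewrite /G /= => gx; lra.
Qed.

End RieszMeasure.

Lemma real_test_bounded (R : realType) N (W : set (Cn R N)) f : real_test W f ->
  exists2 B : R, 0 <= B & forall x, `|f x| <= B.
Proof.
move=> tf; have cf := real_test_continuous tf; have [_ [K [cK KW f0]]] := tf.
have cn : continuous (fun x => `|f x|).
  by move=> x; apply: (@continuous_comp _ _ _ f (@Num.norm R R) x (cf x)); exact: norm_continuous.
move/compact_near_coveringP : cK => /(_ R (pinfty_nbhs R) (fun B x => `|f x| <= B)).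
case.
  move=> x Kx; exists ([set y | `|f y| < `|f x| + 1], [set B | `|f x| + 1 < B]).
    split; last by exists (`|f x| + 1); rewrite num_real.
    by apply: (@cn x [set r | r < `|f x| + 1]); apply: near_lt; rewrite ltrDl.
  by move=> [y B] /= [/ltW h1 /ltW h2]; exact: le_trans h2.
move=> M [_ h]; exists (`|M| + 1) => [|x]; first by rewrite addr_ge0.
have [Kx|/f0 ->] := pselect (K x); last by rewrite normr0 addr_ge0.
by apply: h => //; rewrite (le_lt_trans (ler_norm M)) // ltrDl.
Qed.

(** * A positive functional is determined by the masses of open sets *)

Section Layers.
Variables (R : realType) (chi : R -> R) (hchi : cutoff chi).
Implicit Types (t u e : R).

Lemma chi_lipschitz u v : u <= v -> 0 <= chi v - chi u <= v - u.
Proof.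
rewrite le_eqVlt => /predU1P[->|uv]; first by rewrite !subrr lexx.
rewrite subr_ge0 (cutoff_incr hchi (ltW uv)) /=.
have /andP[_ h] := chi1_slope hchi uv.
have := le_trans h (chi1_le1 hchi v).
by rewrite ler_pdivrMr ?subr_gt0 // mul1r.
Qed.

(* [ramp e i - ramp e i.+1] is a smoothing of the layer min (max (t - i e) 0) e,
   constant outside [(i + 1/4) e, (i + 7/4) e]. *)
Definition ramp e (i : nat) t := e / 4 * chi (4 / e * t - (4 * i%:R + 2)).

Lemma ramp_left e i t : 0 < e -> t <= i%:R * e -> ramp e i t = 0.
Proof.
move=> e0 h; rewrite /ramp (cutoff_left hchi) ?mulr0 //.
have : 4 / e * t <= 4 * i%:R.
  by rewrite mulrAC ler_pdivrMr // -mulrA ler_wpM2l.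
by lra.
Qed.

Lemma layer_bounds e i t : 0 < e -> 0 <= ramp e i t - ramp e i.+1 t <= e.
Proof.
move=> e0; rewrite -mulrBr; set u := 4 / e * t - (4 * i%:R + 2).
have -> : 4 / e * t - (4 * i.+1%:R + 2) = u - 4 by rewrite /u -natr1; lra.
have /andP[h1 h2] : 0 <= chi u - chi (u - 4) <= u - (u - 4).
  by apply: chi_lipschitz; lra.
rewrite mulr_ge0 ?divr_ge0 ?(ltW e0) //=.
have e4 : 0 <= e / 4 by rewrite divr_ge0 // ltW.
have h3 : chi u - chi (u - 4) <= 4 by lra.
have := ler_wpM2l e4 h3; rewrite divfK // pnatr_eq0 //.
Qed.

Lemma layer_full e i t : 0 < e -> i.+2%:R * e < t -> ramp e i t - ramp e i.+1 t = e.
Proof.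
move=> e0 h; rewrite -mulrBr; set u := 4 / e * t - (4 * i%:R + 2).
have -> : 4 / e * t - (4 * i.+1%:R + 2) = u - 4 by rewrite /u -natr1; lra.
have : 4 * i.+2%:R < 4 / e * t.
  by rewrite mulrAC ltr_pdivlMr // -mulrA ltr_pM2l.
have -> : i.+2%:R = i%:R + 2 :> R by rewrite -addn2 natrD.
move=> h'; have u4 : 1 <= u - 4 by rewrite /u; lra.
have u1 : 1 <= u by lra.
rewrite (cutoff_right hchi u1) (cutoff_right hchi u4) subKr.
by rewrite divfK // pnatr_eq0.
Qed.

Lemma layer_empty e i t : 0 < e -> t <= (i%:R + 4^-1) * e ->
  ramp e i t - ramp e i.+1 t = 0.
Proof.
move=> e0 h.
have h' : 4 / e * t <= 4 * i%:R + 1.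
  rewrite mulrAC ler_pdivrMr //; have := ler_wpM2l (ler0n R 4) h.
  by rewrite mulrA mulrDr mulfV.
rewrite /ramp !(cutoff_left hchi) ?mulr0 ?subrr //; last by lra.
by rewrite -natr1; lra.
Qed.

Lemma ramp0_approx e t : 0 < e -> 0 <= t -> `|t - ramp e 0 t| <= e.
Proof.
move=> e0 t0; rewrite /ramp; set u := 4 / e * t - _.
have tE : t = e / 4 * (u + 2).
  by rewrite /u; field; rewrite gt_eqF.
have e4 : 0 <= e / 4 by lra.
have key : 0 <= u + 2 - chi u <= 4.
  have [u1|u1] := leP u (-1).
    have u2 : -2 <= u.
      by rewrite /u; have : 0 <= 4 / e * t; [rewrite mulr_ge0 ?divr_ge0 ?(ltW e0)|lra].
    by rewrite (cutoff_left hchi) //; lra.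
  have [u2|u2] := leP 1 u; first by rewrite (cutoff_right hchi) //; lra.
  have := chi_lipschitz (ltW u1); rewrite (cutoff_left hchi (lexx _)).
  by lra.
rewrite {1}tE -mulrBr ger0_norm; last by case/andP: key => *; rewrite mulr_ge0.
case/andP: key => _ k4.
by have := ler_wpM2l e4 k4; rewrite divfK // pnatr_eq0.
Qed.

Lemma smooth_ramp N (f : Cn R N -> R) e i : smooth_real f ->
  smooth_real (fun x => ramp e i (f x)).
Proof.
move=> sf; apply: smooth_realM; first exact: smooth_real_cst.
have su : smooth_real (fun x => 4 / e * f x - (4 * i%:R + 2)).
  apply: smooth_realD; last exact: smooth_real_cst.
  by apply: smooth_realM => //; exact: smooth_real_cst.
exact: (smooth_real_comp (fun k t => chi_is_derive hchi k t) su).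
Qed.

Variables (N : nat) (W : set (Cn R N)) (oW : open W).
Variables (L J : (Cn R N -> R) -> R) (m : set (Cn R N) -> R).
Hypothesis hL : positive_functional W L.
Hypothesis hJ : positive_functional W J.
Let relcompact G := [/\ open G, G `<=` W &
  exists K : set (Cn R N), [/\ compact K, K `<=` W & G `<=` K]].
(** [m G] behaves like the measure of G for [F]: it lies above F of the functions below the
    indicator of G and below F of those above it. *)
Let compatible (F : (Cn R N -> R) -> R) := forall G, relcompact G ->
  (forall h, subunit G h -> F h <= m G) /\
  (forall s, real_test W s -> (forall x, 0 <= s x) -> (forall x, G x -> 1 <= s x) ->
     m G <= F s).
Hypothesis cL : compatible L.
Hypothesis cJ : compatible J.

(** A smooth layer-cake argument. Up to e, f is a sum of layers lying between e times the indicators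
    of G_(i+2) and of G_i, with G_i = {f > i e}. The values of both functionals at a layer lie in
    the same interval, and the lengths of these intervals telescope to at most 2 e L g; replacing f
    by the sum of layers costs e L g and e J g. *)
Lemma positive_functional_layers f e : real_test W f -> (forall x, 0 <= f x) -> 0 < e ->
  forall g, real_test W g -> (forall x, 0 <= g x <= 1) ->
   (forall x, f x != 0 -> g x = 1) ->
  `|L f - J f| <= e * (3 * L g + J g).
Proof.
move=> tf f0 e0 g tg g01 gf.
have [sf [K [cK KW fK]]] := tf; have cf := real_test_continuous tf.
have [B B0 hB] := real_test_bounded tf.
have [n hn] : exists n : nat, B <= n%:R * e.
  exists (Num.bound (B / e)); rewrite -ler_pdivrMr // ltW // archi_boundP //.
  by rewrite divr_ge0 // ltW.
pose s i x := ramp e i (f x) - ramp e i.+1 (f x).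
pose G i := [set x | i%:R * e < f x].
have oG i : open (G i) by apply: (open_comp (fun y _ => cf y) (@open_gt R _)).
have GK i : G i `<=` K.
  move=> x; rewrite /G /= => gx; apply: contrapT => /fK fx.
  by move: gx; rewrite fx ltNge mulr_ge0 // ltW.
have rG i : relcompact (G i).
  by split => //; [move=> x /GK /KW|exists K].
have ss i : smooth_real (s i).
  have h := smooth_realD (smooth_ramp e i sf)
    (smooth_realM (smooth_real_cst (-1)) (smooth_ramp e i.+1 sf)).
  apply: (smooth_eq openT _ h) => x _; congr toC.
  by rewrite mulN1r.
have sG i : supported_in (G i) (s i).
  exists (K `&` [set x | (i%:R + 4^-1) * e <= f x]); split.
  - apply: compact_closedI => //.
    exact: (closed_comp (fun y _ => cf y) (@closed_ge R _)).
  - move=> x [_ /=]; rewrite /G /=; apply: lt_le_trans.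
    by rewrite ltr_pM2r // ltrDl.
  - move=> x /not_andP[/fK fx|/negP]; rewrite /s.
      have i0 : 0 <= i%:R + 4^-1 :> R by rewrite addr_ge0 ?invr_ge0 ?ler0n.
      by apply: (layer_empty e0); rewrite fx mulr_ge0 // ltW.
    by rewrite -ltNge => /ltW; exact: layer_empty.
have tsG i : real_test (G i) (s i) by exact: (conj (ss i) (sG i)).
have ts i : real_test W (s i) by apply: (real_test_sub _ (tsG i)) => x /GK /KW.
have en : e != 0 by rewrite gt_eqF.
(* Divided by e, the layer is a subunit function for G_i, and it equals 1 on G_(i+2). *)
have bounds F : positive_functional W F -> compatible F -> forall i,
    e * m (G i.+2) <= F (s i) <= e * m (G i).
  move=> hF cF i.
  have te : real_test (G i) (fun x => e^-1 * s i x) by exact: real_testZ.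
  have te' : real_test W (fun x => e^-1 * s i x) by exact: real_testZ.
  have FE : F (s i) = e * F (fun x => e^-1 * s i x).
    by rewrite (pos_funZ hF) // mulrA mulfV // mul1r.
  rewrite FE !ler_pM2l //; have [lo _] := cF _ (rG i); have [_ up] := cF _ (rG i.+2).
  apply/andP; split.
    apply: up => //.
      by move=> x; have /andP[h _] := layer_bounds i (f x) e0; apply: mulr_ge0 => //; rewrite invr_ge0 ltW.
    by move=> x Gx; rewrite /s layer_full // mulVf.
  apply: lo; split => // x; have /andP[h1 h2] := layer_bounds i (f x) e0.
  by rewrite mulr_ge0 ?invr_ge0 ?(ltW e0) //= mulrC ler_pdivrMr // mul1r.
have mg i : 0 <= m (G i) <= L g.
  have [lo up] := cL (rG i); apply/andP; split.
    by rewrite -(pos_fun0 hL); apply: lo; exact: subunit0.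
  apply: up => //; first by move=> x; have /andP[] := g01 x.
  move=> x /= Gx; rewrite gf //; apply: lt0r_neq0.
  by apply: le_lt_trans Gx; rewrite mulr_ge0 // ltW.
have sumE (F : (Cn R N -> R) -> R) : positive_functional W F ->
    F (fun x => ramp e 0 (f x)) = \sum_(i < n) F (s i).
  move=> hF; rewrite -(pos_fun_sum hF (F := fun i : 'I_n => s i)) //; congr F.
  apply/funext => x; rewrite /s.
  have -> : \sum_(i < n) (ramp e i (f x) - ramp e i.+1 (f x)) =
      ramp e 0 (f x) - ramp e n (f x).
    elim: (n) => [|k ih]; first by rewrite big_ord0 subrr.
    by rewrite big_ord_recr ih /= addrA subrK.
  rewrite (ramp_left (i := n)) ?subr0 //.
  by apply: le_trans hn; exact: le_trans (ler_norm _) (hB x).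
have tr : real_test W (fun x => ramp e 0 (f x)).
  split; first exact: smooth_ramp.
  exists K; split => // x /fK fx; apply: ramp_left => //.
  by rewrite fx mul0r.
have approx F : positive_functional W F -> `|F f - F (fun x => ramp e 0 (f x))| <= e * F g.
  move=> hF; rewrite -(pos_funB hF) // -(pos_funZ hF) //; apply: (pos_fun_norm hF).
  - exact: real_testB.
  - exact: real_testZ.
  move=> x; have [fx|fx] := eqVneq (f x) 0.
    rewrite fx ramp_left ?mul0r // subr0 normr0 mulr_ge0 ?(ltW e0) //.
    by have /andP[] := g01 x.
  by rewrite gf // mulr1; exact: ramp0_approx.
have diff : `|L (fun x => ramp e 0 (f x)) - J (fun x => ramp e 0 (f x))| <= e * (2 * L g).
  rewrite !sumE // -sumrB (le_trans (ler_norm_sum _ _ _)) //.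
  apply: (@le_trans _ _ (\sum_(i < n) e * (m (G i) - m (G i.+2)))).
    apply: ler_sum => i _; rewrite ler_norml.
    have /andP[a1 a2] := bounds L hL cL i; have /andP[b1 b2] := bounds J hJ cJ i.
    by rewrite mulrBr; apply/andP; split; lra.
  rewrite -mulr_sumr ler_pM2l //.
  (* The step of two between the bounds of a layer leaves two terms at each end. *)
  have -> : \sum_(i < n) (m (G i) - m (G i.+2)) =
      m (G 0%N) + m (G 1%N) - m (G n) - m (G n.+1).
    elim: (n) => [|k ih]; first by rewrite big_ord0; lra.
    by rewrite big_ord_recr ih /=; lra.
  have /andP[a1 a2] := mg 0%N; have /andP[b1 b2] := mg 1%N.
  have /andP[d1 d2] := mg n; have /andP[e1 e2] := mg n.+1.
  by lra.
have aL := approx L hL; have aJ := approx J hJ.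
move: aL aJ diff; set a := L _; set b := J f.
set a' := L _; set b' := J _ => h1 h2 h3.
have -> : a - b = (a - a') + (a' - b') - (b - b') by ring.
rewrite (le_trans (ler_normB _ _)) // (le_trans (lerD (ler_normD _ _) h2)) //.
by rewrite (le_trans (lerD (lerD h1 h3) (lexx _))) // -!mulrDr; apply: ler_wpM2l; lra.
Qed.

(** A signed f is the difference of f + B g and B g, both nonnegative, where g = 1 on the support of
    f and B bounds |f|. *)
Lemma positive_functional_unique f : real_test W f -> L f = J f.
Proof.
have pos h : real_test W h -> (forall x, 0 <= h x) -> L h = J h.
  move=> th h0; have [_ [K [cK KW hK]]] := th.
  have [g [tg g01 gK]] := smooth_cutoff hchi cK oW KW.
  have gh x : h x != 0 -> g x = 1.
    move=> hx; apply: gK; apply: contrapT => /hK h'; by rewrite h' eqxx in hx.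
  apply/eqP; rewrite -subr_eq0 -normr_le0; apply/ler_addgt0Pl => e e0.
  rewrite addr0; pose c := 3 * L g + J g.
  have g0 x : 0 <= g x by have /andP[] := g01 x.
  have c0 : 0 <= c by rewrite addr_ge0 ?mulr_ge0 ?(pos_fun_ge0 hL tg g0) ?(pos_fun_ge0 hJ tg g0).
  have e1 : 0 < e / (c + 1) by rewrite divr_gt0 // ltr_wpDl.
  apply: (le_trans (positive_functional_layers th h0 e1 tg g01 gh)).
  rewrite -/c mulrAC ler_pdivrMr ?ltr_wpDl // ler_pM2l //.
  by rewrite lerDl.
move=> tf; have [B B0 hB] := real_test_bounded tf.
have [_ [K [cK KW fK]]] := tf.
have [g [tg g01 gK]] := smooth_cutoff hchi cK oW KW.
have tBg := real_testZ B tg.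
have tp : real_test W (fun x => f x + B * g x) by exact: real_testD.
have E F : positive_functional W F -> F f = F (fun x => f x + B * g x) - F (fun x => B * g x).
  by move=> hF; rewrite (pos_funD hF) // addrK.
rewrite !E // !pos // => x; first by have /andP[h _] := g01 x; rewrite mulr_ge0.
have [Kx|/fK fx] := pselect (K x).
  by rewrite gK // mulr1; have := hB x; rewrite ler_norml => /andP[]; lra.
by rewrite fx add0r; have /andP[h _] := g01 x; rewrite mulr_ge0.
Qed.

End Layers.

(** * Integration of test functions against locally finite Borel measures *)

Section BorelIntegral.
Variables (R : realType) (N : nat).
Local Notation CN := (Cn R N).
Implicit Types (W : set CN) (f : CN -> R).

Lemma borel_open W : open W -> measurable (W : set (borelCn R N)).
Proof. by move=> oW; exact: sub_sigma_algebra. Qed.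

Lemma borel_closed W : closed W -> measurable (W : set (borelCn R N)).
Proof. by move=> cW; rewrite -(setCK W); apply: measurableC; apply: borel_open; exact: closed_openC. Qed.

Lemma borel_compact W : compact W -> measurable (W : set (borelCn R N)).
Proof. by move=> /compact_CnE[cW _]; exact: borel_closed. Qed.

Lemma borel_continuous W f : open W -> continuous f ->
  measurable_fun (W : set (borelCn R N)) (f : borelCn R N -> R).
Proof.
move=> oW cf; refine (@measurability _ _ (borelCn R N) _ W f _ (RGenOInfty.measurableE R) _).
move=> _ [_ [a ->] <-]; apply: borel_open; apply: openI => //.
apply: (open_comp (fun y _ => cf y)).
by rewrite set_itvE; exact: open_gt.
Qed.

Section LocallyFinite.
Variables (mu : {measure set (borelCn R N) -> \bar R}) (W : set CN) (oW : open W).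
Hypothesis mfin : forall K : set CN, compact K -> K `<=` W -> (mu K < +oo)%E.

Lemma integrable_indic_finite (A : set CN) : measurable (A : set (borelCn R N)) ->
  (mu A < +oo)%E ->
  mu.-integrable (W : set (borelCn R N)) (fun x : borelCn R N => (\1_A x)%:E).
Proof.
move=> mA fA; have mW := borel_open oW; apply/integrableP; split.
  exact/measurable_EFinP/measurable_indic.
rewrite (eq_integral (fun x : borelCn R N => (\1_A x)%:E)); last first.
  by move=> x _; rewrite gee0_abs // lee_fin.
rewrite integral_indic //; apply: (le_lt_trans _ fA).
by apply: le_measure; rewrite ?inE //; exact: measurableI.
Qed.

Lemma real_test_integrable f : real_test W f ->
  mu.-integrable (W : set (borelCn R N)) (EFin \o f).
Proof.
move=> tf; have [B B0 hB] := real_test_bounded tf.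
have [_ [K [cK KW f0]]] := tf.
have mK := borel_compact cK.
have iK := integrable_indic_finite mK (mfin cK KW).
have mW := borel_open oW.
apply: (le_integrable mW _ _ (integrableZl mW B iK)).
  apply/measurable_EFinP; apply: borel_continuous => //.
  exact: (real_test_continuous tf).
move=> x _ /=; rewrite lee_fin (ger0_norm (mulr_ge0 B0 _)) // indicE.
have [Kx|nKx] := pselect (K x); first by rewrite mem_set // mulr1.
by rewrite memNset // mulr0 f0 // normr0.
Qed.

Lemma Rintegral_positive_functional :
  positive_functional W (fun f => Rintegral mu (W : set (borelCn R N)) f).
Proof.
have mW := borel_open oW.
split=> [c f g tf tg|f tf f0].
  have ig := real_test_integrable tg.
  rewrite (RintegralD mW (real_test_integrable (real_testZ c tf)) ig).
  by rewrite (RintegralZl c mW (real_test_integrable tf)).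
by apply: Rintegral_ge0 => x _; exact: f0.
Qed.

Lemma Rintegral_indic_finite (A : set CN) : measurable (A : set (borelCn R N)) ->
  A `<=` W -> Rintegral mu (W : set (borelCn R N)) (\1_A) = fine (mu A).
Proof.
move=> mA AW; have mW := borel_open oW.
by rewrite /Rintegral integral_indic // setIidl.
Qed.

Lemma Rintegral_le_measure (G : set CN) f : open G -> G `<=` W -> (mu G < +oo)%E ->
  subunit G f -> Rintegral mu (W : set (borelCn R N)) f <= fine (mu G).
Proof.
move=> oG GW fG [tf f01]; have mG := borel_open oG; have mW := borel_open oW.
rewrite -(Rintegral_indic_finite mG GW); apply: (le_Rintegral mW).
- exact: real_test_integrable (real_test_sub GW tf).
- exact: integrable_indic_finite.
move=> x _; cbn beta; have /andP[_ f1] := f01 x.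
have [Gx|nGx] := pselect (G x); first by rewrite mem_set.
rewrite memNset //; have [_ [K [_ KG f0]]] := tf.
by rewrite f0 // => /KG.
Qed.

Lemma measure_le_Rintegral (G : set CN) f : open G -> G `<=` W -> (mu G < +oo)%E ->
  real_test W f -> (forall x, 0 <= f x) -> (forall x, G x -> 1 <= f x) ->
  fine (mu G) <= Rintegral mu (W : set (borelCn R N)) f.
Proof.
move=> oG GW fG tf f0 f1; have mG := borel_open oG; have mW := borel_open oW.
rewrite -(Rintegral_indic_finite mG GW); apply: (le_Rintegral mW).
- exact: integrable_indic_finite.
- exact: real_test_integrable.
move=> x _; cbn beta.
have [Gx|nGx] := pselect (G x); first by rewrite mem_set //; exact: f1.
by rewrite memNset.
Qed.

End LocallyFinite.

Variables (W : set CN) (L : (CN -> R) -> R).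
Hypothesis hL : positive_functional W L.
Hypothesis oW : open W.
Variables (chi : R -> R) (hchi : cutoff chi).
Local Notation mu := (riesz_measure hL oW hchi).

(** Integration against the Riesz measure is itself a positive functional. It and [L] are both
    compatible with the measure of relatively compact open sets, so they agree by uniqueness. *)
Lemma riesz_representation f : real_test W f ->
  L f = Rintegral mu (W : set (borelCn R N)) f.
Proof.
have mfin := riesz_measure_compact hL oW hchi.
have fin G : open G -> G `<=` W -> (exists K : set CN, [/\ compact K, K `<=` W & G `<=` K]) ->
    (mu G < +oo)%E.
  move=> oG GW [K [cK KW GK]]; apply: (le_lt_trans _ (mfin _ cK KW)).
  by apply: le_measure => //; rewrite inE; [exact: borel_open|exact: borel_compact].
apply: (positive_functional_unique hchi oW hL (Rintegral_positive_functional oW mfin)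
  (m := fun G => fine (mu G))) => G [oG GW GK]; have fG := fin G oG GW GK.
  have fG' : mu G \is a fin_num by rewrite ge0_fin_numE.
  split=> [h hG|s ts s0 s1]; rewrite -lee_fin fineK //.
    by rewrite riesz_measure_open //; exact: riesz_open_ge.
  by rewrite riesz_measure_open //; exact: (riesz_open_le hL ts s0 GW s1).
split=> [h hG|s ts s0 s1]; last first.
  exact: (measure_le_Rintegral oW mfin oG GW fG ts s0 s1).
exact: (Rintegral_le_measure oW mfin oG GW fG hG).
Qed.

End BorelIntegral.

(** * Diagonal subsequences *)

Lemma subsequence_ge (f : nat -> nat) : {homo f : i j / (i < j)%N} -> forall k, (k <= f k)%N.
Proof. by move=> fi; elim=> // k ih; exact: leq_ltn_trans ih (fi _ _ (ltnSn k)). Qed.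

Lemma cvg_nat_ge (f : nat -> nat) : (forall k, (k <= f k)%N) -> f @ \oo --> \oo.
Proof.
by move=> fk A [n _ nA]; exists n => // k /= nk; apply: nA; exact: leq_trans (fk k).
Qed.

(** The conclusion [k <= f k] is the form in which subsequences are used: it makes f tend to
    infinity, hence preserves limits. *)
Lemma diagonal_subsequence (R : realType) (u : nat -> nat -> R) :
  (forall i, exists B, forall k, `|u i k| <= B) ->
  exists2 f : nat -> nat, forall k, (k <= f k)%N & forall i, cvgn (fun k => u i (f k)).
Proof.
move=> ub.
have step (g : nat -> nat) i : exists f : nat -> nat,
    {homo f : a b / (a < b)%N} /\ cvgn (fun k => u i (g (f k))).
  have [B hB] := ub i.
  have bu : bounded_fun (fun k => u i (g k)).
    by exists B; split; [rewrite num_real|move=> M BM k _; exact: le_trans (hB _) (ltW BM)].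
  have [f fi fc] := bolzano_weierstrass bu; exists f; split => // a b.
  by move=> ab; rewrite ltnNge -leEnat fi -ltnNge.
pose ext g i := projT1 (cid (step g i)).
have extP g i := projT2 (cid (step g i)).
(* [F i] composes the first i extractions, and makes the sequences of index below i converge. *)
pose F := fix F (i : nat) : nat -> nat := if i is i'.+1 then F i' \o ext (F i') i' else id.
have Fi i : {homo F i : a b / (a < b)%N}.
  by elim: i => [|i ih] a b ab //=; apply: ih; have [h _] := extP (F i) i; exact: h.
have Ftail i k : (i <= k)%N ->
    exists2 G : nat -> nat, {homo G : a b / (a < b)%N} & F k = F i \o G.
  elim: k => [|k ih]; first by rewrite leqn0 => /eqP ->; exists id.
  rewrite leq_eqVlt => /predU1P[->|/ih [G Gi FE]]; first by exists id.
  have [h _] := extP (F k) k.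
  exists (G \o ext (F k) k); first by move=> a b /h /Gi.
  by rewrite [LHS]/= [in LHS]FE compA -FE.
exists (fun k => F k k) => [k|i]; first exact: subsequence_ge.
(* From k = i + 1 on, the diagonal takes its values along [F i.+1], where u_i converges. *)
have tail k : exists j, (k <= j)%N /\ ((i.+1 <= k)%N -> F k k = F i.+1 j).
  have [ik|ik] := boolP (i.+1 <= k)%N; last by exists k; split => // /(negP ik).
  have [G Gi FE] := Ftail _ _ ik.
  by exists (G k); split => [|_]; [exact: subsequence_ge|rewrite FE].
have [h hh] := choice tail.
have [_ hc] := extP (F i) i.
have hc' := cvg_comp h _ (@cvg_nat_ge h (fun k => (hh k).1)) hc.
apply/cvg_ex; exists (limn (fun k => u i (F i (ext (F i) i k)))).
apply: cvg_trans hc'; apply: near_eq_cvg; exists i.+1 => // k /= ik.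
by have [_ ->] := hh k.
Qed.

Lemma cvg_seq_approx (R : realType) (u : nat -> R) (B : R) : 0 <= B ->
  (forall e, 0 < e -> exists2 v : nat -> R, cvgn v & forall k, `|u k - v k| <= e * B) ->
  cvgn u.
Proof.
move=> B0 h; apply/cauchy_cvgP/cauchy_exP => e e0.
have B1 : 0 < B + 1 by rewrite ltr_wpDl.
(* B + 1 instead of B, which may be 0. *)
have d0 : 0 < e / 2 / (B + 1) by rewrite !divr_gt0.
have [v cv uv] := h _ d0; exists (limn v).
have /(@cvgr_dist_lt _ _ _ _ _ _ (limn v)) := cv.
move=> /(_ (e / 2)); rewrite divr_gt0 // => /(_ isT).
apply: filterS => k hk; rewrite /ball /= (splitr e).
rewrite -(subrK (v k) (limn v)) -addrA (le_lt_trans (ler_normD _ _)) //.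
apply: ltr_leD => //; rewrite distrC (le_trans (uv k)) //.
rewrite mulrAC ler_pdivrMr // ler_pM2l ?divr_gt0 //.
by rewrite lerDl.
Qed.

Section ConvergentSubsequences.
Variables (R : realType) (N : nat) (W : set (Cn R N)) (oW : open W).
Variables (chi : R -> R) (hchi : cutoff chi).

(** The bumps of all cells form a countable family, so one diagonal extraction makes every [L i]
    converge on them. The approximation by bumps has error e g with L i k g bounded in k, which
    extends the convergence to all test functions. *)
Lemma functional_subsequence (I : countType) (L : I -> nat -> (Cn R N -> R) -> R) :
  (forall i k, positive_functional W (L i k)) ->
  (forall i f, real_test W f -> exists B, forall k, `|L i k f| <= B) ->
  exists2 s : nat -> nat, forall k, (k <= s k)%N &
    forall i f, real_test W f -> cvgn (fun k => L i (s k) f).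
Proof.
move=> hL hB.
(* Bumps of cells outside [W] are not test functions on [W], and no bound is known for them; they
   are replaced by 0. *)
pose v (j : I * nat * {ffun 'I_N * bool -> int}) k : R :=
  if `[< cell j.1.2 j.2 `<=` W >] then L j.1.1 k (cell_bump chi j.1.2 j.2) else 0.
pose u j k := if unpickle j is Some t then v t k else 0.
have ub j : exists B, forall k, `|u j k| <= B.
  rewrite /u; case: unpickle => [t|]; last by exists 0 => _; rewrite normr0.
  rewrite /v; case: asboolP => [h|_]; last by exists 0 => _; rewrite normr0.
  by have [B h'] := hB t.1.1 _ (real_test_cell_bump hchi h); exists B.
have [s sk sc] := diagonal_subsequence ub.
exists s => // i f tf.
have [g [tg g0] hg] := cell_approximation hchi oW tf.
have [B hBg] := hB i g tg.
have B0 : 0 <= B by exact: le_trans (normr_ge0 _) (hBg 0%N).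
apply: (cvg_seq_approx B0) => e e0.
have [q [l [c [lW approx]]]] := hg e e0.
have tc a : a \in l -> real_test W (fun x => c a * cell_bump chi q a x).
  by move=> al; apply: real_testZ; apply: real_test_cell_bump => //; exact: lW.
exists (fun k => \sum_(a <- l) c a * u (pickle (i, q, a)) (s k)).
  elim: (l) => [|a l' ih].
    by under eq_fun do rewrite big_nil; exact: is_cvg_cst.
  under eq_fun do rewrite big_cons.
  apply: is_cvgD => //; apply: is_cvgM; first exact: is_cvg_cst.
  exact: sc.
move=> k.
have -> : \sum_(a <- l) c a * u (pickle (i, q, a)) (s k) =
    L i (s k) (fun x => \sum_(a <- l) c a * cell_bump chi q a x).
  rewrite (pos_fun_sum (hL i (s k)) tc) big_seq [RHS]big_seq; apply: eq_bigr => a al.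
  rewrite (pos_funZ (hL i (s k))); last by apply: real_test_cell_bump => //; exact: lW.
  by rewrite /u pickleK /v /= asboolT //; exact: lW.
have ts := real_test_sum tc.
rewrite -(pos_funB (hL i (s k)) tf ts).
have := pos_fun_norm (hL i (s k)) (real_testB tf ts) (real_testZ e tg) approx.
rewrite (pos_funZ (hL i (s k))) // => h; apply: (le_trans h).
by rewrite ler_pM2l // (le_trans (ler_norm _)).
Qed.

Lemma limit_positive_functional (L : nat -> (Cn R N -> R) -> R) :
  (forall k, positive_functional W (L k)) ->
  (forall f, real_test W f -> cvgn (fun k => L k f)) ->
  positive_functional W (fun f => limn (fun k => L k f)).
Proof.
move=> hL cL; split=> [c f g tf tg|f tf f0].
  apply: cvg_lim => //.
  rewrite (_ : (fun k => _) = (fun k => c * L k f + L k g)); last first.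
    by apply/funext => k; exact: (pos_fun_linear (hL k)).
  apply: cvgD; last exact: cL.
  by apply: cvgMl_tmp; exact: cL.
by apply: limr_ge; [exact: cL|apply: nearW => k; exact: (pos_fun_ge0 (hL k))].
Qed.

End ConvergentSubsequences.

(** * Positive decomposition of test forms *)

Lemma scale_split (R : realType) (V : lmodType (Cplx R)) (a g t : R) (k e : V) :
  toC (a * t) *: k - toC g *: e = toC ((a - g) * t) *: k + toC g *: (toC t *: k - e).
Proof.
by rewrite scalerBr scalerA addrA -scalerDl -toCM -toCD -mulrDl subrK.
Qed.

Section PositiveSplitting.
Variables (R : realType) (d : nat) (W : set (Cn R d)).
Implicit Types (phi : cform R d) (r : nat).

Lemma bidegree_elemcov (l : seq (Cn R d)) : bidegree_covec (size l) (size l) (elemcov l).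
Proof.
elim: l => [|a l ih]; first exact: bidegree_one.
rewrite elemcov_cons; apply: (@bidegree_wedge _ _ 1 1) => //.
by rewrite posformE; exact: bidegree_herm.
Qed.

(** The domination by a multiple of [kahler_pow] is recorded along with positivity, since the mass
    bound to be transferred concerns a power of omega_V. *)
Definition positive_split r phi := exists (g : nat -> cform R d) (C : R),
  [/\ 0 <= C, forall k, test_form W r r (g k), forall k y, pos_comb r (g k y),
      forall k y, pos_comb r (toC C *: kahler_pow R finset.setT r - g k y) &
      forall y, phi y = \sum_(k < 4) 'i ^+ k *: g k y].

Lemma test_form0 r : test_form W r r (fun=> 0).
Proof.
split; [exact: smooth_form_cst|by move=> x; exact: bidegree0|].
by exists set0; split => //; exact: compact0.
Qed.

Lemma test_formD r (v w : cform R d) : test_form W r r v -> test_form W r r w ->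
  test_form W r r (fun x => v x + w x).
Proof.
move=> [sv bv [K [cK KW v0]]] [sw bw [L [cL LW w0]]]; split.
- exact: smooth_formD openT sv sw.
- by move=> x; exact: bidegreeD (bv x) (bw x).
exists (K `|` L); split; [exact: compactU|by move=> x [/KW|/LW]|].
by move=> x /not_orP[/v0 -> /w0 ->]; rewrite addr0.
Qed.

Lemma positive_split0 r : positive_split r (fun=> 0).
Proof.
exists (fun _ _ => 0), 0; split=> [//|k|k y|k y|y].
- exact: test_form0.
- exact: pos_comb0.
- by rewrite toC0 scale0r subrr; exact: pos_comb0.
- by rewrite big1 // => k _; rewrite scaler0.
Qed.

Lemma positive_splitD r phi psi : positive_split r phi -> positive_split r psi ->
  positive_split r (fun y => phi y + psi y).
Proof.
move=> [g [C [C0 tg pg dg gE]]] [h [D [D0 th ph dh hE]]].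
exists (fun k y => g k y + h k y), (C + D); split=> [|k|k y|k y|y].
- exact: addr_ge0.
- exact: test_formD (tg k) (th k).
- exact: pos_combD (pg k y) (ph k y).
- rewrite toCD scalerDl opprD addrACA; exact: pos_combD (dg k y) (dh k y).
- by rewrite gE hE -big_split; apply: eq_bigr => k _; rewrite scalerDr.
Qed.

Lemma positive_split_sum r I (s : seq I) (F : I -> cform R d) :
  (forall i, positive_split r (F i)) -> positive_split r (fun y => \sum_(i <- s) F i y).
Proof.
move=> h; elim: s => [|i s ih].
  by under eq_fun do rewrite big_nil; exact: positive_split0.
by under eq_fun do rewrite big_cons; exact: positive_splitD.
Qed.

Variables (chi : R -> R) (hchi : cutoff chi) (oW : open W).

Lemma test_fun_parts N (O : set (Cn R N)) (F : Cn R N -> Cplx R) : test_fun O F ->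
  real_test O (fun y => reC (F y)) /\ real_test O (fun y => imC (F y)).
Proof.
move=> /test_funE[sF [K [cK KW F0]]]; split; split.
- exact: smooth_reC openT sF.
- by exists K; split => // y /F0 ->.
- exact: smooth_imC openT sF.
- by exists K; split => // y /F0 ->.
Qed.

(** The same term b h is added to all four coefficients of 1, i, -1, -i. It cancels in the sum, and
    it makes the coefficients nonnegative and at most 2 b, as h = 1 on the support of F and b bounds
    its real and imaginary parts. *)
Lemma positive_split_elemcov (F : Cn R d -> Cplx R) (l : seq (Cn R d)) : test_fun W F ->
  positive_split (size l) (fun y => F y *: elemcov l).
Proof.
move=> tF; have [ta tb] := test_fun_parts tF.
have [_ [K [cK KW F0]]] := (test_funE W F).1 tF.
have [A A0 hA] := real_test_bounded ta; have [B B0 hB] := real_test_bounded tb.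
have [h [th h01 hK]] := smooth_cutoff hchi cK oW KW.
have [t t0 dom] := elemcov_dominated l.
pose b := A + B; have b0 : 0 <= b by exact: addr_ge0.
pose G k y := (if k is 0 then reC (F y) else if k is 1 then imC (F y) else 0) + b * h y.
have tG k : real_test W (G k).
  by case: k => [|[|k]]; apply: real_testD => //; try exact: real_testZ; exact: real_test0.
have hG k y : 0 <= G k y <= b + b.
  have [Ky|/F0 Fy] := pselect (K y); last first.
    have -> : G k y = b * h y by rewrite /G Fy; case: k => [|[|k]]; rewrite add0r.
    have /andP[h0 h1] := h01 y; rewrite mulr_ge0 //=.
    by rewrite (le_trans (ler_piMr b0 h1)) // lerDl.
  have hAy := hA y; have hBy := hB y; rewrite !ler_norml in hAy hBy.
  move: hAy hBy => /andP[a1 a2] /andP[b1 b2].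
  by rewrite /G hK // mulr1 /b; case: k => [|[|k]]; apply/andP; split; lra.
exists (fun k y => toC (G k y) *: elemcov l), ((b + b) * t); split=> [|k|k y|k y|y].
- by rewrite mulr_ge0 // addr_ge0.
- have [sG [L [cL LW G0]]] := tG k; split.
  + exact: smooth_form_scale openT sG.
  + by move=> y; apply: bidegreeZ; exact: bidegree_elemcov.
  + by exists L; split => // y /G0 ->; rewrite toC0 scale0r.
- by have /andP[g0 _] := hG k y; apply: pos_combZ => //; exact: pos_comb_elemcov.
- have /andP[g0 g1] := hG k y.
  apply: (@eq_ind_r _ _ (pos_comb (size l)) _ _ (scale_split _ _ _ _ _)).
  apply: pos_combD; last exact: pos_combZ.
  apply: pos_combZ; last exact: pos_comb_kahler_pow.
  by rewrite mulr_ge0 // subr_ge0.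
- have -> : \sum_(k < 4) 'i ^+ k *: (toC (G k y) *: elemcov l) =
      (\sum_(k < 4) 'i ^+ k * toC (G k y)) *: elemcov l.
    by rewrite scaler_suml; apply: eq_bigr => k _; rewrite scalerA.
  congr (_ *: _); rewrite !big_ord_recl big_ord0 /G /= add0r !toCD [LHS]CplxE.
  move: (toC (b * h y)) (toC (reC (F y))) (toC (imC (F y))) => s u v.
  rewrite expr0 /bump /=.
  have ii : 'i ^+ 2 = -1 :> Cplx R by exact: sqrCi.
  move: 'i ii => I ii.
  rewrite [RHS](_ : _ = (u + s) + I * (v + s) + I ^+ 2 * s + I * I ^+ 2 * s).
    by rewrite ii; ring.
  by ring.
Qed.

(** The form is treated component by component. By its bidegree only the basis covectors with r
    holomorphic and r antiholomorphic indices occur, and these are spanned by elementary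
    covectors. *)
Lemma test_form_positive_split r phi : test_form W r r phi -> positive_split r phi.
Proof.
move=> [sphi bphi [K [cK KW phi0]]].
have E y : phi y = \sum_S phi y S *: ecov R S by exact: covecE.
have -> : phi = fun y => \sum_S phi y S *: ecov R S by apply/funext.
apply: positive_split_sum => S.
have tS : test_fun W (fun y => phi y S).
  by apply/test_funE; split; [exact: sphi|exists K; split => // y /phi0 ->; rewrite ffunE].
have [/andP[/eqP hS /eqP aS]|nS] := boolP ((holn S == r) && (aholn S == r)); last first.
  have -> : (fun y => phi y S *: ecov R S) = (fun=> 0).
    apply/funext => y; have [->|/bphi [hS aS]] := eqVneq (phi y S) 0; first exact: scale0r.
    by move: nS; rewrite /holn /aholn hS aS !eqxx.
  exact: positive_split0.
have [s /allP sr ->] := ecov_span R hS aS.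
elim: s sr => [|p s ih] sr.
  by under eq_fun do rewrite big_nil scaler0; exact: positive_split0.
under eq_fun do rewrite big_cons scalerDr scalerA.
apply: positive_splitD; last by apply: ih => q qs; apply: sr; rewrite inE qs orbT.
rewrite -(eqP (sr p (mem_head _ _))); apply: positive_split_elemcov.
have [sf [L [cL LW f0]]] := (test_funE _ _).1 tS.
apply/test_funE; split; last by exists L; split => // y /f0 ->; rewrite mul0r.
by apply: (smooth_eq openT _ (smoothZ p.1 openT sf)) => y _; rewrite mulrC.
Qed.

End PositiveSplitting.

(** * The functionals of T *)

(** On a fine enough mesh each cell meeting the support of f lies in one of the neighbourhoods with
    a uniform bound, which then applies to its bump; f is dominated by a constant times the finite
    sum of these bumps. *)
Lemma family_bounded (R : realType) (chi : R -> R) (hchi : cutoff chi) N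
    (W : set (Cn R N)) (I : Type) (D : set I) (L : I -> (Cn R N -> R) -> R) :
  (forall i, D i -> positive_functional W (L i)) ->
  (forall x, W x -> exists (O : set (Cn R N)) (C : R),
     [/\ open O, O x, O `<=` W &
         forall i h, D i -> subunit O h -> L i h <= C]) ->
  forall f, real_test W f -> exists B : R, forall i, D i -> `|L i f| <= B.
Proof.
move=> hL loc f tf; have [B B0 hB] := real_test_bounded tf.
have [_ [K [cK KW f0]]] := tf.
pose P (O : set (Cn R N)) := O `<=` W /\
  exists C : R, forall i h, D i -> subunit O h -> L i h <= C.
have [q _ hq] : \forall q \near \oo, forall a, cell q a `&` K !=set0 ->
    exists2 O, P O & cell q a `<=` O.
  apply: small_cells => // x Kx; have [G [C [oG Gx GW hC]]] := loc x (KW x Kx).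
  by exists G; split => //; split => //; exists C.
have [s [sK s1 sE]] := cell_partition hchi q cK.
have bnd a : exists C : R, a \in s -> [/\ real_test W (cell_bump chi q a) &
    forall i, D i -> L i (cell_bump chi q a) <= C].
  have [as_|] := boolP (a \in s); last by exists 0.
  have [G [GW [C hC]] aG] := hq q (leqnn q) a (sK a as_).
  have ta : real_test G (cell_bump chi q a) by exact: real_test_cell_bump.
  exists C => _; split=> [|i Di]; first exact: real_test_sub ta.
  apply: hC => //; split => // x; rewrite cell_bump_ge0 //=.
  rewrite (le_trans _ (s1 x)) // (big_rem a as_) /= lerDl.
  by apply: sumr_ge0 => b _; exact: cell_bump_ge0.
have [C hC] := choice bnd.
exists (B * \sum_(a <- s) C a) => i Di.
have ts a : a \in s -> real_test W (cell_bump chi q a) by move=> /hC[].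
have tS := real_test_sum ts.
have fS x : `|f x| <= B * \sum_(a <- s) cell_bump chi q a x.
  have [Kx|/f0 ->] := pselect (K x); first by rewrite sE // mulr1.
  rewrite normr0 mulr_ge0 // sumr_ge0 // => a _; exact: cell_bump_ge0.
apply: (le_trans (pos_fun_norm (hL i Di) tf (real_testZ B tS) fS)).
rewrite (pos_funZ (hL i Di)) // ler_wpM2l // (pos_fun_sum (hL i Di)) //.
rewrite big_seq [leRHS]big_seq; apply: ler_sum => a /hC[_ h]; exact: h.
Qed.

Lemma smooth_form_scaleC (R : realType) N (W : set (Cn R N)) (z : Cplx R) w :
  open W -> smooth_form W w -> smooth_form W (fun y => z *: w y).
Proof.
move=> oW sw S; apply: (smooth_eq oW _ (smoothZ z oW (sw S))) => y _.
by rewrite ffunE.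
Qed.

Section Slices.
Variables (R : realType) (chi : R -> R) (hchi : cutoff chi) (d n : nat).
Local Notation CN := (Cn R (d + n)).
Implicit Types (T : functional R (d + n)) (psi : cform R d) (c : R) (m r : nat)
  (W : set CN).

(** The real part makes this a real functional, as positive functionals require. For positive [T]
    and a positive weight nothing is lost, by [slice_toC]. *)
Definition slice T c m psi (f : CN -> R) : R :=
  reC (T (sliced_form chi c m psi (fun x => toC (f x)))).

(** Compact support is left to the test function on the total space, so that powers of omega_V are
    weights too. *)
Definition slice_weight r psi :=
  [/\ smooth_form setT psi, bidegree r r psi & forall y, pos_comb r (psi y)].

Section OneCurrent.
Variables (W : set CN) (p m r : nat) (T : functional R (d + n)).
Hypothesis cT : current W p p T.
Hypothesis pT : positive_current W p T.
Hypothesis mr : (d + n - p = m + r)%N.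

Lemma sliced_linear c psi (z : Cplx R) f g : smooth_form setT psi -> bidegree r r psi ->
  test_fun W f -> test_fun W g ->
  T (sliced_form chi c m psi (fun x => z * f x + g x)) =
  z * T (sliced_form chi c m psi f) + T (sliced_form chi c m psi g).
Proof.
move=> sp bp tf tg; have [lin _] := cT.
rewrite (@sliced_fun_linear R chi d n c m psi z f g).
by apply: lin; rewrite mr; exact: sliced_test.
Qed.

Lemma slice_positive_functional c psi : slice_weight r psi ->
  positive_functional W (slice T c m psi).
Proof.
move=> [sp bp pp]; split=> [a f g /real_testP tf /real_testP tg|f tf f0].
  rewrite /slice (_ : sliced_form chi c m psi (fun x => toC (a * f x + g x)) =
    sliced_form chi c m psi (fun x => toC a * toC (f x) + toC (g x))).
    by rewrite sliced_linear // reCD reCM reC_toC imC_toC mul0r subr0.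
  by congr sliced_form; apply/funext => x; rewrite toCD toCM.
have h : 0 <= T (sliced_form chi c m psi (fun x => toC (f x))).
  apply: pT; rewrite mr.
    by apply: (sliced_test hchi) => //; exact/real_testP.
  by move=> x; apply: (sliced_positive hchi) => //; exists (f x).
by move: h; rewrite /slice; case: (T _) => u v; rewrite lecE /= => /andP[].
Qed.

(** Positivity makes the value real when f >= 0. A signed f is written as (f + B h) - B h, with h =
    1 on its support. *)
Lemma slice_toC c psi f : slice_weight r psi -> real_test W f -> open W ->
  T (sliced_form chi c m psi (fun x => toC (f x))) = toC (slice T c m psi f).
Proof.
move=> wp tf oW; have [sp bp pp] := wp.
have pos g : real_test W g -> (forall x, 0 <= g x) ->
    imC (T (sliced_form chi c m psi (fun x => toC (g x)))) = 0.
  move=> tg g0; have : 0 <= T (sliced_form chi c m psi (fun x => toC (g x))).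
    apply: pT; rewrite mr.
      by apply: (sliced_test hchi) => //; exact/real_testP.
    by move=> x; apply: (sliced_positive hchi) => //; exists (g x).
  by case: (T _) => u v; rewrite lecE /= => /andP[/eqP].
suff i0 : imC (T (sliced_form chi c m psi (fun x => toC (f x)))) = 0.
  by apply: Cplx_eq; rewrite ?imC_toC // reC_toC.
have [B B0 hB] := real_test_bounded tf; have [_ [K [cK KW f0]]] := tf.
have [h [th h01 hK]] := smooth_cutoff hchi cK oW KW.
have tBh := real_testZ B th; have tg := real_testD tf tBh.
have h0 x : 0 <= B * h x by have /andP[hx _] := h01 x; exact: mulr_ge0.
have g0 x : 0 <= f x + B * h x.
  have [Kx|/f0 ->] := pselect (K x); last by rewrite add0r.
  by rewrite hK // mulr1; have := hB x; rewrite ler_norml => /andP[+ _]; lra.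
have := sliced_linear c (-1) sp bp ((real_testP _ _).1 tBh) ((real_testP _ _).1 tg).
rewrite (_ : sliced_form _ _ _ _ _ = sliced_form chi c m psi (fun x => toC (f x))).
  by move=> ->; rewrite mulN1r addrC imCB !pos // subrr.
by congr sliced_form; apply/funext => x; rewrite toCD mulN1r addrC addrK.
Qed.

Lemma slice_complex c psi f : slice_weight r psi -> test_fun W f -> open W ->
  T (sliced_form chi c m psi f) =
  toC (slice T c m psi (fun x => reC (f x)))
  + 'i * toC (slice T c m psi (fun x => imC (f x))).
Proof.
move=> wp tf oW; have [sp bp pp] := wp; have [ta tb] := test_fun_parts tf.
rewrite -(slice_toC c wp ta oW) -(slice_toC c wp tb oW) addrC.
rewrite -sliced_linear //; try exact/real_testP.
congr (T (sliced_form _ _ _ _ _)); apply/funext => x.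
by rewrite addrC -CplxE.
Qed.

Lemma sliced_base_linear c u v (z : Cplx R) f :
  smooth_form setT u -> bidegree r r u -> smooth_form setT v -> bidegree r r v ->
  test_fun W f ->
  T (sliced_form chi c m (fun y => z *: u y + v y) f) =
  z * T (sliced_form chi c m u f) + T (sliced_form chi c m v f).
Proof.
move=> su bu sv bv tf; have [lin _] := cT.
rewrite (@sliced_formD R chi d n c m (fun y => z *: u y) v f).
rewrite (@sliced_formZ R chi d n c m z u f).
by apply: lin; rewrite mr; exact: sliced_test.
Qed.

Lemma sliced_base0 c f : test_fun W f -> T (sliced_form chi c m (fun=> 0) f) = 0.
Proof.
move=> tf.
have sz : smooth_form setT (fun _ : Cn R d => 0 : covec R d) by exact: smooth_form_cst.
have bz : bidegree r r (fun _ : Cn R d => 0 : covec R d) by move=> y; exact: bidegree0.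
have := sliced_base_linear c (-1) sz bz sz bz tf.
by under eq_fun do rewrite scaler0 addr0; rewrite mulN1r addNr.
Qed.

Lemma sliced_baseZ c u (z : Cplx R) f : smooth_form setT u -> bidegree r r u ->
  test_fun W f ->
  T (sliced_form chi c m (fun y => z *: u y) f) = z * T (sliced_form chi c m u f).
Proof.
move=> su bu tf.
have sz : smooth_form setT (fun _ : Cn R d => 0 : covec R d) by exact: smooth_form_cst.
have bz : bidegree r r (fun _ : Cn R d => 0 : covec R d) by move=> y; exact: bidegree0.
rewrite -[RHS]addr0 -(sliced_base0 c tf) -(sliced_base_linear c z su bu sz bz tf).
by under [in RHS]eq_fun do rewrite addr0.
Qed.

Lemma sliced_split c phi (g : nat -> cform R d) f : test_fun W f ->
  (forall k, slice_weight r (g k)) ->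
  (forall y, phi y = \sum_(k < 4) 'i ^+ k *: g k y) ->
  T (sliced_form chi c m phi f) = \sum_(k < 4) 'i ^+ k * T (sliced_form chi c m (g k) f).
Proof.
move=> tf wg gE.
have {gE}-> : phi = fun y => \sum_(k <- index_iota 0 4) 'i ^+ k *: g k y.
  by apply/funext => y; rewrite gE big_mkord.
rewrite -(big_mkord xpredT (fun k => 'i ^+ k * T (sliced_form chi c m (g k) f))).
have sg k := let: And3 h _ _ := wg k in h.
have bg k := let: And3 _ h _ := wg k in h.
elim: (index_iota 0 4) => [|k s ih].
  by under eq_fun do rewrite big_nil; rewrite big_nil; exact: sliced_base0.
under eq_fun do rewrite big_cons.
rewrite big_cons -ih; apply: (sliced_base_linear c _ (sg k) (bg k) _ _ tf).
  apply: smooth_form_sum; first exact: openT.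
  by move=> j _; exact: (smooth_form_scaleC _ openT (sg j)).
by move=> y; apply: bidegree_sum => j _; apply: bidegreeZ; exact: bg.
Qed.

(** The difference C Om - psi is itself a positive weight, so T is nonnegative on it; the rest is
    linearity in the weight. *)
Lemma slice_le c psi (C : R) Om f : slice_weight r psi -> slice_weight r Om ->
  0 <= C -> (forall y, pos_comb r (toC C *: Om y - psi y)) ->
  real_test W f -> (forall x, 0 <= f x) ->
  slice T c m psi f <= C * slice T c m Om f.
Proof.
move=> wp wo C0 dom tf f0; have [sp bp pp] := wp; have [so bo po] := wo.
have E y : toC C *: Om y - psi y = (-1) *: psi y + toC C *: Om y.
  by rewrite scaleN1r addrC.
have sCo : smooth_form setT (fun y => toC C *: Om y) by exact: (smooth_form_scaleC _ openT so).
have bCo : bidegree r r (fun y => toC C *: Om y) by move=> y; apply: bidegreeZ; exact: bo.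
have wd : slice_weight r (fun y => (-1) *: psi y + toC C *: Om y).
  split; last by move=> y; rewrite -E.
    by apply: (smooth_formD openT _ sCo); exact: (smooth_form_scaleC _ openT sp).
  by move=> y; apply: bidegreeD => //; apply: bidegreeZ; exact: bp.
have tf' := (real_testP _ _).1 tf.
have h := pos_fun_ge0 (slice_positive_functional c wd) tf f0.
have E1 := sliced_base_linear c (-1) sp bp sCo bCo tf'.
have {}E1 := eq_trans E1 (congr1 (+%R _) (sliced_baseZ c (toC C) so bo tf')).
have {}h : 0 <= - slice T c m psi f + C * slice T c m Om f.
  apply: (le_trans h); rewrite {1}/slice [X in reC X]E1 mulN1r reCD reCN.
  by rewrite reCM reC_toC imC_toC mul0r subr0.
by rewrite addrC subr_ge0 in h.
Qed.

End OneCurrent.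
End Slices.

(** * Exchange of the masses of shells *)

(* [a j s] stands for the mass of eta_s at the j-th parameter, whose inverse square
   modulus is of order [l j]; [a j s0 - a j s] is the mass of a shell, and its
   supremum S is almost attained by a shell that does not depend on [j]. *)
Lemma shell_exchange (R : realType) (a : nat -> R -> R) (l : nat -> R) (k s0 B : R)
  (A : R -> R) (D : R) :
  0 < k -> l @ \oo --> +oo ->
  (forall j s, s0 <= s -> 0 <= a j s) -> (forall j, a j s0 <= B) ->
  (forall i j s, s0 <= s -> s <= k * l i -> s <= k * l j ->
     a i s0 - a i s = a j s0 - a j s) ->
  (forall s, s0 <= s -> (fun j => a j s) @ \oo --> A s) ->
  (fun j => a j (k * l j)) @ \oo --> D ->
  forall e, 0 < e -> exists2 s, s0 <= s & A s <= D + e.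
Proof.
move=> k0 ly a0 aB indep cA cD e e0.
have lge s : \forall j \near \oo, s <= k * l j.
  have : \forall j \near \oo, s / k <= l j by exact: (cvgry_ge ly).
  by apply: filterS => j; rewrite ler_pdivrMr // mulrC.
pose S := [set r | exists j s, [/\ s0 <= s, s <= k * l j & r = a j s0 - a j s]].
have hS : has_sup S.
  split.
    have [j _ hj] := lge s0; exists (a j s0 - a j s0), j, s0; split=> //.
    exact: (hj j (leqnn j)).
  exists B => _ [j [s [h1 h2 ->]]]; rewrite lerBlDr (le_trans (aB j)) // lerDl.
  exact: a0.
have [_ [i [s [s1 s2 ->]]] hs] := sup_adherent e0 hS.
exists s => //; have cAs := cA s s1.
apply: (ler_cvg_to cAs (cvgD cD (cvg_cst e))).
apply: filterS (lge s) => j sj /=.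
(* The shell from s0 to k l_j has mass at most sup S, and the one from s0 to s has mass above sup S
   - e at every large j. Subtracting gives a_j(s) <= a_j(k l_j) + e, which passes to the limit. *)
have : a j s0 - a j (k * l j) <= sup S.
  by apply: ub_le_sup; [exact: hS.2|exists j, (k * l j); split => //; exact: le_trans sj].
move: hs; rewrite (indep i j s s1 s2 sj) => h1 h2.
by change (a j s <= a j (k * l j) + e); move: h1 h2; lra.
Qed.

(** * Tubes around the zero section and the cutoffs carried by them *)

Section Tubes.
Variables (R : realType) (d n : nat).
Local Notation F := (fiber d n).
Local Notation CN := (Cn R (d + n)).
Implicit Types (x : CN) (y : Cn R d) (K : set (Cn R d)).

Lemma le_radsq x (j : 'I_n) : modC (x 0 (rshift d j)) ^+ 2 <= radsq F x.
Proof.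
rewrite /radsq (bigD1 (rshift d j)) /=; last by apply/imsetP; exists j.
by rewrite lerDl sumr_ge0 // => i _; rewrite sqr_ge0.
Qed.

Lemma smooth_real_radsq J : smooth_real (radsq J : CN -> R).
Proof. exact: smooth_sqnorm_on openT. Qed.

(** The bound 3 is the point beyond which [kappa] vanishes, so that the tube carries [eta s] when b
    vanishes off K. *)
Definition tube K (s : R) : set CN := [set x | K (bpart x) /\ s * radsq F x <= 3].

Lemma tube_compact K s : compact K -> 0 < s -> compact (tube K s).
Proof.
(* A modulus whose square is at most 3 / s is at most 3 / s + 1; this avoids the square root. *)
move=> /compact_CnE[cK [B hB]] s0; apply: (@closed_box_sub_compact _ _ _ (`|B| + (3 / s + 1))).
  apply: closedI; first exact: (closed_comp (fun z _ => @bpart_continuous R d n z) cK).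
  have cr : continuous (fun x : CN => s * radsq F x).
    exact: (smooth_real_continuous (smooth_realM (smooth_real_cst s) (smooth_real_radsq F))).
  exact: (closed_comp (fun z _ => cr z) (@closed_le R 3)).
move=> x [Kx sx] j.
rewrite -[j](splitK j); case: (fintype.split j) => i /=.
  have := hB _ Kx i; rewrite bpart_coord => h; apply: (le_trans h).
  apply: (le_trans (ler_norm B)); rewrite lerDl addr_ge0 // divr_ge0 // ltW //.
have h : modC (x 0 (rshift d i)) ^+ 2 <= 3 / s.
  by apply: (le_trans (le_radsq x i)); rewrite ler_pdivlMr // mulrC.
have B0 : 0 <= `|B| by [].
have := modC_ge0 (x 0 (rshift d i)); move: h B0; nra.
Qed.

(** The tube lemma over K x {0}: compactness of [K] in near-covering form, with s tending to +oo. *)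
Lemma tube_sub K (O : set CN) : compact K -> open O ->
  (forall y, K y -> O (row_mx y 0)) ->
  exists2 s0 : R, 0 < s0 & forall s, s0 <= s -> tube K s `<=` O.
Proof.
move=> /compact_near_coveringP cK oO KO.
have [] := cK R (pinfty_nbhs R) (fun s y => forall x : CN, bpart x = y ->
   s * radsq F x <= 3 -> O x) _.
  move=> y Ky.
  have /nbhs_CnP[e e0 he] : nbhs (row_mx y 0 : CN) O by apply: open_nbhs_nbhs; split=> //; exact: KO.
  (* For s > 3 / e^2, the inequality s |x''|^2 <= 3 forces every |x''_j| < e; the added 1 keeps s
     positive. *)
  exists ([set z : Cn R d | forall j, modC (y 0 j - z 0 j) < e], [set s : R | 3 / e ^+ 2 + 1 < s]).
    split; first by apply/nbhs_CnP; exists e.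
    by exists (3 / e ^+ 2 + 1); rewrite num_real.
  move=> [z s] /= [hz hs] x xz sx; apply: he => j.
  rewrite -[j](splitK j); case: (fintype.split j) => i /=.
    by rewrite row_mxEl; have := hz i; rewrite -xz bpart_coord.
  rewrite row_mxEr mxE sub0r modCN -(ltr_pXn2r (n := 2)) ?nnegrE ?modC_ge0 ?(ltW e0) //.
  apply: (le_lt_trans (le_radsq x i)).
  have s0 : 0 < s by apply: lt_trans hs; rewrite ltr_pwDr // divr_ge0 // sqr_ge0.
  have : radsq F x <= 3 / s by rewrite ler_pdivlMr // mulrC.
  move=> h; apply: (le_lt_trans h); rewrite ltr_pdivrMr //.
  rewrite mulrC -ltr_pdivrMr ?exprn_gt0 //; apply: lt_trans hs.
  by rewrite ltrDl.
move=> M [_ h]; exists (`|M| + 1) => [|s hs x [Kx sx]]; first by rewrite ltr_wpDl.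
by apply: (h s) Kx x erefl sx; rewrite (lt_le_trans _ hs) // (le_lt_trans (ler_norm M)) // ltrDl.
Qed.

Variables (chi : R -> R) (hchi : cutoff chi).

(** A smooth decreasing step, equal to 1 for t < 1 and to 0 for t > 3. *)
Definition kappa (t : R) : R := 1 - chi_ chi 1 (t - 2).

Lemma kappa01 t : 0 <= kappa t <= 1.
Proof. by rewrite /kappa subr_ge0 chi1_le1 // lerBlDr lerDl chi1_ge0. Qed.

Lemma kappa_homo t u : t <= u -> kappa u <= kappa t.
Proof. by move=> tu; rewrite lerD2l lerN2; apply: chi1_homo => //; rewrite lerD2r. Qed.

Lemma kappa1 t : t < 1 -> kappa t = 1.
Proof. by move=> t1; rewrite /kappa chi1_left ?subr0 //; lra. Qed.

Lemma kappa0 t : 3 < t -> kappa t = 0.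
Proof. by move=> t3; rewrite /kappa chi1_right ?subrr //; lra. Qed.

Variable b : Cn R d -> R.

Definition eta s x : R := b (bpart x) * kappa (s * radsq F x).

Lemma smooth_real_base (f : Cn R d -> R) : smooth_real f ->
  smooth_real (fun x : CN => f (bpart x)).
Proof. exact: smooth_bpart. Qed.

Lemma smooth_kappa s : smooth_real (fun x : CN => kappa (s * radsq F x)).
Proof.
have su : smooth_real (fun x : CN => s * radsq F x - 2).
  apply: smooth_realD; last exact: smooth_real_cst.
  by apply: smooth_realM; [exact: smooth_real_cst|exact: smooth_real_radsq].
have sc := smooth_real_comp (fun k t => chi_is_derive hchi k.+1 t) su.
have h := smooth_realD (smooth_real_cst 1) (smooth_realM (smooth_real_cst (-1)) sc).
by apply: (smooth_eq openT _ h) => x _; congr toC; rewrite mulN1r.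
Qed.

Lemma smooth_eta s : smooth_real b -> smooth_real (eta s).
Proof. by move=> sb; exact: smooth_realM (smooth_real_base sb) (smooth_kappa s). Qed.

Lemma eta_tube K s x : (forall y, ~ K y -> b y = 0) -> ~ tube K s x -> eta s x = 0.
Proof.
move=> b0 /not_andP[/b0 h|/negP]; rewrite /eta; first by rewrite h mul0r.
by rewrite -ltNge => /kappa0 ->; rewrite mulr0.
Qed.

Lemma real_test_eta K (O : set CN) s : compact K -> (forall y, ~ K y -> b y = 0) ->
  smooth_real b -> 0 < s -> tube K s `<=` O -> real_test O (eta s).
Proof.
move=> cK b0 sb s0 KO; split; first exact: smooth_eta.
by exists (tube K s); split => //; [exact: tube_compact|move=> x; exact: eta_tube].
Qed.

Hypothesis b01 : forall y, 0 <= b y <= 1.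

Lemma eta01 s x : 0 <= eta s x <= 1.
Proof.
have /andP[b0 b1] := b01 (bpart x); have /andP[k0 k1] := kappa01 (s * radsq F x).
by rewrite mulr_ge0 // mulr_ile1.
Qed.

Lemma eta_homo s t x : s <= t -> eta t x <= eta s x.
Proof.
move=> st; have /andP[b0 _] := b01 (bpart x); rewrite ler_wpM2l // kappa_homo //.
by rewrite ler_wpM2r // radsq_ge0.
Qed.

Lemma eta_dilation s lam x : eta s (dilation lam x) = eta (s * modC lam ^+ 2) x.
Proof. by rewrite /eta bpart_dilation radsq_dilation mulrA. Qed.

Lemma eta_shell s t x : s <= t -> 0 < t -> radsq F x < t^-1 -> eta s x - eta t x = 0.
Proof.
move=> st t0 h; have rt : t * radsq F x < 1 by rewrite mulrC -ltr_pdivlMr // mul1r.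
rewrite /eta !kappa1 ?subrr //; apply: le_lt_trans rt.
by rewrite ler_wpM2r // radsq_ge0.
Qed.

End Tubes.

(** * Comparison of the mass on V with the mass on E *)

Section MassExchange.
Variables (R : realType) (d n : nat).
Local Notation F := (fiber d n).
Local Notation CN := (Cn R (d + n)).
Implicit Types (x : CN) (y : Cn R d).

Lemma zero_section_continuous : continuous (fun y : Cn R d => row_mx y 0 : CN).
Proof.
move=> y; apply: (@continuous_CnP R (d + n) _ (fun y : Cn R d => row_mx y 0 : CN) y) => j.
rewrite -[j](splitK j); case: (fintype.split j) => i /=.
  have -> : (fun z : Cn R d => (row_mx z 0 : CN) 0 (lshift n i)) = (fun z => z 0 i).
    by apply/funext => z; rewrite row_mxEl.
  exact: coordC_continuous.
have -> : (fun z : Cn R d => (row_mx z 0 : CN) 0 (rshift d i)) = (fun=> 0).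
  by apply/funext => z; rewrite row_mxEr mxE.
exact: continuous_cstC.
Qed.

Lemma open_base (U : set CN) : open U -> open (base U).
Proof.
by move=> oU; apply: (@open_comp _ _ (fun y : Cn R d => row_mx y 0 : CN) U _ oU) => z _;
  exact: zero_section_continuous.
Qed.

Lemma open_normal_bundle (U : set CN) : open U -> open (normal_bundle U).
Proof.
by move=> /open_base ob; apply: (@open_comp _ _ (@bpart R d n) (base U) _ ob) => z _;
  exact: bpart_continuous.
Qed.

Lemma fpart_row0 y : fpart (row_mx y 0 : CN) = 0.
Proof. by rewrite /fpart row_mxKr. Qed.

Lemma radsq_fpart0 x : fpart x = 0 -> radsq F x = 0.
Proof. by rewrite radsq_fiber => ->; apply/eqP; rewrite sqnorm_eq0. Qed.

Variables (chi : R -> R) (hchi : cutoff chi).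
Variables (U : set CN) (oU : open U).
Local Notation E := (normal_bundle U).
Local Notation eta := (eta chi).
Variables (b : Cn R d -> R) (sb : smooth_real b) (b01 : forall y, 0 <= b y <= 1).
Variables (K : set (Cn R d)) (cK : compact K) (KU : K `<=` base U).
Hypothesis b0 : forall y, ~ K y -> b y = 0.
Variables (s0 : R) (s00 : 0 < s0).
Hypothesis tubeU : forall s, s0 <= s -> tube K s `<=` U.
Variables (L J : (CN -> R) -> R).
Hypothesis hL : positive_functional U L.
Hypothesis hJ : positive_functional E J.
(** This and [locJ] retain from the form on the base only that b = 1 on its support. *)
Hypothesis locL : forall f, real_test U f -> L f = L (fun x => b (bpart x) * f x).
Hypothesis locJ : forall f, real_test E f -> J f = J (fun x => b (bpart x) * f x).
Hypothesis le_JL : forall t s : R, 0 < t -> s0 <= s -> J (eta b t) <= L (eta b s).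
Hypothesis approx_JL : forall e, 0 < e ->
  exists s t, [/\ s0 <= s, 0 < t & L (eta b s) <= J (eta b t) + e].

Lemma eta_subunit (O : set CN) s : 0 < s -> tube K s `<=` O -> subunit O (eta b s).
Proof.
move=> sp KO; split; first exact: (real_test_eta hchi cK b0 sb sp KO).
by move=> x; exact: eta01.
Qed.

Lemma real_test_base_mul (W : set CN) f : real_test W f -> real_test W (fun x => b (bpart x) * f x).
Proof.
move=> tf; have := real_test_mul (smooth_real_base (n := n) sb) tf.
by under eq_fun do rewrite mulrC.
Qed.

Lemma base_mul_le s f x : (forall z, 0 <= f z <= 1) ->
  (f x != 0 -> s * radsq F x < 1) -> b (bpart x) * f x <= eta b s x.
Proof.
move=> f01 h; have /andP[f0 f1] := f01 x; have /andP[bx0 _] := b01 (bpart x).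
rewrite /eta ler_wpM2l //; have [->|/h r1] := eqVneq (f x) 0.
  by have /andP[] := kappa01 hchi (s * radsq F x).
by rewrite kappa1.
Qed.

(** The set {s |x''|^2 < 1} is a neighbourhood of V on which kappa = 1, so any f between 0 and 1
    supported in it satisfies b f <= eta_s. *)
Lemma outer_le_eta s : s0 <= s -> (riesz_outer U L (zero_section U) <= (L (eta b s))%:E)%E.
Proof.
move=> ss; have sp : 0 < s by exact: lt_le_trans ss.
pose O := U `&` [set x | s * radsq F x < 1].
have cr : continuous (fun x : CN => s * radsq F x).
  exact: (smooth_real_continuous (smooth_realM (smooth_real_cst s) (smooth_real_radsq F))).
have oO : open O.
  by apply: openI => //; exact: (open_comp (fun z _ => cr z) (@open_lt R 1)).
have adm : admissible U (zero_section U) O.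
  split => //; first by move=> x [].
  move=> x [[Ux fx] _]; split => //=.
  by rewrite radsq_fpart0 // mulr0.
apply: (le_trans (riesz_outer_le L adm)).
apply: ge_ereal_sup => _ [f [tf f01] <-]; rewrite lee_fin.
have tfU : real_test U f by apply: (real_test_sub _ tf) => x [].
rewrite (locL tfU); apply: (pos_fun_le hL).
- exact: real_test_base_mul.
- by have [] := eta_subunit sp (tubeU ss).
move=> x; apply: base_mul_le => // fx.
have [_ [C [_ CO f0]]] := tf.
have Cx : C x by apply: contrapT => /f0 h; rewrite h eqxx in fx.
by have [] := CO x Cx.
Qed.

(** Every neighbourhood of V contains a tube over K, hence carries eta_s for some large s, and J
    (eta_t) <= L (eta_s) by [le_JL]. *)
Lemma eta_le_outer t : 0 < t -> ((J (eta b t))%:E <= riesz_outer U L (zero_section U))%E.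
Proof.
move=> t0; apply: le_ereal_inf_tmp => _ [G [oG GU VG] <-].
have KG y : K y -> G (row_mx y 0 : CN).
  by move=> /KU Uy; apply: VG; split => //; split => //=; exact: fpart_row0.
have [s1 s10 hs] := tube_sub cK oG KG.
pose s := Num.max s0 s1.
have ss0 : s0 <= s by rewrite le_max lexx.
have ss1 : s1 <= s by rewrite le_max lexx orbT.
apply: (@le_trans _ _ (L (eta b s))%:E); first by rewrite lee_fin le_JL.
apply: riesz_open_ge; apply: eta_subunit; last exact: hs.
exact: lt_le_trans ss0.
Qed.

Lemma tube_bundle t : tube K t `<=` E.
Proof. by move=> x [/KU]. Qed.

(** The functions eta_s for large s test the mass of V from above, and the eta_t for small t exhaust
    E; [approx_JL] and [le_JL] give the two inequalities. *)
Lemma mass_exchange :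
  riesz_outer U L (zero_section U) = riesz_outer E J E /\
  (riesz_outer E J E < +oo)%E.
Proof.
have oE := open_normal_bundle oU.
have -> : riesz_outer E J E = riesz_open J E by rewrite riesz_outer_open.
have EQ : riesz_outer U L (zero_section U) = riesz_open J E; last first.
  by split => //; rewrite -EQ (le_lt_trans (outer_le_eta (lexx s0))) // ltry.
apply/eqP; rewrite eq_le; apply/andP; split.
  apply/lee_addgt0Pr => e e0; have [s [t [ss t0 h]]] := approx_JL e0.
  apply: (le_trans (outer_le_eta ss)).
  apply: (@le_trans _ _ ((J (eta b t))%:E + e%:E)%E); first by rewrite -EFinD lee_fin.
  apply: leeD => //; apply: riesz_open_ge; apply: eta_subunit => //.
  exact: tube_bundle.
apply: ge_ereal_sup => _ [f [tf f01] <-].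
have [_ [C [cC CE f0]]] := tf.
have [_ [B hB]] := compact_CnE cC.
(* Chosen so that t |x''|^2 < 1 on the compact [C], where |x''|^2 is at most n B^2; there kappa =
   1. *)
pose t := (n%:R * B ^+ 2 + 1)^-1.
have nB : 0 < n%:R * B ^+ 2 + 1 by rewrite ltr_wpDl // mulr_ge0 // sqr_ge0.
have t0 : 0 < t by rewrite invr_gt0.
apply: (le_trans _ (eta_le_outer t0)); rewrite lee_fin (locJ tf).
apply: (pos_fun_le hJ).
- exact: real_test_base_mul.
- by have [] := eta_subunit t0 (@tube_bundle t).
move=> x; apply: base_mul_le => // fx.
have Cx : C x by apply: contrapT => /f0 h; rewrite h eqxx in fx.
rewrite mulrC ltr_pdivrMr // mul1r.
apply: (@le_lt_trans _ _ (n%:R * B ^+ 2)); last by rewrite ltrDl.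
rewrite radsq_fiber /sqnorm; apply: (@le_trans _ _ (\sum_(j < n) B ^+ 2)).
  apply: ler_sum => j _; rewrite fpart_coord lerXn2r ?nnegrE ?modC_ge0 //.
    exact: le_trans (modC_ge0 _) (hB x Cx (rshift d j)).
  exact: hB.
by rewrite sumr_const card_ord mulr_natl.
Qed.

End MassExchange.

(** * The mass comparison for T and its tangent current *)

Section SliceMass.
Variables (R : realType) (d n : nat) (chi : R -> R) (hchi : cutoff chi).
Local Notation F := (fiber d n).
Local Notation CN := (Cn R (d + n)).
Local Notation sl := (@slice R chi d n).
Implicit Types (T : functional R (d + n)) (psi : cform R d) (f : CN -> R).

Lemma slice_base_local T c m psi (b : Cn R d -> R) f :
  (forall y, psi y <> 0 -> b y = 1) ->
  sl T c m psi f = sl T c m psi (fun x => b (bpart x) * f x).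
Proof.
move=> hb; rewrite /slice; congr (reC (T _)); apply/funext => x.
rewrite /sliced_form; have [->|/hb ->] := pselect (psi (bpart x) = 0); last by rewrite mul1r.
have -> : base_pull n (0 : covec R d) = 0.
  by rewrite -[0 in LHS](scale0r (0 : covec R d)) /base_pull pullZ scale0r.
by rewrite wedge0r !scaler0.
Qed.

Lemma slice_tail T c c' m psi f :
  (forall x, f x <> 0 -> expR (2 * (1 - c)) < radsq F x /\ expR (2 * (1 - c')) < radsq F x) ->
  sl T c m psi f = sl T c' m psi f.
Proof.
move=> h; apply: (congr1 (fun w => reC (T w))); apply/funext => x.
have [fx|/h[h1 h2]] := pselect (f x = 0).
  by rewrite /sliced_form fx toC0; exact: (eq_trans (scale0r _) (esym (scale0r _))).
have ker := kernel_form_tail hchi m h1 h2.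
exact: (congr1 (fun e : covec R (d + n) =>
  toC (f x) *: wedge e (base_pull n (psi (bpart x)))) ker).
Qed.

Variables (U : set CN) (oU : open U).
Local Notation E := (normal_bundle U).
Variables (p m r : nat) (T Tinf : functional R (d + n)).
Hypothesis cT : current U p p T.
Hypothesis pT : positive_current U p T.
Hypothesis cTinf : current E p p Tinf.
Hypothesis pTinf : positive_current E p Tinf.
Hypothesis mr : (d + n - p = m + r)%N.
Variables (lam : nat -> Cplx R) (M : R).
Hypothesis lam0 : forall j, lam j != 0.
Hypothesis lamy : (fun j => modC (lam j)) @ \oo --> +oo%R.
Hypothesis lamT : forall w, test_form E (d + n - p) (d + n - p) w ->
  (fun j => current_pushforward (@dilation R d n (lam j)) T w) @ \oo --> Tinf w.
Variables (psi : cform R d) (wpsi : slice_weight r psi).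
Variables (K0 : set (Cn R d)) (cK0 : compact K0) (K0U : K0 `<=` base U).
Hypothesis psi0 : forall y, ~ K0 y -> psi y = 0.
Variable L : (CN -> R) -> R.
Local Notation c := (fun j => M + ln (modC (lam j))).
Hypothesis hL : positive_functional U L.
Hypothesis cL : forall f, real_test U f -> (fun j => sl T (c j) m psi f) @ \oo --> L f.
Hypothesis bL : forall f, real_test U f -> exists B, forall j, `|sl T (c j) m psi f| <= B.

Lemma slice_dilation_cvg f : real_test E f ->
  (fun j => sl T (c j) m psi (fun x => f (dilation (lam j) x))) @ \oo -->
  sl Tinf M m psi f.
Proof.
move=> tf; have [sp bp pp] := wpsi.
have tw : test_form E (d + n - p) (d + n - p) (sliced_form chi M m psi (fun x => toC (f x))).
  by rewrite mr; apply: (sliced_test hchi) => //; exact/real_testP.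
have [h _] := (cvg_CplxE _ _).1 (lamT tw).
have -> : (fun j => sl T (c j) m psi (fun x => f (dilation (lam j) x))) =
  (fun j => reC (current_pushforward (@dilation R d n (lam j)) T
     (sliced_form chi M m psi (fun x => toC (f x))))).
  apply/funext => j; rewrite /current_pushforward /slice.
  by rewrite (sliced_dilation chi M m psi _ (lam0 j)).
exact: h.
Qed.

(** This is e^2 |theta|^2 for theta = e^(-M) / l, the value of |x''|^2 beyond which the kernel no
    longer depends on theta. *)
Lemma expR_slice_level (l : Cplx R) : l != 0 ->
  expR (2 * (1 - (M + ln (modC l)))) = expR (2 * (1 - M)) / modC l ^+ 2.
Proof.
move=> l0; have l1 : 0 < modC l by rewrite modC_gt0.
have -> : 2 * (1 - (M + ln (modC l))) = 2 * (1 - M) - (ln (modC l) + ln (modC l)) by ring.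
by rewrite expRD expRN expRD lnK ?posrE // -expr2.
Qed.

(** [le_JL] holds because the scale t |lambda_j|^2, to which the dilation brings eta_t, eventually
    exceeds any s, and eta decreases with the scale. [approx_JL] is [shell_exchange] at the scales k
    |lambda_j|^2, where D is J (eta_k). *)
Lemma slice_mass_exchange :
  riesz_outer U L (zero_section U) = riesz_outer E (sl Tinf M m psi) E /\
  (riesz_outer E (sl Tinf M m psi) E < +oo)%E.
Proof.
have oB := open_base oU.
have [b [tb b01 bK0]] := smooth_cutoff hchi cK0 oB K0U.
have [sb [K [cK KU b0]]] := tb.
have [s0 s00 tubeU] : exists2 s0 : R, 0 < s0 & forall s, s0 <= s -> tube K s `<=` U.
  by apply: (tube_sub cK oU) => y /KU.
have bpsi y : psi y <> 0 -> b y = 1.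
  by move=> h; apply: bK0; apply: contrapT => /psi0.
have hT j := slice_positive_functional hchi cT pT mr (c j) wpsi.
have te s : s0 <= s -> real_test U (eta chi b s).
  move=> ss; apply: (real_test_eta hchi cK b0 sb); last exact: tubeU.
  exact: lt_le_trans ss.
have e0 s x : 0 <= eta chi b s x by have /andP[] := eta01 hchi b01 s x.
have ly : (fun j => modC (lam j) ^+ 2) @ \oo --> +oo.
  apply/cvgryPge => A.
  have : \forall j \near \oo, `|A| + 1 <= modC (lam j) by exact: (cvgry_ge lamy).
  apply: filterS => j h.
  have := modC_ge0 (lam j); have := ler_norm A; have := normr_ge0 A; move: h; nra.
have etaJ t : 0 < t ->
    (fun j => sl T (c j) m psi (eta chi b (t * modC (lam j) ^+ 2))) @ \oo -->
    sl Tinf M m psi (eta chi b t).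
  move=> t0; have tE : real_test E (eta chi b t).
    by apply: (real_test_eta hchi cK b0 sb t0) => x [/KU].
  have h := slice_dilation_cvg tE.
  rewrite (_ : (fun j => _) =
    (fun j => sl T (c j) m psi (fun x => eta chi b t (dilation (lam j) x)))) //.
  by apply/funext => j; congr (sl _ _ _ _); apply/funext => x; rewrite eta_dilation.
have tge t s : 0 < t -> \forall j \near \oo, s <= t * modC (lam j) ^+ 2.
  move=> t0; have : \forall j \near \oo, s / t <= modC (lam j) ^+ 2 by exact: (cvgry_ge ly).
  apply: filterS => j.
  by rewrite ler_pdivrMr // mulrC.
apply: (mass_exchange hchi oU sb b01 cK KU b0 s00 tubeU hL
  (slice_positive_functional hchi cTinf pTinf mr M wpsi)).
- move=> f tf; apply: (cvg_unique _ (cL tf)) => //.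
  have tf' := real_test_base_mul sb tf.
  rewrite (_ : (fun j => _) = fun j => sl T (c j) m psi (fun x => b (bpart x) * f x)).
    exact: cL tf'.
  by apply/funext => j; exact: slice_base_local.
- by move=> f tf; exact: slice_base_local.
- move=> t s t0 ss; apply: (ler_cvg_to (etaJ t t0) (cL (te s ss))).
  apply: filterS (tge t s t0) => j sj.
  apply: (pos_fun_le (hT j)); [exact: te (le_trans ss sj)|exact: te|].
  by move=> x; exact: eta_homo.
move=> e ep.
(* For s <= k |lambda|^2 the shell lies in |x''|^2 >= 1 / s, which is at least 2 e^(2 (1 - M)) /
   |lambda|^2. The factor 2 gives the strict inequality required for the kernel to be independent of
   the parameter. *)
pose k := expR (2 * (M - 1)) / 2.
have k0 : 0 < k by rewrite divr_gt0 ?expR_gt0.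
have [B hB] := bL (te s0 (lexx s0)).
have := @shell_exchange R (fun j s => sl T (c j) m psi (eta chi b s))
  (fun j => modC (lam j) ^+ 2) k s0 B (fun s => L (eta chi b s)) _ k0 ly _ _ _ _ (etaJ k k0) e ep.
case.
- by move=> j s ss; apply: (pos_fun_ge0 (hT j)); [exact: te|exact: e0].
- by move=> j; exact: le_trans (ler_norm _) (hB j).
- move=> i j s ss si sj.
  apply: (eq_trans (esym (pos_funB (hT i) (te s0 (lexx s0)) (te s ss)))).
  apply: (eq_trans _ (pos_funB (hT j) (te s0 (lexx s0)) (te s ss))).
  apply: slice_tail => x hx.
  have sp : 0 < s by exact: lt_le_trans ss.
  (* Near V both cutoffs equal b, so their difference vanishes for |x''|^2 < 1 / s. *)
  have rx : s^-1 <= radsq F x.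
    by rewrite leNgt; apply/negP => h; apply: hx; exact: eta_shell.
  have lev a : s <= k * modC (lam a) ^+ 2 -> expR (2 * (1 - c a)) < radsq F x.
    move=> sa; apply: lt_le_trans rx.
    have la : 0 < modC (lam a) by rewrite modC_gt0.
    have la2 : 0 < modC (lam a) ^+ 2 by rewrite exprn_gt0.
    apply: (@eq_ind_r _ _ (fun z => z < s^-1) _ _ (expR_slice_level (lam0 a))).
    have -> : 2 * (1 - M) = - (2 * (M - 1)) by ring.
    rewrite expRN -invfM ltf_pV2 ?posrE ?mulr_gt0 ?expR_gt0 //.
    by rewrite (le_lt_trans sa) // ltr_pM2r // ltr_pdivrMr // ltr_pMr ?expR_gt0 // ltr1n.
  by split; exact: lev.
- by move=> s ss; exact: cL (te s ss).
by move=> s ss h; exists s, k.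
Qed.

End SliceMass.

(** * Complex measures as currents *)

Section MeasureCurrents.
Variables (R : realType) (N : nat) (W : set (Cn R N)) (oW : open W).
Variables (chi : R -> R) (hchi : cutoff chi).
Variable mu : 'I_4 -> {measure set (borelCn R N) -> \bar R}.
Hypothesis mfin : forall k (K : set (Cn R N)), compact K -> K `<=` W -> (mu k K < +oo)%E.
Local Notation int k f := (Rintegral (mu k) (W : set (borelCn R N)) f).

(** The degree 0 coefficient is the only one that a test form of bidegree (0,0) can have. *)
Definition measure_functional : functional R N := fun w =>
  \sum_(k < 4) 'i ^+ k * (toC (int k (fun x => reC (w x finset.set0)))
    + 'i * toC (int k (fun x => imC (w x finset.set0)))).

Lemma modC_i : modC ('i : Cplx R) = 1.
Proof. by rewrite modCE reCi imCi expr0n /= add0r expr1n sqrtr1. Qed.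

Lemma modC_iX k : modC ('i ^+ k : Cplx R) = 1.
Proof. 
elim: k => [|k ih]; first by rewrite expr0 -toC1 modC_toC normr1.
by rewrite exprS modCM ih modC_i mulr1.
 Qed.

Lemma modC_sum_le I (r : seq I) (F : I -> Cplx R) (G : I -> R) :
  (forall i, modC (F i) <= G i) -> modC (\sum_(i <- r) F i) <= \sum_(i <- r) G i.
Proof.
move=> FG; elim: r => [|i r ih]; first by rewrite !big_nil modC0.
by rewrite !big_cons (le_trans (modCD _ _)) // lerD.
Qed.

(** With h a cutoff equal to 1 on K, |w| <= B h, so each integral is at most B times that of h;
    there are a real and an imaginary part for each of the four measures. *)
Lemma measure_functional_bound (K : set (Cn R N)) : compact K -> K `<=` W ->
  exists C : R, forall (w : cform R N) (B : R), test_fun W (fun x => w x finset.set0) ->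
    (forall x, ~ K x -> w x finset.set0 = 0) ->
    (forall x, modC (w x finset.set0) <= B) -> modC (measure_functional w) <= C * B.
Proof.
move=> cK KW; have [h [th h01 hK]] := smooth_cutoff hchi cK oW KW.
exists (\sum_(k < 4) (int k h + int k h)) => w B tw w0 wB.
have [ta tb] := test_fun_parts tw.
have bnd k (f : Cn R N -> R) : real_test W f -> (forall x, `|f x| <= modC (w x finset.set0)) ->
    `|int k f| <= B * int k h.
  move=> tf fw; have hJ := Rintegral_positive_functional oW (mfin k).
  rewrite -(pos_funZ hJ) //; apply: (pos_fun_norm hJ tf (real_testZ B th)) => x.
  apply: (le_trans (fw x)); have [Kx|nKx] := pselect (K x); first by rewrite hK // mulr1.
  rewrite w0 // modC0; have /andP[h0 _] := h01 x; rewrite mulr_ge0 //.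
  exact: le_trans (modC_ge0 _) (wB x).
rewrite mulr_suml; apply: modC_sum_le => k.
rewrite modCM modC_iX mul1r mulrDl ![_ * B]mulrC (le_trans (modCD _ _)) //.
rewrite modCM modC_i mul1r !modC_toC; apply: lerD; apply: bnd => // x.
  exact: le_reC_modC.
exact: le_imC_modC.
Qed.

Lemma test_fun_component (w : cform R N) : test_form W 0 0 w -> test_fun W (fun x => w x finset.set0).
Proof.
move=> [sw _ [K [cK KW w0]]]; apply/test_funE; split; first exact: sw.
by exists K; split => // x /w0 ->; rewrite ffunE.
Qed.

Lemma measure_functional_current : current W N N measure_functional.
Proof.
have hJ k := Rintegral_positive_functional oW (mfin k).
rewrite /current subnn; split=> [c v w tv tw|K cK KW].
  have [va vb] := test_fun_parts (test_fun_component tv).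
  have [wa wb] := test_fun_parts (test_fun_component tw).
  rewrite /measure_functional mulr_sumr -big_split; apply: eq_bigr => k _ /=.
  rewrite (_ : (fun x => reC _) = fun x =>
    reC c * reC (v x finset.set0) + (- imC c * imC (v x finset.set0) + reC (w x finset.set0)));
    last by apply/funext => x; rewrite !ffunE reCD reCM mulNr addrA.
  rewrite (_ : (fun x => imC _) = fun x =>
    reC c * imC (v x finset.set0) + (imC c * reC (v x finset.set0) + imC (w x finset.set0)));
    last by apply/funext => x; rewrite !ffunE imCD imCM addrA.
  rewrite !(pos_fun_linear (hJ k)) //.
  - rewrite [c in RHS]CplxE !toCD !toCM toCN.
    have ii : 'i * 'i = -1 :> Cplx R by rewrite -expr2 sqrCi.
    move: (toC (reC c)) (toC (imC c)) => a b.
    move: (toC _) (toC _) (toC _) (toC _) => p q s t.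
    move: ('i ^+ k) => J; move: 'i ii => I ii.
    rewrite [RHS](_ : _ = J * (a * t + a * I * s + b * I * t + I * I * b * s + (q + I * p))).
      by rewrite ii; ring.
    by ring.
  - by apply: real_testD => //; exact: real_testZ.
  - by apply: real_testD => //; exact: real_testZ.
have [C hC] := measure_functional_bound cK KW.
exists 0%N, C => w B tw w0 wB; apply: hC.
- exact: test_fun_component.
- by move=> x /w0 ->; rewrite ffunE.
- by move=> x; exact: (wB [::]).
Qed.

Lemma measure_functional_order0 : order0 W measure_functional.
Proof.
move=> K cK KW; have [C hC] := measure_functional_bound cK KW.
exists C => f B tf f0 fB; apply: hC.
- by apply: test_fun_component; exact: tf.
- by move=> x /f0; rewrite zform_set0.
- by move=> x; rewrite zform_set0.
Qed.

Lemma measure_functional_represents : represents W mu measure_functional.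
Proof.
split=> // f tf; rewrite /measure_functional; apply: eq_bigr => k _.
have Er : (fun x => reC (zform f x finset.set0)) = (fun x => reC (f x)).
  by apply/funext => x; rewrite zform_set0.
have Ei : (fun x => imC (zform f x finset.set0)) = (fun x => imC (f x)).
  by apply/funext => x; rewrite zform_set0.
by rewrite Er Ei.
Qed.

End MeasureCurrents.

(** * Uniform bounds from the mass hypothesis, and convergence of sums *)

Section Assembly.
Variables (R : realType) (d n : nat) (chi : R -> R) (hchi : cutoff chi).
Local Notation CN := (Cn R (d + n)).

Lemma wpow_omegaV r (y : Cn R d) :
  wpow (@omegaV R d) r y = toC (pi^-1 ^+ r) *: kahler_pow R finset.setT r.
Proof.
have oE : @omegaV R d y = toC pi^-1 *: kahler R finset.setT.
  have := @real_ddc_radial R d finset.setT id (fun=> 1) 0 y.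
  rewrite (_ : (fun z => id (radsq finset.setT z)) = @sqnorm R d); last first.
    by apply/funext => z; exact: radsq_setT.
  rewrite /omegaV => -> //.
  - by rewrite /radial_form toC1 toC0 scale1r scale0r addr0.
  - by apply: (@filterS _ (nbhs y) _ setT _ _ filterT) => z _; exact: is_derive_id.
rewrite wpowE oE; elim: r => [|r ih]; first by rewrite expr0 toC1 scale1r.
rewrite /= ih wedgeZl wedgeZr scalerA exprS toCM.
by rewrite -[wedge _ _]/(kahler_pow R finset.setT r.+1).
Qed.

Lemma omegaV_weight r : slice_weight r (wpow (@omegaV R d) r).
Proof.
have E := wpow_omegaV r; split=> [|y|y].
- have h := @smooth_form_cst R d setT (toC (pi^-1 ^+ r) *: kahler_pow R finset.setT r).
  by apply: (smooth_form_eq openT _ h) => y _; rewrite E.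
- rewrite E; apply: bidegreeZ; elim: r {E} => [|r ih]; first exact: bidegree_one.
  by apply: (@bidegree_wedge _ _ 1 1) ih; rewrite kahlerE; exact: bidegree_herm.
- rewrite E; apply: pos_combZ; last exact: pos_comb_kahler_pow.
  by rewrite exprn_ge0 // invr_ge0 pi_ge0.
Qed.

(** The factor pi^r undoes the normalisation of dd^c in omega_V^r. *)
Lemma omegaV_dominates r (C : R) (c : covec R d) y :
  pos_comb r (toC C *: kahler_pow R finset.setT r - c) ->
  pos_comb r (toC (C * pi ^+ r) *: wpow (@omegaV R d) r y - c).
Proof.
rewrite wpow_omegaV scalerA -toCM -mulrA -exprMn mulfV ?expr1n ?mulr1 //.
by rewrite gt_eqF // pi_gt0.
Qed.

(** Since psi <= C0 omega_V^r, the slices of psi on subunit functions are at most C0 times those of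
    omega_V^r, which the local mass bounds control; [family_bounded] then glues. *)
Lemma slice_family_bounded (U : set CN) (p m r : nat) (T : functional R (d + n))
  (psi : cform R d) (C0 r0 : R) :
  current U p p T -> positive_current U p T -> (d + n - p = m + r)%N ->
  slice_weight r psi -> 0 <= C0 ->
  (forall y, pos_comb r (toC C0 *: wpow (@omegaV R d) r y - psi y)) ->
  locally_uniformly_bounded_mass U
    [set theta : Cplx R | 0 < modC theta < r0]
    (fun theta => cwedge T (wform (@Kform R d n chi theta m)
       (form_pullback (@bpart R d n) (wpow (@omegaV R d) r)))) ->
  forall f, real_test U f -> exists B : R, forall theta : Cplx R, 0 < modC theta < r0 ->
    `|slice chi T (- ln (modC theta)) m psi f| <= B.
Proof.
move=> cT pT mr wpsi C00 dom hmass.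
have wO := omegaV_weight r.
apply: (@family_bounded R chi hchi _ U (Cplx R) [set theta | 0 < modC theta < r0]
  (fun theta => slice chi T (- ln (modC theta)) m psi)).
  by move=> theta _; exact: (slice_positive_functional hchi cT pT mr).
move=> x Ux; have [G [C [oG Gx GU hG]]] := hmass x Ux.
exists G, (C0 * C); split => // theta h Dt [th h01].
have thU : real_test U h by exact: real_test_sub th.
have h0 z : 0 <= h z by have /andP[] := h01 z.
have le1 := slice_le hchi cT pT mr (- ln (modC theta)) wpsi wO C00 dom thU h0.
apply: (le_trans le1); apply: ler_wpM2l => //.
have tf : test_fun G (fun z => toC (h z)) by exact/real_testP.
have h1 z : modC (toC (h z)) <= 1.
  by rewrite modC_toC ger0_norm //; have /andP[] := h01 z.
have := hG theta Dt _ tf h1; rewrite /cwedge (sliced_Kform hchi).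
by apply: le_trans; rewrite /slice (le_trans (ler_norm _)) // le_reC_modC.
Qed.

Lemma cvg_sum_Cplx I (s : seq I) (u : I -> nat -> Cplx R) (l : I -> Cplx R) :
  (forall i, u i @ \oo --> l i) ->
  (fun k => \sum_(i <- s) u i k) @ \oo --> \sum_(i <- s) l i.
Proof.
move=> ul; elim: s => [|i s ih].
  by rewrite big_nil; under eq_fun do rewrite big_nil; exact: cvg_cst.
by rewrite big_cons; under eq_fun do rewrite big_cons; exact: cvgD (ul i) ih.
Qed.

Lemma cvg_toC_pair (u v : nat -> R) a b (z : Cplx R) :
  u @ \oo --> a -> v @ \oo --> b ->
  (fun k => z * (toC (u k) + 'i * toC (v k))) @ \oo --> z * (toC a + 'i * toC b).
Proof.
move=> ua vb; apply: cvgMl_tmp; apply: cvgD.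
  exact: (cvg_comp _ _ ua (@toC_continuous R a)).
by apply: cvgMl_tmp; exact: (cvg_comp _ _ vb (@toC_continuous R b)).
Qed.

End Assembly.

Theorem proposition2p8 (R : realType) (d n : nat) (hn : (0 < n)%N)
    (chi : R -> R) (hchi : cutoff chi) :
  exists2 M0 : R, 0 < M0 & forall M : R, M0 <= M ->
  forall (U : set (Cn R (d + n))),
    open U -> connected U ->
    U `<=` normal_bundle U ->
    bounded_in (base U) -> simply_connected (base U) ->
    smooth_boundary (base U) ->
  forall (p : nat) (T Tinf : functional R (d + n)),
    (p <= d + n)%N ->
    current U p p T -> positive_current U p T -> closed_current U p T ->
    tangent_current U p T Tinf ->
  forall m : nat, (n - p <= m)%N -> (m <= minn (d + n - p) n)%N ->
    (exists2 r0 : R, 0 < r0 &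
       locally_uniformly_bounded_mass U
         [set theta : Cplx R | 0 < modC theta < r0]
         (fun theta => cwedge T (wform (@Kform R d n chi theta m)
            (form_pullback (@bpart R d n) (wpow (@omegaV R d) (d + n - p - m)))))) ->
  forall phi : cform R d,
    test_form (base U) (d + n - p - m) (d + n - p - m) phi ->
  exists theta : nat -> Cplx R,
    [/\ forall k, theta k != 0,
     theta @ \oo --> (0 : Cplx R) &
     exists L : functional R (d + n),
       [/\ current U (d + n) (d + n) L,
        order0 U L,
        forall f : Cn R (d + n) -> Cplx R, test_fun U f ->
          (fun k => cwedge T (wform (@Kform R d n chi (theta k) m)
             (form_pullback (@bpart R d n) phi)) (zform f)) @ \oo --> L (zform f) &
        exists c : Cplx R,
          total_mass_on U L (zero_section U) c /\
          compactified_pushforward_pairing U Tinf (@Omega R n chi M m) phi c]].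
Proof.
exists 1 => // M _ U oU _ UE _ _ _ p T Tinf _ cT pT _ [cTinf pTinf _ [lam [lam0 lamy lamT]]]
  m _ mle [r0 r00 hmass] phi tphi.
set r := (d + n - p - m)%N.
have mr : (d + n - p = m + r)%N.
  by rewrite /r subnKC //; apply: (leq_trans mle); exact: geq_minl.
have oB := open_base oU.
have oE := open_normal_bundle oU.
have [g [C [C0 tg pg dom gE]]] := test_form_positive_split hchi oB tphi.
have wg k : slice_weight r (g k) by have [sg bg _] := tg k; split.
have supp k : exists K : set (Cn R d), [/\ compact K, K `<=` base U &
    forall y, ~ K y -> g k y = 0] by have [_ _] := tg k.
pose th j : Cplx R := toC (expR (- M)) / lam j.
have thE j : modC (th j) = expR (- M) / modC (lam j).
  by rewrite modCM modCV modC_toC ger0_norm // expR_ge0.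
have lam1 j : 0 < modC (lam j) by rewrite modC_gt0.
have th1 j : 0 < modC (th j) by rewrite thE divr_gt0 ?expR_gt0.
have lnth j : - ln (modC (th j)) = M + ln (modC (lam j)).
  by rewrite thE ln_div ?posrE ?expR_gt0 // expRK opprB opprK addrC.
have small e : 0 < e -> \forall j \near \oo, modC (th j) < e.
  move=> e0; have : \forall j \near \oo, expR (- M) / e + 1 <= modC (lam j) by exact: (cvgry_ge lamy).
  apply: filterS => j h; rewrite thE ltr_pdivrMr // mulrC -ltr_pdivrMr //.
  by apply: lt_le_trans h; rewrite ltrDl.
(* From index j0 on, |theta_j| < r0, the range where the mass hypothesis applies; the sequence is
   shifted accordingly. *)
have [j0 _ hj0] := small r0 r00.
have bnd k f : real_test U f -> exists B : R, forall j, `|slice chi T (M + ln (modC (lam (j0 + j)%N))) m (g k) f| <= B.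
  move=> tf; have Cpi : 0 <= C * pi ^+ r by rewrite mulr_ge0 // exprn_ge0 // pi_ge0.
  have dom' y := omegaV_dominates y (dom k y).
  have [B hB] := slice_family_bounded hchi cT pT mr (wg k) Cpi dom' hmass tf.
  exists B => j; rewrite -lnth; apply: hB; rewrite th1 /=.
  by apply: hj0 => /=; exact: leq_addr.
pose L0 (k : 'I_4) j := slice chi T (M + ln (modC (lam (j0 + j)%N))) m (g k).
have hL0 k j : positive_functional U (L0 k j) by exact: (slice_positive_functional hchi cT pT mr).
have bL0 k f : real_test U f -> exists B, forall j, `|L0 k j f| <= B by exact: bnd.
(* A single extraction serves the four positive pieces of phi. *)
have [s sk scvg] := functional_subsequence oU hchi hL0 bL0.
pose ix i := (j0 + s i)%N.
have ixk i : (i <= ix i)%N by rewrite (leq_trans (sk i)) // leq_addl.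
have ixc := cvg_nat_ge ixk.
pose Lk (k : 'I_4) f := limn (fun i => L0 k (s i) f).
have cLk k f : real_test U f -> (fun i => L0 k (s i) f) @ \oo --> Lk k f by exact: scvg.
have hLk k : positive_functional U (Lk k).
  exact: (limit_positive_functional (fun i => hL0 k (s i)) (scvg k)).
pose mu k := riesz_measure (hLk k) oU hchi.
pose Jk (k : 'I_4) := slice chi Tinf M m (g k).
have hJk k : positive_functional (normal_bundle U) (Jk k).
  exact: (slice_positive_functional hchi cTinf pTinf mr).
pose nu k := riesz_measure (hJk k) oE hchi.
have mufin k (K : set (Cn R (d + n))) : compact K -> K `<=` U -> (mu k K < +oo)%E.
  exact: riesz_measure_compact.
have nufin k (K : set (Cn R (d + n))) : compact K -> K `<=` normal_bundle U -> (nu k K < +oo)%E.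
  exact: riesz_measure_compact.
(* The convergence to T_infty survives along the extracted subsequence of lambda, so the comparison
   applies to each piece separately. *)
have mass k : mu k (zero_section U) = nu k (normal_bundle U) /\
    (nu k (normal_bundle U) < +oo)%E.
  have [K [cK KU gK]] := supp k.
  apply: (@slice_mass_exchange R d n chi hchi U oU p m r T Tinf cT pT cTinf pTinf mr
    (fun i => lam (ix i)) M _ _ _ (g k) (wg k) K cK KU gK (Lk k) (hLk k)).
  - by move=> i; exact: lam0.
  - exact: (cvg_comp _ _ ixc lamy).
  - by move=> w tw; exact: (cvg_comp _ _ ixc (lamT w tw)).
  - by move=> f tf; exact: cLk.
  - by move=> f tf; have [B hB] := bL0 k f tf; exists B => i; exact: hB.
exists (fun i => th (ix i)); split=> [i||].
- by rewrite -modC_gt0.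
- have : (fun j => th j) @ \oo --> (0 : Cplx R).
    move=> A /nbhs_CplxP[e e0 he]; apply: filterS (small e e0) => j h.
    by apply: he; rewrite sub0r modCN.
  by move=> h; exact: (cvg_comp _ _ ixc h).
(* The limit is defined from the four limit measures, which makes it a current of order 0; that the
   sequence converges to it is then checked on test functions. *)
exists (measure_functional U mu); split.
- exact: (measure_functional_current oU hchi mufin).
- exact: (measure_functional_order0 oU hchi mufin).
- move=> f tf; have [ta tb] := test_fun_parts tf.
  have [_ ->] := measure_functional_represents mufin; last exact: tf.
  have E i : cwedge T (wform (@Kform R d n chi (th (ix i)) m)
      (form_pullback (@bpart R d n) phi)) (zform f) =
    \sum_(k < 4) 'i ^+ k * (toC (L0 k (s i) (fun x => reC (f x)))
      + 'i * toC (L0 k (s i) (fun x => imC (f x)))).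
    rewrite /cwedge (sliced_Kform hchi) lnth.
    rewrite (sliced_split hchi cT mr _ tf wg gE); apply: eq_bigr => k _.
    by rewrite (slice_complex hchi cT pT mr _ (wg k) tf oU).
  under eq_fun do rewrite E.
  apply: cvg_sum_Cplx => k; apply: cvg_toC_pair.
    by rewrite -(riesz_representation (hLk k) oU hchi ta); exact: cLk.
  by rewrite -(riesz_representation (hLk k) oU hchi tb); exact: cLk.
(* The value of the decomposition [mu] on V, equal to that of [nu] on E term by term. *)
exists (\sum_(k < 4) 'i ^+ k * toC (fine (mu k (zero_section U)))); split.
  exists mu; split=> [|k|//]; first exact: (measure_functional_represents mufin).
  by have [-> ] := mass k.
exists nu; split=> [|k|].
- split=> // f tf; rewrite /cwedge (sliced_Omega hchi).
  have [ta tb] := test_fun_parts tf.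
  rewrite (sliced_split hchi cTinf mr _ tf wg gE); apply: eq_bigr => k _.
  rewrite (slice_complex hchi cTinf pTinf mr _ (wg k) tf oE).
  rewrite -(riesz_representation (hJk k) oE hchi ta).
  by rewrite -(riesz_representation (hJk k) oE hchi tb).
- by have [] := mass k.
by apply: eq_bigr => k _; have [-> _] := mass k.
Qed.
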